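(* Let $\Gamma$ be a compact connected metric graph having no loops or multiple edges, with measure $\mu_\Gamma$ as in the context. Let $u_0=dh_0$ with $h_0\in W^{1,2}(X_\Gamma,\mu_\Gamma)$ and let $u(t)$, $t\geq 0$, be the unique solution (in the sense specified in the context) to the vector Burgers Cauchy problem with initial condition $u_0$, that is, $u(t)=-2\,d\log w(t)$ with $w(t)=e^{t\mathcal{L}_\Gamma}e^{-h_0/2}$. Assume in addition that $h_0(s_0)=0$ for some $s_0\in X_\Gamma$. (i) We have $$\sup_{t>0}\|u(t)\|_{L^2(X_\Gamma,\mu_\Gamma)}\le c_1\|u_0\|_{L^2(X_\Gamma,\mu_\Gamma)}\,e^{c_2\|u_0\|_{L^2(X_\Gamma,\mu_\Gamma)}}$$ with positive constants $c_1$ and $c_2$ independent of $u_0$. (ii) If $\widetilde u_0=d\widetilde h_0$ is another initial condition with $\widetilde h_0\in W^{1,2}(X_\Gamma,\mu_\Gamma)$ such that $\widetilde h_0(s_0)=0$, and $\widetilde u$ is the corresponding solution, then $$\sup_{t>0}\|u(t)-\widetilde u(t)\|_{L^2(X_\Gamma,\mu_\Gamma)}\le c_3\big(\|u_0\|_{L^2(X_\Gamma,\mu_\Gamma)}+1\big)^2e^{c_4(\|u_0\|_{L^2(X_\Gamma,\mu_\Gamma)}+\|\widetilde u_0\|_{L^2(X_\Gamma,\mu_\Gamma)})}\|u_0-\widetilde u_0\|_{L^2(X_\Gamma,\mu_\Gamma)}$$ with positive constants $c_3$ and $c_4$ independent of $u_0$ and $\widetilde u_0$.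
   Context: Metric graph. $\Gamma=(E,V,i,j)$ consists of a finite set $E$ of edges, each edge $e$ being identified with an open interval $(0,l_e)$, $0<l_e<+\infty$, a finite set $V$ of vertices, and maps $i,j:E\to V$ giving the initial and terminal vertex of each edge. No loops: $i(e)\neq j(e)$ for all $e$. No multiple edges: $\{i(e),j(e)\}\neq\{i(e'),j(e')\}$ for $e\neq e'$. Connected: any two vertices are joined by a chain of vertices in which consecutive ones are incident to a common edge. $X_\Gamma=V\cup\bigcup_{e\in E}\{e\}\times(0,l_e)$ is the associated compact metric space, obtained by gluing the closed intervals $[0,l_e]$ at their endpoints according to $0\mapsto i(e)$, $l_e\mapsto j(e)$. A function $f$ on $X_\Gamma$ is identified with the family $(f_e)_{e\in E}$ of its restrictions to the edges, regarded as functions on $(0,l_e)$. We write $e\sim p$ if $p\in V$ is an endpoint of $e$. Measure. Fix positive real numbers $(c_e)_{e\in E}$; $\mu_\Gamma$ is the measure on $X_\Gamma$ equal to $c_e$ times Lebesgue measure on each edge $e$, and not charging vertices. Energy. $\mathcal{E}_\Gamma(f)=\sum_{e\in E}\int_0^{l_e}(f_e'(s))^2\,ds$, and $W^{1,2}(X_\Gamma,\mu_\Gamma)$ is the space of all $f\in C(X_\Gamma)$ such that each $f_e$ has a distributional derivative in $L^2(0,l_e)$, normed by $\|f\|_{W^{1,2}(X_\Gamma,\mu_\Gamma)}=(\mathcal{E}_\Gamma(f)+\|f\|_{L^2(X_\Gamma,\mu_\Gamma)}^2)^{1/2}$. $(\mathcal{E}_\Gamma,W^{1,2}(X_\Gamma,\mu_\Gamma))$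 is a Dirichlet form on $L^2(X_\Gamma,\mu_\Gamma)$; $\mathcal{L}_\Gamma$ denotes its generator, the nonpositive self-adjoint operator with $\mathcal{E}_\Gamma(f,g)=-\langle\mathcal{L}_\Gamma f,g\rangle_{L^2(X_\Gamma,\mu_\Gamma)}$ (the Kirchhoff Laplacian), and $e^{t\mathcal{L}_\Gamma}$ the associated semigroup. Operators. $d:W^{1,2}(X_\Gamma,\mu_\Gamma)\to L^2(X_\Gamma,\mu_\Gamma)$, $(df)_e=c_e^{-1/2}f_e'$; then $\langle df,dg\rangle_{L^2(X_\Gamma,\mu_\Gamma)}=\mathcal{E}_\Gamma(f,g)$. $d$ is a densely defined closed operator on $L^2(X_\Gamma,\mu_\Gamma)$ with domain $W^{1,2}(X_\Gamma,\mu_\Gamma)$. Its adjoint $d^\ast$ is given by $(d^\ast f)_e=-c_e^{-1/2}f_e'$ on the domain $\mathcal{D}(d^\ast)$ of all $f\in L^2(X_\Gamma,\mu_\Gamma)$ such that each $f_e$ has a weak derivative in $L^2(0,l_e)$ and $\sum_{e\sim p}c_e^{1/2}U_p(e)f_e(p)=0$ for all $p\in V$, where $f_e(p)$ is the trace of $f_e$ at $p$, $U_p(e)=1$ if $p=j(e)$ and $U_p(e)=-1$ if $p=i(e)$. The vector Laplacian is $\vec{\mathcal{L}}_\Gamma v=-dd^\ast v$ with domain $\mathcal{D}(\vec{\mathcal{L}}_\Gamma)=\{v\in\mathcal{D}(d^\ast): d^\ast v\in W^{1,2}(X_\Gamma,\mu_\Gamma)\}$. Vector Burgers Cauchy problem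 and solution. The problem is $u_t(t)=\vec{\mathcal{L}}_\Gamma u(t)-\frac12 d(u^2)(t)$, $t>0$, $u(0)=u_0$. A function $u\in C([0,+\infty),L^2(X_\Gamma,\mu_\Gamma))\cap C^1((0,+\infty),L^2(X_\Gamma,\mu_\Gamma))$ is a solution with initial condition $u_0\in L^2(X_\Gamma,\mu_\Gamma)$ if $u(0)=u_0$ in $L^2(X_\Gamma,\mu_\Gamma)$ and the equation holds in the distributional sense, tested against $\mathcal{D}(\vec{\mathcal{L}}_\Gamma)$, i.e. for all $t>0$ and all $v\in\mathcal{D}(\vec{\mathcal{L}}_\Gamma)$, $$\langle u_t(t),v\rangle_{L^2(X_\Gamma,\mu_\Gamma)}=-\langle u(t),d\,d^\ast v\rangle_{L^2(X_\Gamma,\mu_\Gamma)}-\frac12\int_{X_\Gamma}(d^\ast v)\,u(t)^2\,d\mu_\Gamma .$$ For initial conditions $u_0=dh_0$, $h_0\in W^{1,2}(X_\Gamma,\mu_\Gamma)$, the solution exists, is unique, and is given by the formula in the claim. *)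

(* Defs.v *)
From HB Require Import structures.
From mathcomp Require Import all_boot all_order all_algebra.
From mathcomp Require Import all_classical all_reals all_analysis.
From mathcomp Require Import measurable_realfun.

Set Implicit Arguments.
Unset Strict Implicit.
Unset Printing Implicit Defensive.

Import Order.TTheory GRing.Theory Num.Theory.
Import numFieldNormedType.Exports.

Local Open Scope classical_set_scope.
Local Open Scope ring_scope.

(* The edge [e] is identified with the open interval (0, len e). *)
Record metricGraph (R : realType) := MetricGraph {
  vertex : finType;
  edge : finType;
  src : edge -> vertex;
  tgt : edge -> vertex;
  len : edge -> R;
  len_gt0 : forall e, 0 < len e;
  vertex_gt0 : (0 < #|vertex|)%N;
  no_loop : forall e, src e != tgt e;
  no_multiedge : forall e e', e != e' ->
    [set src e; tgt e]%SET != [set src e'; tgt e']%SET;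
  chain_connected : forall p q, connect
    (fun p' q' => [exists e, (p' \in [set src e; tgt e]%SET) &&
                             (q' \in [set src e; tgt e]%SET)]) p q }.

Inductive graph_space (R : realType) (G : metricGraph R) : Type :=
| Vertex of vertex G
| Inner (e : edge G) (s : R) of 0 < s < len e.

Section Space.
Context {R : realType} {G : metricGraph R}.

(* Parametrization of the closed edge [e] by [0, len e], extended to the line
   by constants. *)
Definition edge_param (e : edge G) (s : R) : graph_space G :=
  match boolP (0 < s < len e) with
  | AltTrue h => Inner h
  | AltFalse _ => if s <= 0 then Vertex (src e) else Vertex (tgt e)
  end.

HB.instance Definition _ := gen_eqMixin (graph_space G).
HB.instance Definition _ := gen_choiceMixin (graph_space G).
HB.instance Definition _ := isPointed.Build (graph_space G)
  (Vertex (enum_val (Ordinal (vertex_gt0 G)))).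

(* The gluing topology, i.e., the final topology for the parametrizations of
   the closed edges. As [edge_param e] is constant on each side of
   [0, len e], the preimage of U is open in the line iff its trace on
   [0, len e] is relatively open. *)
Definition space_open (U : set (graph_space G)) : Prop :=
  forall e, open (edge_param e @^-1` U).

Lemma space_openT : space_open setT.
Proof. by move=> e; rewrite preimage_setT; exact: openT. Qed.

Lemma space_openI U1 U2 :
  space_open U1 -> space_open U2 -> space_open (U1 `&` U2).
Proof. by move=> o1 o2 e; rewrite preimage_setI; exact: openI. Qed.

Lemma space_open_bigU (I : Type) (F : I -> set (graph_space G)) :
  (forall i, space_open (F i)) -> space_open (\bigcup_i F i).
Proof.
by move=> oF e; rewrite preimage_bigcup; apply: bigcup_open => i _; exact: oF.
Qed.

HB.instance Definition _ := isOpenTopological.Build (graph_space G)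
  space_openT space_openI space_open_bigU.

HB.instance Definition _ := Measurable.copy (graph_space G)
  (g_sigma_algebraType (@open (graph_space G))).

Lemma edge_param_continuous e : continuous (edge_param e).
Proof. by apply/continuousP => U oU; exact: oU. Qed.

Lemma measurable_edge_param e :
  measurable_fun [set: measurableTypeR R] (edge_param e).
Proof.
apply: (@measurability _ _ (measurableTypeR R) (graph_space G) setT (edge_param e)
  (@open (graph_space G))) => //.
move=> _ [U oU <-]; rewrite setTI.
by apply: open_measurable; exact: oU.
Qed.

End Space.

Section Measure.
Context {R : realType} {G : metricGraph R} (c : edge G -> {posnum R}).
Local Open Scope ereal_scope.

Definition edge_interval (e : edge G) : set R := `]0%R, len e[%classic.

Definition graph_measure (A : set (graph_space G)) : \bar R :=
  \sum_(e : edge G) (c e)%:num%:E *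
    lebesgue_measure (edge_interval e `&` edge_param e @^-1` A).

Let graph_measure0 : graph_measure set0 = 0.
Proof.
rewrite /graph_measure big1// => e _.
by rewrite preimage_set0 setI0 measure0 mule0.
Qed.

Let graph_measure_ge0 A : 0 <= graph_measure A.
Proof. by apply: sume_ge0 => e _; rewrite mule_ge0. Qed.

Let measurable_preim (e : edge G) (A : set (graph_space G)) : measurable A ->
  measurable (edge_interval e `&` edge_param e @^-1` A : set (measurableTypeR R)).
Proof.
move=> mA; apply: measurableI; first exact: measurable_itv.
by rewrite -[X in measurable X]setTI; exact: measurable_edge_param.
Qed.

Let graph_measure_sigma_additive : semi_sigma_additive graph_measure.
Proof.
move=> F mF tF mUF; rewrite [X in _ --> X](_ : _ =
    lim ((fun n => \sum_(0 <= i < n) graph_measure (F i)) @ \oo)).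
  by apply: is_cvg_ereal_nneg_natsum => k _; exact: graph_measure_ge0.
rewrite nneseries_sum; last by move=> *; rewrite mule_ge0.
apply: eq_bigr => /= e _.
rewrite nneseriesZl//; congr (_ * _).
rewrite preimage_bigcup setI_bigcupr.
apply: (@measure_semi_bigcup _ _ _ lebesgue_measure
  (fun i => edge_interval e `&` edge_param e @^-1` F i)).
- by move=> i; exact: measurable_preim.
- apply/trivIsetP => i j _ _ ij.
  move/trivIsetP : tF => /(_ i j I I ij) Fij.
  by rewrite setIACA setIid -preimage_setI Fij preimage_set0 setI0.
- by apply: bigcup_measurable => i _; exact: measurable_preim.
Qed.

HB.instance Definition _ := isMeasure.Build _ _ _ graph_measure
  graph_measure0 graph_measure_ge0 graph_measure_sigma_additive.

End Measure.

Section Analysis.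
Context {R : realType} {G : metricGraph R} (c : edge G -> {posnum R}).

Local Notation X := (graph_space G).
Local Notation mu := (graph_measure c).

(* A function on the space is given by its values at all points. Elements of
   L^2 are represented by functions, which are equal in L^2 iff they are
   equal mu-almost everywhere; the values at vertices do not matter. *)
Definition restr_edge (f : X -> R) (e : edge G) : R -> R :=
  f \o edge_param e.

Definition of_edges (g : edge G -> R -> R) : X -> R :=
  fun x => match x with Vertex _ => 0 | @Inner _ _ e s _ => g e s end.

Definition L2 (f : X -> R) : Prop := f \in Lfun mu 2%:E.

Definition L2norm (f : X -> R) : R := fine ('N[mu]_2%:E[EFin \o f])%E.

Definition L2dot (f g : X -> R) : R := \int[mu]_x (f x * g x).

(* C_c^infty of the open edge, with functions extended by 0 to the line *)
Definition test_function (e : edge G) (phi : R -> R) : Prop :=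
  (forall n x, derivable (derive1n n phi) x 1) /\
  exists a b, [/\ 0 < a, b < len e & forall x, phi x != 0 -> a <= x <= b].

Definition L2_edge (e : edge G) (g : R -> R) : Prop :=
  measurable_fun (edge_interval e) g /\
  (\int[lebesgue_measure]_(s in edge_interval e) ((g s) ^+ 2)%:E < +oo)%E.

Definition is_L2_deriv (e : edge G) (f g : R -> R) : Prop :=
  L2_edge e g /\
  forall phi, test_function e phi ->
    \int[lebesgue_measure]_(s in edge_interval e) (f s * derive1 phi s) =
    - \int[lebesgue_measure]_(s in edge_interval e) (g s * phi s).

(* A representative of the distributional derivative of the restriction to
   [e], when it is in L^2. *)
Definition edge_deriv (f : X -> R) (e : edge G) : R -> R :=
  xget (fun=> 0) [set g | is_L2_deriv e (restr_edge f e) g].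

Definition W12 (f : X -> R) : Prop :=
  continuous f /\ forall e, exists g, is_L2_deriv e (restr_edge f e) g.

Definition energy (f g : X -> R) : R :=
  \sum_(e : edge G) \int[lebesgue_measure]_(s in edge_interval e)
    (edge_deriv f e s * edge_deriv g e s).

(* [form_generator f g] : f is in the domain of the Kirchhoff Laplacian, the
   generator of the Dirichlet form [energy] with domain [W12], and its image
   is g. *)
Definition form_generator (f g : X -> R) : Prop :=
  [/\ L2 f, L2 g &
    exists2 f0, W12 f0 /\ f0 = f %[ae mu] &
      forall phi, W12 phi -> energy f0 phi = - L2dot g phi].

(* [T] is the strongly continuous semigroup of symmetric contractions of L^2
   whose infinitesimal generator is [form_generator]. *)
Definition is_heat_semigroup (T : R -> (X -> R) -> X -> R) : Prop :=
  [/\ [/\ forall (t : R) f, 0 <= t -> L2 f -> L2 (T t f),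
        forall (t a : R) f g, 0 <= t -> L2 f -> L2 g ->
          T t (fun x => a * f x + g x) =
            (fun x => a * T t f x + T t g x) %[ae mu],
        forall (t : R) f, 0 <= t -> L2 f -> L2norm (T t f) <= L2norm f &
        forall (t : R) f g, 0 <= t -> L2 f -> L2 g ->
          L2dot (T t f) g = L2dot f (T t g)],
      forall f, L2 f -> T 0 f = f %[ae mu],
      forall (s t : R) f, 0 <= s -> 0 <= t -> L2 f ->
        T (s + t) f = T s (T t f) %[ae mu],
      forall f, L2 f -> L2norm (fun x => T t f x - f x) @[t --> 0^'+] --> 0 &
      forall f g, L2 f -> L2 g ->
        (form_generator f g <->
         L2norm (fun x => t^-1 * (T t f x - f x) - g x) @[t --> 0^'+] --> 0)].

(* The operator d, with domain [W12]. *)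
Definition dop (f : X -> R) : X -> R :=
  of_edges (fun e s => (Num.sqrt (c e)%:num)^-1 * edge_deriv f e s).

(* The trace of the restriction to [e] at the endpoint [p] of [e] is the value
   at p of the continuous representative on the closed edge. *)
Definition edge_rep (f : X -> R) (e : edge G) : R -> R :=
  xget (fun=> 0) [set g | {within `[0, len e], continuous g} /\
    g = restr_edge f e %[ae lebesgue_measure in edge_interval e]].

Definition edge_trace (f : X -> R) (e : edge G) (p : vertex G) : R :=
  edge_rep f e (if p == src e then 0 else len e).

Definition orientation (p : vertex G) (e : edge G) : R :=
  if p == tgt e then 1 else -1.

Definition dom_dadj (f : X -> R) : Prop :=
  [/\ L2 f,
      forall e, exists g, is_L2_deriv e (restr_edge f e) g &
      forall p, \sum_(e : edge G | p \in [set src e; tgt e]%SET)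
        Num.sqrt (c e)%:num * orientation p e * edge_trace f e p = 0].

(* The operator d^*, with domain [dom_dadj]. *)
Definition dadj (f : X -> R) : X -> R :=
  of_edges (fun e s => - (Num.sqrt (c e)%:num)^-1 * edge_deriv f e s).

(* [dom_vecLaplacian v psi] : v is in the domain of the vector Laplacian
   - d d^*, and psi is the continuous representative of d^* v. *)
Definition dom_vecLaplacian (v psi : X -> R) : Prop :=
  [/\ dom_dadj v, W12 psi & psi = dadj v %[ae mu]].

(* u is in C([0, +oo), L^2) and in C^1((0, +oo), L^2), with time derivative
   ut, and solves the vector Burgers Cauchy problem. *)
Definition burgers_solution (u0 : X -> R) (u : R -> X -> R) : Prop :=
  [/\ forall t : R, 0 <= t -> L2 (u t),
      forall t : R, 0 <= t ->
        L2norm (fun x => u s x - u t x)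
          @[s --> within [set s | 0 <= s] (nbhs t)] --> 0,
      u 0 = u0 %[ae mu] &
      exists ut : R -> X -> R,
      [/\ forall t : R, 0 < t -> L2 (ut t),
          forall t : R, 0 < t ->
            L2norm (fun x => h^-1 * (u (t + h) x - u t x) - ut t x)
              @[h --> 0^'] --> 0,
          forall t : R, 0 < t ->
            L2norm (fun x => ut s x - ut t x) @[s --> t] --> 0 &
          forall (t : R) v psi, 0 < t -> dom_vecLaplacian v psi ->
            L2dot (ut t) v =
              - L2dot (u t) (dop psi) -
              2^-1 * \int[mu]_x (psi x * u t x ^+ 2)]].

(* u(t) = - 2 d log w(t), where w(t) is the representative in W^{1,2} of
   T_t e^{- h0 / 2}. *)
Definition cole_hopf (T : R -> (X -> R) -> X -> R) (h0 : X -> R)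
    (u : R -> X -> R) : Prop :=
  exists w : R -> X -> R, forall t : R, 0 <= t ->
    [/\ W12 (w t),
        w t = T t (fun x => expR (- h0 x / 2)) %[ae mu] &
        u t = (fun x => - 2 * dop (fun y => ln (w t y)) x) %[ae mu]].

(* The unique solution with initial condition d h0, which is characterized
   both by the Cauchy problem and by the Cole-Hopf formula. *)
Definition the_burgers_solution (T : R -> (X -> R) -> X -> R) (h0 : X -> R)
    (u : R -> X -> R) : Prop :=
  burgers_solution (dop h0) u /\ cole_hopf T h0 u.

End Analysis.

(* Main.v *)
Require Import Defs.
From mathcomp Require Import all_boot all_order all_algebra.
From mathcomp Require Import all_classical all_reals all_analysis.
From mathcomp Require Import measurable_realfun ring lra.
Import Order.TTheory GRing.Theory Num.Theory.
Import numFieldNormedType.Exports.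
Local Open Scope classical_set_scope.
Local Open Scope ring_scope.

Set Implicit Arguments.
Unset Strict Implicit.
Unset Printing Implicit Defensive.

(** By the Cole-Hopf formula, u(t) = - 2 d ln w(t), where w(t) is the image under
the heat semigroup T_t of w(0) = e^(-h0/2). As d is isometric from the energy
to the L^2 norm ([ip_dop]), the norm of u(t) is twice the square root of the
energy of ln w(t), and the theorem is about the heat flow of exponentials.

The first estimate. If w >= m > 0, then the energy of ln w is at most m^(-2)
times that of w ([energy_ln]), so a lower bound for w(t) and an upper bound for
its energy are enough. Since the graph is connected, a Sobolev function
oscillates by at most a constant times the square root of its energy ([osc_le]).
As h0 vanishes somewhere, |h0| <= M, where M is a multiple of the norm of u0.
Hence w(0) is at least e^(-M/2), and its energy is at most e^M times that of h0;
both bounds pass to w(t), by the minimum principle ([min_principle]) and the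
decay of energy ([energy_T]). This gives [solution_bound].

The second estimate. The derivative of ln w - ln w' is
(dw - dw') / w' + (w' - w) dw / (w w'), so that besides the previous bounds one
needs the energy and the supremum of w(t) - w'(t). By linearity this is the heat
flow of w(0) - w'(0): its energy and its L^2 norm decay, and together they
control the supremum by a Sobolev inequality ([sup_le], [sup_T]). Finally the
size of w(0) - w'(0) is estimated in terms of h0 - h0', in the same manner
([initial_diff]). This gives [solution_stability].

The semigroup is only known through its generator, so the two properties of the
heat flow are derived from that. For phi in the domain, let a(s) be the energy
of T_s phi. By symmetry and the Cauchy-Schwarz inequality,
a(s)^2 <= a(0) a(2s); as a is bounded, this forces a(s) <= a(0) ([doubling_le]).
The domain is dense for the energy ([dom_dense]), and duality extends the decay
to all Sobolev functions. As for the minimum principle, if phi >= a is in the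
domain, the integral of e^(-lam T_s phi) does not increase with s, because the
energy of f and e^(-lam f) is nonpositive ([generator_exp]). This is made precise
without differentiating the integral: by convexity of the exponential, backward
steps of length t/n increase it by o(1/n) ([orbit_exp]). So the integral of
e^(-lam T_t phi) is at most e^(-lam a) times the mass of the graph, and
lam -> +oo leaves no room for values of T_t phi below a.

On each edge, a continuous function with weak derivative g in L^2 is a primitive
of g ([weak_prim], by the lemma of du Bois-Reymond), and the rules of calculus
are proved for primitives ([prim_chain]). *)

(** * Square-integrable functions *)

(** A quadratic polynomial that takes no negative value has a nonpositive
discriminant: from this follow the Cauchy-Schwarz inequalities, for the product
of L^2 and for the energy. *)
Lemma discriminant_le (R : realType) (a b c : R) : 0 <= c ->
  (forall t, 0 <= a - 2 * t * b + t ^+ 2 * c) -> b ^+ 2 <= a * c.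
Proof.
rewrite le_eqVlt => /predU1P[<-|c0] H.
  rewrite mulr0; have [->|b0] := eqVneq b 0; first by rewrite expr0n.
  have := H ((a + 1) / (2 * b)).
  rewrite (_ : a - _ + _ = -1); first by rewrite oppr_ge0 ler10.
  by field.
have := H (b / c).
rewrite (_ : a - _ + _ = (a * c - b ^+ 2) / c); last by field; rewrite gt_eqF.
by rewrite pmulr_lge0 ?invr_gt0// subr_ge0.
Qed.

Section SquareIntegrable.
Context d (T : measurableType d) (R : realType).
Variables (mu : {measure set T -> \bar R}) (D : set T).
Hypothesis mD : measurable D.
Implicit Types (f g h k : T -> R) (a C : R).

(** The domain D is a parameter, so that this applies both to Lebesgue measure on
an interval and to the measure of the graph. *)
Definition sqint f :=
  measurable_fun D f /\ (\int[mu]_(x in D) ((f x) ^+ 2)%:E < +oo)%E.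

Definition ip f g := \int[mu]_(x in D) (f x * g x).

Lemma sqint_measurable f : sqint f -> measurable_fun D f.
Proof. by case. Qed.

Lemma sqint_sqr f : sqint f -> mu.-integrable D (EFin \o (fun x => f x ^+ 2)).
Proof.
case=> mf foo; apply/integrableP; split.
  by apply/measurable_EFinP; exact: measurable_funX.
by under eq_integral do rewrite /= ger0_norm ?sqr_ge0//.
Qed.

Lemma sqint_mul f g : sqint f -> sqint g ->
  mu.-integrable D (EFin \o (fun x => f x * g x)).
Proof.
move=> sf sg; apply: (@le_integrable _ _ _ _ _ mD _
  (EFin \o (fun x => f x ^+ 2 + g x ^+ 2))).
- by apply/measurable_EFinP/measurable_funM; apply: sqint_measurable.
- move=> x _ /=; rewrite lee_fin [leRHS]ger0_norm ?addr_ge0 ?sqr_ge0//.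
  rewrite normrM -(real_normK (num_real (f x))) -(real_normK (num_real (g x))).
  by have := sqr_ge0 (`|f x| - `|g x|); have := sqr_ge0 (`|f x| + `|g x|); nra.
- by apply: (@integrableD _ _ _ _ _ mD (EFin \o _) (EFin \o _));
    apply: sqint_sqr.
Qed.

Lemma sqint_le f g : measurable_fun D f -> (forall x, D x -> `|f x| <= `|g x|) ->
  sqint g -> sqint f.
Proof.
move=> mf fg [mg goo]; split => //; apply: le_lt_trans goo.
apply: ge0_le_integral => //.
- by move=> x _; rewrite lee_fin sqr_ge0.
- by apply/measurable_EFinP; exact: measurable_funX.
- by apply/measurable_EFinP; exact: measurable_funX.
- move=> x Dx; rewrite lee_fin.
  rewrite -(real_normK (num_real (f x))) -(real_normK (num_real (g x))).
  by rewrite lerXn2r ?nnegrE ?fg.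
Qed.

Lemma integrableD_EFin f g : mu.-integrable D (EFin \o f) ->
  mu.-integrable D (EFin \o g) -> mu.-integrable D (fun x => (f x + g x)%:E).
Proof. exact: integrableD. Qed.

Lemma integrableB_EFin f g : mu.-integrable D (EFin \o f) ->
  mu.-integrable D (EFin \o g) -> mu.-integrable D (fun x => (f x - g x)%:E).
Proof. exact: integrableB. Qed.

Lemma sqintZ a f : sqint f -> sqint (fun x => a * f x).
Proof.
move=> sf; split; first by apply: measurable_funM => //; apply: sqint_measurable.
under eq_integral do rewrite exprMn EFinM.
by apply: (integrable_lty mD); apply: integrableZl => //; apply: sqint_sqr.
Qed.

Lemma sqintD f g : sqint f -> sqint g -> sqint (fun x => f x + g x).
Proof.
move=> sf sg; split; first by apply: measurable_funD; apply: sqint_measurable.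
under eq_integral do rewrite sqrrD mulr2n.
apply: (integrable_lty mD); have fg := sqint_mul sf sg.
apply: integrableD_EFin; last exact: sqint_sqr.
by apply: integrableD_EFin; [exact: sqint_sqr|exact: integrableD_EFin].
Qed.

Lemma sqintB f g : sqint f -> sqint g -> sqint (fun x => f x - g x).
Proof.
move=> sf sg; under eq_fun do rewrite -mulN1r.
by apply: sqintD => //; exact: sqintZ.
Qed.

Lemma sqint_bdM C k f : measurable_fun D k -> (forall x, D x -> `|k x| <= C) ->
  sqint f -> sqint (fun x => k x * f x).
Proof.
move=> mk kC sf; apply: (@sqint_le _ (fun x => C * f x)); last exact: sqintZ.
  by apply: measurable_funM => //; apply: sqint_measurable.
by move=> x Dx; rewrite !normrM ler_wpM2r// (le_trans (kC _ Dx)) ?ler_norm.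
Qed.

Lemma sqint_bounded C k : (mu D < +oo)%E -> measurable_fun D k ->
  (forall x, D x -> `|k x| <= C) -> sqint k.
Proof.
move=> muD mk kC; have s1 : sqint (cst 1).
  split => //; apply: (integrable_lty mD).
  apply: (@measurable_bounded_integrable _ _ _ mu (fun=> 1 ^+ 2)) => //.
  by exists 1; split => // x x1 y _ /=; rewrite expr1n normr1 ltW.
rewrite (_ : k = (fun x => k x * cst 1 x)); last by apply/funext => x; rewrite mulr1.
exact: sqint_bdM mk kC s1.
Qed.

Lemma ipC f g : ip f g = ip g f.
Proof. by apply: eq_Rintegral => x _; rewrite mulrC. Qed.

Lemma ipDl f g h : sqint f -> sqint g -> sqint h ->
  ip (fun x => f x + g x) h = ip f h + ip g h.
Proof.
move=> sf sg sh; rewrite /ip -RintegralD//; try exact: sqint_mul.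
by apply: eq_Rintegral => x _; rewrite mulrDl.
Qed.

Lemma ipZl a f h : sqint f -> sqint h -> ip (fun x => a * f x) h = a * ip f h.
Proof.
move=> sf sh; rewrite /ip -RintegralZl//; try exact: sqint_mul.
by apply: eq_Rintegral => x _; rewrite mulrA.
Qed.

Lemma ipBl f g h : sqint f -> sqint g -> sqint h ->
  ip (fun x => f x - g x) h = ip f h - ip g h.
Proof.
move=> sf sg sh; rewrite /ip -RintegralB//; try exact: sqint_mul.
by apply: eq_Rintegral => x _; rewrite mulrBl.
Qed.

Lemma ipDr f g h : sqint f -> sqint g -> sqint h ->
  ip h (fun x => f x + g x) = ip h f + ip h g.
Proof. by move=> *; rewrite ipC ipDl// !(ipC h). Qed.

Lemma ipZr a f h : sqint f -> sqint h -> ip h (fun x => a * f x) = a * ip h f.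
Proof. by move=> *; rewrite ipC ipZl// !(ipC h). Qed.

Lemma ipBr f g h : sqint f -> sqint g -> sqint h ->
  ip h (fun x => f x - g x) = ip h f - ip h g.
Proof. by move=> *; rewrite ipC ipBl// !(ipC h). Qed.

Lemma ip_ge0 f : 0 <= ip f f.
Proof. by apply: Rintegral_ge0 => x _; rewrite -expr2 sqr_ge0. Qed.

Lemma ip_CS f g : sqint f -> sqint g -> ip f g ^+ 2 <= ip f f * ip g g.
Proof.
move=> sf sg; apply: discriminant_le; first exact: ip_ge0.
move=> t; have := ip_ge0 (fun x => f x - t * g x).
have st := sqintZ t sg; have sft := sqintB sf st.
rewrite ipBl// !ipBr// !ipZl// !ipZr// (ipC g f).
by congr (0 <= _); ring.
Qed.

Lemma ip_CS_norm f g : sqint f -> sqint g ->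
  `|ip f g| <= Num.sqrt (ip f f) * Num.sqrt (ip g g).
Proof.
move=> sf sg; rewrite -sqrtrM ?ip_ge0// -sqrtr_sqr ler_wsqrtr//.
exact: ip_CS.
Qed.

Lemma eq_ip f f' g g' : {in D, f =1 f'} -> {in D, g =1 g'} -> ip f g = ip f' g'.
Proof. by move=> ff' gg'; apply: eq_Rintegral => x Dx; rewrite ff' ?gg'. Qed.

Lemma eq_sqint f f' : {in D, f =1 f'} -> sqint f -> sqint f'.
Proof.
move=> ff' [mf foo]; split; first exact: eq_measurable_fun mf.
rewrite (_ : integral _ _ _ = \int[mu]_(x in D) ((f x) ^+ 2)%:E)%E //.
by apply: eq_integral => x Dx; rewrite ff'.
Qed.

Lemma ae_ip f f' g g' : sqint f -> sqint f' -> sqint g -> sqint g' ->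
  f = f' %[ae mu in D] -> g = g' %[ae mu in D] -> ip f g = ip f' g'.
Proof.
move=> sf sf' sg sg' ff' gg'; congr fine; apply: ae_eq_integral => //.
- exact: measurable_int (sqint_mul sf sg).
- exact: measurable_int (sqint_mul sf' sg').
- by apply: filterS2 ff' gg' => x + + Dx => /(_ Dx) -> /(_ Dx) ->.
Qed.

Lemma le_ip f g : measurable_fun D f -> (forall x, D x -> `|f x| <= `|g x|) ->
  sqint g -> ip f f <= ip g g.
Proof.
move=> mf fg sg; have sf := sqint_le mf fg sg.
apply: le_Rintegral => //; try exact: sqint_mul.
by move=> x Dx; rewrite -!expr2 -(real_normK (num_real (f x)))
  -(real_normK (num_real (g x))) lerXn2r ?nnegrE ?fg.
Qed.

(** The parallelogram identity with one term dropped. Losing a factor 2 allows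
one to work with squares of norms throughout. *)
Lemma ip_sqrD f g : sqint f -> sqint g ->
  ip (fun x => f x + g x) (fun x => f x + g x) <= 2 * ip f f + 2 * ip g g.
Proof.
move=> sf sg; have := ip_ge0 (fun x => f x - g x).
have sD := sqintD sf sg; have sB := sqintB sf sg.
by rewrite ipBl// !ipBr// ipDl// !ipDr// (ipC g f); lra.
Qed.

End SquareIntegrable.

(** * Primitives of square-integrable functions *)

Section Primitives.
Context {R : realType}.
Implicit Types (a b c l x y : R) (f g h k F : R -> R).
Local Notation leb := (@lebesgue_measure R).
Local Notation "'oo' a b" := (`]a, b[%classic : set (measurableTypeR R))
  (at level 10, a at level 9, b at level 9).

Lemma moo a b : measurable (oo a b).
Proof. exact: measurable_itv. Qed.
Hint Resolve moo : core.

Lemma leb_itv_fin a b : (leb (oo a b) < +oo)%E.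
Proof. by rewrite lebesgue_measure_itv/=; case: ifP => _; rewrite ?ltry. Qed.

Lemma leb_itv a b : a <= b -> fine (leb (oo a b)) = b - a.
Proof.
rewrite le_eqVlt => /predU1P[->|ab]; rewrite lebesgue_measure_itv/= lte_fin.
  by rewrite ltxx subrr.
by rewrite ab.
Qed.

Lemma sqint_cst a b (r : R) : sqint leb (oo a b) (fun=> r).
Proof.
by apply: (@sqint_bounded _ _ _ _ _ _ `|r|) => //; exact: leb_itv_fin.
Qed.

Lemma sqint_integrable a b g : sqint leb (oo a b) g ->
  leb.-integrable (oo a b) (EFin \o g).
Proof.
move=> sg; have := sqint_mul (moo _ _) (sqint_cst a b 1) sg.
by rewrite (_ : (fun x => 1 * g x) = g)//; apply/funext => x; rewrite mul1r.
Qed.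

Lemma sub_oo l a b : 0 <= a -> b <= l -> oo a b `<=` oo 0 l.
Proof. by move=> a0 bl; apply: subset_itvW. Qed.

Lemma sqint_sub l a b g : 0 <= a -> b <= l ->
  sqint leb (oo 0 l) g -> sqint leb (oo a b) g.
Proof.
move=> a0 bl [mg goo]; have sub := sub_oo a0 bl.
split; first exact: measurable_funS mg.
apply: le_lt_trans goo; apply: ge0_subset_integral => //.
  by apply/measurable_EFinP; exact: measurable_funX.
by move=> x _; rewrite lee_fin sqr_ge0.
Qed.

Lemma Rint_nil a g : \int[leb]_(x in oo a a) g x = 0.
Proof. by rewrite set_itv_ge ?Rintegral_set0// bnd_simp ltxx. Qed.

Lemma Rint_split a b c g : leb.-integrable (oo a c) (EFin \o g) ->
  a <= b -> b <= c ->
  \int[leb]_(x in oo a c) g x =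
  \int[leb]_(x in oo a b) g x + \int[leb]_(x in oo b c) g x.
Proof.
move=> ig; rewrite le_eqVlt => /predU1P[-> _|ab].
  by rewrite Rint_nil add0r.
rewrite le_eqVlt => /predU1P[->|bc].
  by rewrite Rint_nil addr0.
have iab : leb.-integrable (oo a b) (EFin \o g).
  by apply: integrableS ig => //; apply: subset_itvW => //; exact: ltW.
rewrite (Rintegral_itv_bndo_bndc iab).
have := @Rintegral_itvB R g (BRight a) (BLeft c) b ig.
rewrite !bnd_simp => /(_ (ltW ab) bc) H; rewrite -[X in _ + X]H.
by rewrite addrC subrK.
Qed.

Lemma ip_sub l a b g : 0 <= a -> b <= l -> sqint leb (oo 0 l) g ->
  ip leb (oo a b) g g <= ip leb (oo 0 l) g g.
Proof.
move=> a0 bl sg; apply: fine_le.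
- apply: integrable_fin_num => //; apply: sqint_mul => //; exact: sqint_sub sg.
- by apply: integrable_fin_num => //; apply: sqint_mul.
- apply: ge0_subset_integral => //; last exact: sub_oo.
    exact: measurable_int (sqint_mul (moo _ _) sg sg).
  by move=> x _; rewrite lee_fin -expr2 sqr_ge0.
Qed.

Lemma ip1 a b g : ip leb (oo a b) (fun=> 1) g = \int[leb]_(x in oo a b) g x.
Proof. by apply: eq_Rintegral => x _; rewrite mul1r. Qed.

Lemma ip11 a b : a <= b -> ip leb (oo a b) (fun=> 1) (fun=> 1) = b - a.
Proof. by move=> ab; rewrite ip1 Rintegral_cst// mul1r leb_itv. Qed.

Lemma Rint_CS a b g : a <= b -> sqint leb (oo a b) g ->
  `|\int[leb]_(x in oo a b) g x| <=
  Num.sqrt (b - a) * Num.sqrt (ip leb (oo a b) g g).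
Proof.
move=> ab sg; rewrite -ip1; apply: le_trans (ip_CS_norm _ _ _) _ => //.
  exact: sqint_cst.
by rewrite ip11.
Qed.

(** The continuous representative of a function of W^{1,2}(0, l), together with a
derivative: weak derivatives are brought to this form, in which calculus is
done, by [weak_prim]. *)
Definition is_prim l f g := sqint leb (oo 0 l) g /\
  forall a b, 0 <= a -> a <= b -> b <= l ->
    f b - f a = \int[leb]_(x in oo a b) g x.

Lemma prim_sqint l f g : is_prim l f g -> sqint leb (oo 0 l) g.
Proof. by case. Qed.

(** The Cauchy-Schwarz inequality on (a, b), which is the embedding of W^{1,2} into
the Hoelder space of exponent 1/2. *)
Lemma prim_holder l f g a b : is_prim l f g -> 0 <= a -> a <= b -> b <= l ->
  `|f b - f a| <= Num.sqrt (ip leb (oo 0 l) g g) * Num.sqrt (b - a).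
Proof.
move=> [sg fg] a0 ab bl; rewrite fg// mulrC.
apply: le_trans (Rint_CS ab (sqint_sub a0 bl sg)) _.
by rewrite ler_wpM2l// ler_wsqrtr// ip_sub.
Qed.

Lemma cvg_sqrt_dist x : Num.sqrt `|x - y| @[y --> x] --> (0 : R).
Proof.
have h : `|x - y| @[y --> x] --> `|x - x|.
  by apply: cvg_norm; apply: cvgB; [exact: cvg_cst|exact: cvg_id].
rewrite -[X in _ --> X]sqrtr0 -(normr0 R) -(subrr x).
exact: continuous_cvg (@sqrt_continuous R _) h.
Qed.

Lemma holder_continuous_in l f C :
  (forall a b, 0 <= a -> a <= b -> b <= l -> `|f b - f a| <= C * Num.sqrt (b - a)) ->
  {in `]0, l[%classic, continuous f}.
Proof.
move=> H x; rewrite inE/= in_itv/= => /andP[x0 xl].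
apply/cvgrPdist_le => /= e e0.
have : C * Num.sqrt `|x - y| @[y --> x] --> C * 0.
  by apply: cvgMr; exact: cvg_sqrt_dist.
rewrite mulr0 => /cvgrPdist_le /(_ _ e0) Ce.
near=> y.
have y0 : 0 <= y by apply: ltW; near: y; exact: lt_nbhsr.
have yl : y <= l by apply: ltW; near: y; exact: lt_nbhsl.
apply: (@le_trans _ _ (C * Num.sqrt `|x - y|)); last first.
  by apply: le_trans (ler_norm _) _; rewrite -normrN -sub0r; near: y.
have [xy|/ltW yx] := leP x y.
  by rewrite distrC (le_trans (H _ _ _ xy yl)) ?(ltW x0)// distrC ger0_norm ?subr_ge0.
by rewrite (le_trans (H _ _ _ yx _)) ?(ltW xl)// ger0_norm ?subr_ge0.
Unshelve. all: by end_near. Qed.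

Lemma holder_measurable l f C :
  (forall a b, 0 <= a -> a <= b -> b <= l -> `|f b - f a| <= C * Num.sqrt (b - a)) ->
  measurable_fun (oo 0 l) f.
Proof.
by move=> H; apply: open_continuous_measurable_fun => //; exact: holder_continuous_in H.
Qed.

(** Telescoping over a fine grid: the increments of D add up to at most e times
the total mass of m. This takes the place of differentiation almost
everywhere. *)
Lemma grid_constant l (D m : R -> R) : 0 <= l ->
  leb.-integrable (oo 0 l) (EFin \o m) -> (forall x, 0 <= m x) ->
  (forall e, 0 < e -> exists2 d, 0 < d & forall a b, 0 <= a -> a <= b -> b <= l ->
     b - a < d -> `|D b - D a| <= e * \int[leb]_(x in oo a b) m x) ->
  D l = D 0.
Proof.
move=> l0 im m0 H.
have im' b : b <= l -> leb.-integrable (oo 0 b) (EFin \o m).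
  by move=> bl; apply: integrableS im => //; exact: sub_oo.
set M := \int[leb]_(x in oo 0 l) m x.
have M0 : 0 <= M by apply: Rintegral_ge0.
suff De e : 0 < e -> `|D l - D 0| <= e * M.
  apply/eqP; rewrite -subr_eq0 -normr_le0.
  apply/ler_addgt0Pl => e e0; rewrite addr0.
  apply: le_trans (De (e / (M + 1)) _) _; first by rewrite divr_gt0// ltr_wpDl.
  rewrite mulrAC ler_pdivrMr ?ltr_wpDl// ler_pM2l//; lra.
move=> e0; have [d d0 {}H] := H _ e0.
(* n steps of length l / n < d *)
pose n := (Num.truncn (l / d)).+1.
have n0 : 0 < n%:R :> R by rewrite ltr0n.
have lnd : l / n%:R < d.
  rewrite ltr_pdivrMr// mulrC -ltr_pdivrMr//; exact: truncnS_gt.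
have st (k : nat) : k.+1%:R * (l / n%:R) - k%:R * (l / n%:R) = l / n%:R.
  by rewrite -mulrBl -natrB// subSnn mul1r.
have ln0 : 0 <= l / n%:R by rewrite divr_ge0// ltW.
suff Hk (k : nat) : (k <= n)%N -> `|D (k%:R * (l / n%:R)) - D 0| <=
    e * \int[leb]_(x in oo 0 (k%:R * (l / n%:R))) m x.
  by have := Hk _ (leqnn n); rewrite mulrC divfK// gt_eqF.
elim: k => [_|k IH kn].
  by rewrite mul0r subrr normr0 mulr_ge0 ?(ltW e0)// Rintegral_ge0.
have kl : k.+1%:R * (l / n%:R) <= l.
  by rewrite mulrCA -[leRHS]mulr1 ler_wpM2l// ler_pdivrMr// mul1r ler_nat.
have k0 (j : nat) : 0 <= j%:R * (l / n%:R) by rewrite mulr_ge0.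
have kk : k%:R * (l / n%:R) <= k.+1%:R * (l / n%:R).
  by rewrite ler_wpM2r// ler_nat.
rewrite (Rint_split (im' _ kl) (k0 k) kk) mulrDr.
rewrite -(subrKA (D (k%:R * (l / n%:R)))) addrC.
apply: le_trans (ler_normD _ _) _; apply: lerD; first exact/IH/ltnW.
by apply: H => //; rewrite st.
Qed.

(** The chain rule for F = Phi o f and k = Phi' o f, where Phi' is Lipschitz on
the range of f. Over a short interval, the increment of F minus the primitive
of k g is bounded by the square of the variation of f, thus by a small
multiple of the integral of |g|, and [grid_constant] applies. *)
Lemma prim_chain l f g F k C : 0 <= l -> is_prim l f g ->
  (forall a b, 0 <= a -> a <= b -> b <= l ->
     `|F b - F a - k a * (f b - f a)| <= C * (f b - f a) ^+ 2) ->
  (forall a b, 0 <= a -> a <= b -> b <= l -> `|k b - k a| <= C * `|f b - f a|) ->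
  is_prim l F (fun x => k x * g x).
Proof.
move=> l0 fg Fk kk; have sg := prim_sqint fg.
set K := Num.sqrt (ip leb (oo 0 l) g g).
have kH a b : 0 <= a -> a <= b -> b <= l -> `|k b - k a| <= `|C| * K * Num.sqrt (b - a).
  move=> a0 ab bl; apply: le_trans (kk _ _ a0 ab bl) _; rewrite -mulrA.
  apply: le_trans (ler_wpM2r (normr_ge0 _) (ler_norm C)) _.
  by rewrite ler_wpM2l//; exact: prim_holder fg _ _ _.
have mk := holder_measurable kH.
have K0 : 0 <= K by exact: sqrtr_ge0.
have kb x : oo 0 l x -> `|k x| <= `|k 0| + `|C| * K * Num.sqrt l.
  rewrite /= in_itv/= => /andP[/ltW x0 /ltW xl]; rewrite -lerBlDl.
  apply: le_trans (lerB_dist _ _) _; apply: le_trans (kH _ _ _ x0 xl) _ => //.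
  by rewrite subr0 ler_wpM2l ?mulr_ge0// ler_wsqrtr.
have skg : sqint leb (oo 0 l) (fun x => k x * g x).
  exact: (sqint_bdM (moo _ _) mk kb sg).
have ig u v : 0 <= u -> v <= l -> leb.-integrable (oo u v) (EFin \o g).
  by move=> au vb; exact/sqint_integrable/(sqint_sub _ _ sg).
have ikg u v : 0 <= u -> v <= l ->
    leb.-integrable (oo u v) (EFin \o (fun x => k x * g x)).
  by move=> au vb; exact/sqint_integrable/(sqint_sub _ _ skg).
have iag u v : 0 <= u -> v <= l ->
    leb.-integrable (oo u v) (EFin \o (fun x => `|g x|)).
  by move=> u0 vl; apply: (integrable_abse (ig _ _ u0 vl)).
pose D x := F x - \int[leb]_(s in oo 0 x) (k s * g s).
suff HD b : 0 <= b -> b <= l -> D b = D 0.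
  split => // a b a0 ab bl.
  have := HD a a0 (le_trans ab bl); have := HD b (le_trans a0 ab) bl.
  rewrite /D Rint_nil (Rint_split (ikg _ _ _ bl) a0 ab)//.
  lra.
move=> b0 bl; apply: (@grid_constant b D (fun x => `|g x|)) => //.
  exact: iag.
move=> e e0; pose C2 := 2 * `|C| * K + 1.
have C20 : 0 < C2 by rewrite ltr_wpDl// !mulr_ge0.
exists ((e / C2) ^+ 2); first by rewrite exprn_gt0// divr_gt0.
move=> u v u0 uv vb dvu; have vl := le_trans vb bl.
have fvu : `|f v - f u| <= \int[leb]_(x in oo u v) `|g x|.
  by rewrite fg.2//; apply: le_normr_Rintegral => //; exact: ig.
have sq : Num.sqrt (v - u) <= e / C2.
  by rewrite -(ger0_norm (ltW (divr_gt0 e0 C20))) -sqrtr_sqr ler_wsqrtr// ltW.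
have fvu' : `|f v - f u| <= K * (e / C2).
  apply: le_trans (prim_holder fg u0 uv vl) _.
  by rewrite ler_wpM2l.
rewrite /D (Rint_split (ikg _ _ _ vl) u0 uv)//.
set I := \int[leb]_(x in oo u v) `|g x|; rewrite -/I in fvu.
have -> : F v - (\int[leb]_(x in oo 0 u) (k x * g x) +
     \int[leb]_(x in oo u v) (k x * g x)) -
    (F u - \int[leb]_(s in oo 0 u) (k s * g s)) =
    (F v - F u - k u * (f v - f u)) -
    \int[leb]_(x in oo u v) ((k x - k u) * g x).
  have -> : \int[leb]_(x in oo u v) ((k x - k u) * g x) =
      \int[leb]_(x in oo u v) (k x * g x) - k u * (f v - f u).
    rewrite fg.2// -RintegralZl//; last exact: ig.
    rewrite -RintegralB//; [|exact: ikg|]; last first.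
      by apply: sqint_integrable; apply: sqintZ => //; exact: sqint_sub sg.
    by apply: eq_Rintegral => x _; rewrite mulrBl.
  by ring.
apply: le_trans (ler_normB _ _) _.
have I0 : 0 <= I by apply: Rintegral_ge0.
have Ke : 0 <= K * (e / C2) by rewrite mulr_ge0// ltW// divr_gt0.
have h1 : `|F v - F u - k u * (f v - f u)| <= `|C| * (K * (e / C2)) * I.
  apply: le_trans (Fk _ _ u0 uv vl) _.
  rewrite -real_normK ?num_real// expr2 mulrA.
  apply: le_trans (ler_wpM2r (normr_ge0 _) (ler_wpM2r (normr_ge0 _) (ler_norm C))) _.
  by apply: ler_pM => //; rewrite ?mulr_ge0// ler_wpM2l.
have h2 : `|\int[leb]_(x in oo u v) ((k x - k u) * g x)| <=
    `|C| * (K * (e / C2)) * I.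
  have i2 : leb.-integrable (oo u v) (EFin \o (fun x => (k x - k u) * g x)).
    apply: sqint_integrable.
    have -> : (fun x => (k x - k u) * g x) = (fun x => k x * g x - k u * g x).
      by apply/funext => x; rewrite mulrBl.
    by apply: sqintB => //; [exact: sqint_sub skg|apply: sqintZ => //; exact: sqint_sub sg].
  apply: le_trans (le_normr_Rintegral _ i2) _ => //.
  rewrite -RintegralZl//; last exact: iag.
  apply: le_Rintegral => //.
  - exact: (integrable_abse i2).
  - by apply: (@integrableZl _ _ _ leb _ (moo u v) _ (EFin \o (fun x => `|g x|)));
      exact: iag.
  - move=> x /=; rewrite in_itv/= => /andP[ux xv].
    rewrite normrM ler_wpM2r//.
    apply: le_trans (kk _ _ u0 (ltW ux) (le_trans (ltW xv) vl)) _.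
    apply: le_trans (ler_wpM2r (normr_ge0 _) (ler_norm C)) _.
    rewrite ler_wpM2l//.
    apply: le_trans (prim_holder fg u0 (ltW ux) (le_trans (ltW xv) vl)) _.
    by rewrite ler_wpM2l// (le_trans _ sq)// ler_wsqrtr// lerD2r ltW.
apply: le_trans (lerD h1 h2) _.
rewrite -mulrDl ler_wpM2r//.
have -> : `|C| * (K * (e / C2)) + `|C| * (K * (e / C2)) = e * ((2 * `|C| * K) / C2).
  by ring.
by rewrite ger_pMr// ler_pdivrMr// mul1r lerDl.
Qed.

End Primitives.

Section PrimitiveCalculus.
Context {R : realType}.
Implicit Types (a b c l x y : R) (f g h k F : R -> R).
Local Notation leb := (@lebesgue_measure R).
Local Notation "'oo' a b" := (`]a, b[%classic : set (measurableTypeR R))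
  (at level 10, a at level 9, b at level 9).
Hint Resolve moo : core.

Lemma primD l f g f' g' : is_prim l f g -> is_prim l f' g' ->
  is_prim l (fun x => f x + f' x) (fun x => g x + g' x).
Proof.
move=> [sg fg] [sg' fg']; split; first exact: sqintD.
move=> a b a0 ab bl; rewrite RintegralD//.
- by rewrite -fg// -fg'//; ring.
- exact/sqint_integrable/(sqint_sub a0 bl).
- exact/sqint_integrable/(sqint_sub a0 bl).
Qed.

Lemma primZ l f g (r : R) : is_prim l f g ->
  is_prim l (fun x => r * f x) (fun x => r * g x).
Proof.
move=> [sg fg]; split; first exact: sqintZ.
move=> a b a0 ab bl; rewrite RintegralZl//.
- by rewrite -fg//; ring.
- exact/sqint_integrable/(sqint_sub a0 bl).
Qed.

Lemma primB l f g f' g' : is_prim l f g -> is_prim l f' g' ->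
  is_prim l (fun x => f x - f' x) (fun x => g x - g' x).
Proof.
move=> fg fg'; have := primD fg (primZ (-1) fg').
by under eq_fun do rewrite mulN1r; under [X in is_prim _ _ X]eq_fun do rewrite mulN1r.
Qed.

Lemma prim_cst l (r : R) : is_prim l (fun=> r) (fun=> 0).
Proof.
split; first exact: sqint_cst.
by move=> a b _ _ _; rewrite subrr Rintegral_cst// mul0r.
Qed.

Lemma prim_bounded l f g : is_prim l f g ->
  exists M, forall a, 0 <= a -> a <= l -> `|f a| <= M.
Proof.
move=> fg; exists (Num.sqrt (ip leb (oo 0 l) g g) * Num.sqrt l + `|f 0|).
move=> a a0 al; rewrite -(subrK (f 0) (f a)).
apply: le_trans (ler_normD _ _) _; rewrite lerD2r.
apply: le_trans (prim_holder fg (lexx 0) a0 al) _.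
by rewrite ler_wpM2l// ler_wsqrtr// subr0.
Qed.

Lemma prim_sqr l f g : 0 <= l -> is_prim l f g ->
  is_prim l (fun x => f x ^+ 2) (fun x => 2 * f x * g x).
Proof.
move=> l0 fg; apply: (@prim_chain _ l f g _ (fun x => 2 * f x) 2) => // a b a0 ab bl.
  rewrite (_ : _ - _ - _ = (f b - f a) ^+ 2); last by ring.
  by rewrite ger0_norm ?sqr_ge0// ler_peMl ?sqr_ge0// ler1n.
by rewrite -mulrBr normrM ger0_norm.
Qed.

(** By polarization of the rule for squares. *)
Lemma prim_mul l f g f' g' : 0 <= l -> is_prim l f g -> is_prim l f' g' ->
  is_prim l (fun x => f x * f' x) (fun x => f x * g' x + g x * f' x).
Proof.
move=> l0 fg fg'.
have := primB (primZ 4^-1 (prim_sqr l0 (primD fg fg')))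
              (primZ 4^-1 (prim_sqr l0 (primB fg fg'))).
rewrite (_ : (fun x => _ - _) = (fun x => f x * f' x)); last first.
  by apply/funext => x; field.
rewrite (_ : (fun x => _ - _) = (fun x => f x * g' x + g x * f' x))//.
by apply/funext => x; field.
Qed.

Lemma prim_measurable l f g : is_prim l f g -> measurable_fun (oo 0 l) f.
Proof.
move=> fg; apply: (@holder_measurable _ _ _ (Num.sqrt (ip leb (oo 0 l) g g))).
by move=> a b; exact: prim_holder.
Qed.

Lemma prim_sqint_fun l f g : is_prim l f g -> sqint leb (oo 0 l) f.
Proof.
move=> fg; have [M HM] := prim_bounded fg.
apply: (@sqint_bounded _ _ _ _ _ _ M) => //; first exact: leb_itv_fin.
  exact: prim_measurable fg.
by move=> x; rewrite /= in_itv/= => /andP[/ltW x0 /ltW xl]; exact: HM.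
Qed.

Lemma prim_by_parts l f g f' g' : 0 <= l -> is_prim l f g -> is_prim l f' g' ->
  ip leb (oo 0 l) f g' = f l * f' l - f 0 * f' 0 - ip leb (oo 0 l) g f'.
Proof.
move=> l0 fg fg'; have [sm mm] := prim_mul l0 fg fg'.
have sf := prim_sqint_fun fg; have sf' := prim_sqint_fun fg'.
rewrite mm// /ip RintegralD//; first by rewrite addrK.
- by apply: sqint_mul => //; exact: prim_sqint fg'.
- by apply: sqint_mul => //; exact: prim_sqint fg.
Qed.

(** The derivative is given to the right of -1, so that F may be an integral from a
negative base point. *)
Lemma prim_C1 l F g : (forall x, -1 < x -> is_derive x 1 F (g x)) -> continuous g ->
  is_prim l F g.
Proof.
move=> dF cg.
have cF x : -1 < x -> {for x, continuous F}.
  move=> x1; apply: differentiable_continuous; apply/derivable1_diffP.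
  by case: (dF x x1).
have N1 : -1 < 0 :> R by rewrite oppr_lt0.
split.
  have [M [_ HM]] : bounded_set (g @` `[0, l]).
    apply: compact_bounded; apply: continuous_compact; last exact: segment_compact.
    exact: continuous_subspaceT.
  apply: (@sqint_bounded _ _ _ _ _ _ (M + 1)) => //; first exact: leb_itv_fin.
    apply: measurable_funTS; exact: continuous_measurable_fun.
  move=> x /=; rewrite in_itv/= => /andP[x0 xl].
  by apply: (HM (M + 1)); rewrite ?ltrDl//; exists x => //=; rewrite in_itv/= !ltW.
move=> a b a0; rewrite le_eqVlt => /predU1P[-> _|ab bl].
  by rewrite subrr Rint_nil.
have ig : leb.-integrable `[a, b] (EFin \o g).
  by apply: continuous_compact_integrable; [exact: segment_compact|exact: continuous_subspaceT].
have ig' : leb.-integrable `]a, b[ (EFin \o g).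
  by apply: integrableS ig => //; exact: subset_itv_oo_cc.
rewrite (Rintegral_itv_bndo_bndc ig') Rintegral_itv_obnd_cbnd; last first.
  by apply: integrableS ig => //; exact: subset_itv_oc_cc.
rewrite /Rintegral (@continuous_FTC2 _ g F a b ab)//.
- exact: continuous_subspaceT.
- split.
  + move=> x; rewrite in_itv/= => /andP[ax _].
    by case: (dF x (lt_trans N1 (le_lt_trans a0 ax))).
  + by apply: cvg_at_right_filter; apply: cF; exact: lt_le_trans a0.
  + by apply: cvg_at_left_filter; apply: cF; rewrite (lt_trans N1)// (le_lt_trans a0).
- move=> x; rewrite in_itv/= => /andP[ax _]; rewrite derive1E.
  have := dF x (lt_trans N1 (le_lt_trans a0 ax)) => d.
  exact: (@derive_val _ _ _ _ _ _ _ d).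
Qed.

End PrimitiveCalculus.

Section ChainRules.
Context {R : realType}.
Implicit Types (a b c l x y : R) (f g h k F : R -> R).
Local Notation leb := (@lebesgue_measure R).
Local Notation "'oo' a b" := (`]a, b[%classic : set (measurableTypeR R))
  (at level 10, a at level 9, b at level 9).
Hint Resolve moo : core.

(** The inverse, like the exponential and the logarithm below, has a Lipschitz
derivative on the range of f, so that [prim_chain] applies. *)
Lemma prim_inv l f g (m : R) : 0 <= l -> 0 < m -> is_prim l f g ->
  (forall x, 0 <= x -> x <= l -> m <= f x) ->
  is_prim l (fun x => (f x)^-1) (fun x => - (f x)^-1 ^+ 2 * g x).
Proof.
move=> l0 m0 fg mf; pose C := 2 * m^-1 ^+ 3.
have inv x : 0 <= x -> x <= l -> [/\ f x != 0, 0 <= (f x)^-1 & (f x)^-1 <= m^-1].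
  move=> x0 xl; have fx := lt_le_trans m0 (mf x x0 xl).
  by split; rewrite ?gt_eqF// ?invr_ge0 ?(ltW fx)// lef_pV2 ?posrE ?mf.
have m30 : 0 < m^-1 ^+ 3 by rewrite exprn_gt0// invr_gt0.
apply: (@prim_chain _ l f g _ (fun x => - (f x)^-1 ^+ 2) C) => // a b a0 ab bl.
  have [fa' va va'] := inv a a0 (le_trans ab bl).
  have [fb' vb vb'] := inv b (le_trans a0 ab) bl.
  have -> : (f b)^-1 - (f a)^-1 - - (f a)^-1 ^+ 2 * (f b - f a) =
      ((f a)^-1 ^+ 2 * (f b)^-1) * (f b - f a) ^+ 2.
    by field; rewrite fa' fb'.
  rewrite normrM [X in _ * X]ger0_norm ?sqr_ge0// ler_wpM2r ?sqr_ge0//.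
  rewrite ger0_norm ?mulr_ge0 ?exprn_ge0//.
  apply: (@le_trans _ _ (m^-1 ^+ 3)); last by rewrite /C; lra.
  by rewrite [leRHS]exprSr; apply: ler_pM; rewrite ?exprn_ge0// lerXn2r ?nnegrE// (le_trans va).
have [fa' va va'] := inv a a0 (le_trans ab bl).
have [fb' vb vb'] := inv b (le_trans a0 ab) bl.
have -> : - (f b)^-1 ^+ 2 - - (f a)^-1 ^+ 2 =
    ((f a)^-1 ^+ 2 * (f b)^-1 + (f b)^-1 ^+ 2 * (f a)^-1) * (f b - f a).
  by field; rewrite fa' fb'.
rewrite normrM ler_wpM2r// ger0_norm ?addr_ge0 ?mulr_ge0 ?exprn_ge0//.
rewrite /C mulr_natl mulr2n [m^-1 ^+ 3]exprSr.
have mi := le_trans va va'.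
by apply: lerD; apply: ler_pM; rewrite ?exprn_ge0// lerXn2r ?nnegrE.
Qed.

(** The slope of a chord of the convex function exp is at most the derivative at
its right end. *)
Lemma exp_lip (M x y : R) : x <= M -> y <= M ->
  `|expR x - expR y| <= expR M * `|x - y|.
Proof.
wlog yx : x y / y <= x => [H xM yM|xM yM].
  by have [/H|/ltW/H] := leP y x; [exact|rewrite distrC (distrC x); exact].
rewrite !ger0_norm ?subr_ge0 ?ler_expR//.
apply: (@le_trans _ _ (expR x * (x - y))); last first.
  by rewrite ler_wpM2r ?subr_ge0// ler_expR.
have -> : expR y = expR x * expR (y - x) by rewrite -expRD; congr expR; ring.
have := ler_wpM2l (ltW (expR_gt0 x)) (expR_ge1Dx (y - x)); lra.
Qed.

Lemma prim_expR l (r : R) f g : 0 <= l -> is_prim l f g ->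
  is_prim l (fun x => expR (r * f x)) (fun x => r * expR (r * f x) * g x).
Proof.
move=> l0 fg; have rfg := primZ r fg; have [M HM] := prim_bounded rfg.
have eM x y : 0 <= x -> x <= l -> 0 <= y -> y <= l ->
    `|expR (r * f y) - expR (r * f x)| <= expR M * `|r * f y - r * f x|.
  by move=> x0 xl y0 yl; apply: exp_lip; apply: le_trans (ler_norm _) (HM _ _ _).
have := @prim_chain _ l (fun x => r * f x) (fun x => r * g x)
  (fun x => expR (r * f x)) (fun x => expR (r * f x)) (expR M) l0 rfg.
have -> : (fun x => expR (r * f x) * (r * g x)) = (fun x => r * expR (r * f x) * g x).
  by apply/funext => x; ring.
apply=> a b a0 ab bl; last first.
  by apply: eM => //; [exact: le_trans bl|exact: le_trans ab].
have al := le_trans ab bl; have b0 := le_trans a0 ab.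
set x := r * f a; set y := r * f b.
have h1 : 0 <= expR y - expR x - expR x * (y - x).
  have h := expR_ge1Dx (y - x); have e0 := expR_gt0 x.
  have -> : expR y = expR x * expR (y - x) by rewrite -expRD; congr expR; ring.
  nra.
rewrite ger0_norm//.
have h2 : expR y - expR x <= expR y * (y - x).
  have h := expR_ge1Dx (x - y); have e0 := expR_gt0 y.
  have -> : expR x = expR y * expR (x - y) by rewrite -expRD; congr expR; ring.
  nra.
apply: (@le_trans _ _ ((expR y - expR x) * (y - x))); first by lra.
apply: le_trans (ler_norm _) _.
rewrite normrM -(real_normK (num_real (y - x))) expr2 mulrA ler_wpM2r//.
exact: eM.
Qed.

Lemma prim_ln l (m : R) f g : 0 <= l -> 0 < m -> is_prim l f g ->
  (forall x, 0 <= x -> x <= l -> m <= f x) ->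
  is_prim l (fun x => ln (f x)) (fun x => (f x)^-1 * g x).
Proof.
move=> l0 m0 fg mf; pose C := m^-1 ^+ 2.
have inv x : 0 <= x -> x <= l -> [/\ 0 < f x, f x != 0, 0 <= (f x)^-1 & (f x)^-1 <= m^-1].
  move=> x0 xl; have fx := lt_le_trans m0 (mf x x0 xl).
  by split; rewrite ?gt_eqF// ?invr_ge0 ?(ltW fx)// lef_pV2 ?posrE ?mf.
have lnD (x y : R) : 0 < x -> 0 < y -> ln y - ln x <= (y - x) / x.
  move=> x0 y0; rewrite -ln_div ?posrE//.
  have -> : y / x = 1 + (y - x) / x by field; rewrite gt_eqF.
  apply: le_ln1Dx; have : 0 < y / x by rewrite divr_gt0.
  by rewrite (_ : y / x = (y - x) / x + 1); [lra|field; rewrite gt_eqF].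
have vv x y : 0 <= x -> x <= l -> 0 <= y -> y <= l -> 0 <= (f x)^-1 * (f y)^-1 <= C.
  move=> x0 xl y0 yl; have [_ _ vx vx'] := inv x x0 xl; have [_ _ vy vy'] := inv y y0 yl.
  by rewrite mulr_ge0//= /C expr2 ler_pM.
apply: (@prim_chain _ l f g _ (fun x => (f x)^-1) C) => // a b a0 ab bl;
  have al := le_trans ab bl; have b0 := le_trans a0 ab;
  have [fa fa' _ _] := inv a a0 al; have [fb fb' _ _] := inv b b0 bl;
  have /andP[v0 vC] := vv a b a0 al b0 bl.
  have h1 := lnD _ _ fa fb; have h2 := lnD _ _ fb fa.
  have d0 : 0 <= (f b - f a) ^+ 2 by exact: sqr_ge0.
  have e1 : (f a)^-1 * (f b)^-1 * (f b - f a) ^+ 2 =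
      (f a)^-1 * (f b - f a) + (f a - f b) / f b by field; rewrite fa' fb'.
  have h3 := ler_wpM2r d0 vC.
  by rewrite ler_norml; apply/andP; split; rewrite mulrC in h1; nra.
rewrite (_ : (f b)^-1 - (f a)^-1 = - ((f a)^-1 * (f b)^-1 * (f b - f a))); last first.
  by field; rewrite fa' fb'.
by rewrite normrN normrM ger0_norm// ler_wpM2r.
Qed.

End ChainRules.

(** * Smooth bumps and the lemma of du Bois-Reymond *)

Section SmoothBumps.
Context {R : realType}.
Implicit Types (a b c l x y : R) (f g h k F : R -> R).
Local Notation leb := (@lebesgue_measure R).
Local Notation "'oo' a b" := (`]a, b[%classic : set (measurableTypeR R))
  (at level 10, a at level 9, b at level 9).
Hint Resolve moo : core.

(** Smoothness by coinduction. *)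
Lemma smooth_closed (S : set (R -> R)) :
  (forall f, S f -> (forall x, derivable f x 1) /\ S (derive1 f)) ->
  forall f, S f -> forall n x, derivable (derive1n n f) x 1.
Proof.
move=> H f Sf n; suff Sn : S (derive1n n f) by case: (H _ Sn).
by elim: n => // n IH; case: (H _ IH).
Qed.

(** This gives the derivative at the points where a function is glued to 0, if the
contact is quadratic. *)
Lemma is_derive_quadratic f (p C : R) :
  (forall x, `|f x - f p| <= C * (x - p) ^+ 2) -> is_derive p 1 f 0.
Proof.
move=> H; have C0 : 0 <= C.
  by have := le_trans (normr_ge0 _) (H (p + 1)); rewrite addrAC subrr add0r expr1n mulr1.
have lim : h^-1 *: (f (h *: 1 + p) - f p) @[h --> 0^'] --> (0 : R).
  apply/cvgrPdist_le => /= e e0; near=> h.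
  rewrite sub0r normrN normrM normfV scaler1.
  have h0 : 0 < `|h| by rewrite normr_gt0; near: h; exact: nbhs_dnbhs_neq.
  rewrite mulrC ler_pdivrMr//; apply: le_trans (H _) _.
  rewrite addrK -real_normK ?num_real// expr2 mulrA ler_wpM2r//.
  have : `|h| < e / (C + 1).
    near: h; apply: dnbhs0_lt; by rewrite divr_gt0// ltr_wpDl.
  rewrite ltr_pdivlMr ?ltr_wpDl// => /ltW; apply: le_trans.
  by rewrite mulrC ler_wpM2l// lerDl.
apply: DeriveDef; first by apply/cvg_ex; exists 0.
exact: cvg_lim lim.
Unshelve. all: by end_near. Qed.

Definition quad : {poly R} := 'X - 'X ^+ 2.

Lemma quadE x : quad.[x] = x * (1 - x).
Proof. by rewrite !hornerE; ring. Qed.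

(** All derivatives of e^(-v), with v = 1 / (x (1 - x)) on (0, 1), are a polynomial
times a power of v times e^(-v). This family is closed under derivation, hence
consists of smooth functions, even when extended by 0. *)
Definition bumpfun (P : {poly R}) (k : nat) x : R :=
  if (0 < x) && (x < 1) then
    P.[x] * (quad.[x])^-1 ^+ k.+1 * expR (- (quad.[x])^-1)
  else 0.

(** The exponential dominates all powers of v, and x (1 - x) <= |x - p|
for x in (0, 1) and p outside. *)
Lemma bumpfun_quadratic P (k : nat) : exists C, forall p x, ~~ (0 < p < 1) ->
  `|bumpfun P k x| <= C * (x - p) ^+ 2.
Proof.
have [M [_ HM]] : bounded_set (horner P @` `[0, 1]).
  apply: compact_bounded; apply: continuous_compact; last exact: segment_compact.
  by apply: continuous_subspaceT; exact: continuous_horner.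
have {}HM x : 0 < x -> x < 1 -> `|P.[x]| <= `|M| + 1.
  move=> x0 x1; apply: HM; first by rewrite ltr_pwDr// ler_norm.
  by exists x => //=; rewrite in_itv/= !ltW.
exists ((`|M| + 1) * (k.+3`!%:R)) => p x p01.
have C0 : 0 <= (`|M| + 1) * (k.+3`!%:R) :> R by rewrite mulr_ge0// addr_ge0.
rewrite /bumpfun; case: ifPn => [/andP[x0 x1]|_]; last first.
  by rewrite normr0 mulr_ge0 ?sqr_ge0.
have q0 : 0 < quad.[x] by rewrite quadE mulr_gt0// subr_gt0.
set v := (quad.[x])^-1; have v0 : 0 < v by rewrite invr_gt0.
have vx : v ^+ k.+1 * expR (- v) <= k.+3`!%:R * quad.[x] ^+ 2.
  (* v^(k+3) / (k+3)! <= e^v and q = 1 / v *)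
  have := expR_ge1Dxn k.+2 (ltW v0); have f0 : 0 < k.+3`!%:R :> R by rewrite ltr0n fact_gt0.
  move=> H; have {H} : v ^+ k.+3 / k.+3`!%:R <= expR v.
    by apply: le_trans H; rewrite lerDr.
  rewrite ler_pdivrMr// => H.
  rewrite expRN ler_pdivrMr ?expR_gt0//.
  have -> : v ^+ k.+1 = v ^+ k.+3 * quad.[x] ^+ 2.
    by rewrite -addn2 exprD -mulrA -exprMn mulVf ?gt_eqF// expr1n mulr1.
  by rewrite [leRHS]mulrAC ler_wpM2r ?sqr_ge0// mulrC.
rewrite -mulrA normrM -mulrA; apply: ler_pM => //; first exact: HM.
rewrite ger0_norm ?mulr_ge0 ?exprn_ge0 ?expR_ge0 ?(ltW v0)//.
apply: le_trans vx _; rewrite ler_wpM2l//.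
rewrite -[leRHS]real_normK ?num_real// lerXn2r ?nnegrE ?(ltW q0)// quadE.
move: p01; rewrite negb_and -!leNgt => /orP[p0|p1].
  rewrite ger0_norm; last by lra.
  by nra.
rewrite ler0_norm; last by lra.
by nra.
Qed.

Lemma bumpfun_derive P (k : nat) x : is_derive x 1 (bumpfun P k)
  (bumpfun (P^`() * quad ^+ 2 - k.+1%:R *: (P * quad^`() * quad) + P * quad^`())
           k.+2 x).
Proof.
have [/andP[x0 x1]|x01] := boolP ((0 < x) && (x < 1)); last first.
  rewrite {2}/bumpfun (negbTE x01).
  have [C HC] := bumpfun_quadratic P k.
  apply: (@is_derive_quadratic _ _ C) => y.
  by rewrite {2}/bumpfun (negbTE x01) subr0; exact: HC.
have q0 : 0 < quad.[x] by rewrite quadE mulr_gt0// subr_gt0.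
rewrite {2}/bumpfun x0 x1/=.
apply: (@near_eq_is_derive _ _ _
  (fun x => P.[x] * (quad.[x])^-1 ^+ k.+1 * expR (- (quad.[x])^-1))).
  near=> y; rewrite /bumpfun ifT//; apply/andP; split; near: y.
    exact: lt_nbhsr.
  exact: lt_nbhsl.
have dq := @is_deriveV R (horner quad) x _ _ (lt0r_neq0 q0) (is_derive_poly quad x).
have dk := @is_deriveX _ _ _ k.+1 _ _ _ dq.
have dE := @is_derive1_comp _ _ _ _ _ _ (is_derive_expR _) (is_deriveN dq).
have := is_deriveM (is_deriveM (is_derive_poly P x) dk) dE.
set G := (G in is_derive _ _ G _).
have -> : G = (fun x => P.[x] * (quad.[x])^-1 ^+ k.+1 * expR (- (quad.[x])^-1)).
  by apply/funext => y; rewrite /G !fctE.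
move=> h; apply: (is_derive_eq h).
rewrite [X in _ = X * _ * _](_ : _ = P^`().[x] * quad.[x] ^+ 2 -
    k.+1%:R * (P.[x] * quad^`().[x] * quad.[x]) + P.[x] * quad^`().[x]); last first.
  by move: quad => Q; rewrite !hornerE.
rewrite !fctE /GRing.scale/=.
set q := quad.[x]; set E := expR _; set dP := P^`().[x]; set dQ := quad^`().[x].
have -> : q^-1 ^+ k.+3 = q^-1 ^+ k.+1 * q^-1 ^+ 2 by rewrite -exprD addn2.
rewrite exprS; set qk := q^-1 ^+ k.
by field; rewrite gt_eqF.
Unshelve. all: by end_near. Qed.

Lemma bumpfun_smooth P (k : nat) : forall (n : nat) x,
  derivable (derive1n n (bumpfun P k)) x 1.
Proof.
apply: (@smooth_closed [set f | exists P (k : nat), f = bumpfun P k]); last first.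
  by exists P, k.
move=> f [{}P [{}k ->]]; split; first by move=> y; case: (bumpfun_derive P k y).
eexists; eexists; apply/funext => y; rewrite derive1E.
by apply: derive_val; exact: bumpfun_derive.
Qed.

End SmoothBumps.

Section Plateaus.
Context {R : realType}.
Implicit Types (a b c l x y : R) (f g h k F : R -> R).
Local Notation leb := (@lebesgue_measure R).
Local Notation "'oo' a b" := (`]a, b[%classic : set (measurableTypeR R))
  (at level 10, a at level 9, b at level 9).
Hint Resolve moo : core.

(** A mollifier supported in [0, 1], of mass [step 1]. *)
Definition eta : R -> R := bumpfun 1 0.

Lemma eta_ge0 x : 0 <= eta x.
Proof.
rewrite /eta /bumpfun; case: ifPn => // /andP[x0 x1].
by rewrite hornerC mul1r !mulr_ge0 ?expR_ge0// invr_ge0 quadE mulr_ge0// ?subr_ge0 ltW.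
Qed.

Lemma eta_out x : ~~ ((0 < x) && (x < 1)) -> eta x = 0.
Proof. by move=> x01; rewrite /eta /bumpfun (negbTE x01). Qed.

Lemma eta_half : 0 < eta 2^-1.
Proof.
have h : (0 < (2^-1 : R)) && ((2^-1 : R) < 1) by rewrite invr_gt0 invf_lt1// ltr1n ltr0n.
rewrite /eta /bumpfun h hornerC mul1r !mulr_gt0 ?expR_gt0// invr_gt0 quadE.
by case/andP: h => h0 h1; rewrite mulr_gt0// subr_gt0.
Qed.

Lemma eta_continuous : continuous eta.
Proof.
move=> x; apply: differentiable_continuous; apply/derivable1_diffP.
by case: (bumpfun_derive 1 0 x).
Qed.

Lemma eta_integrable : leb.-integrable setT (EFin \o eta).
Proof.
have -> : EFin \o eta = (EFin \o eta) \_ `[0, 1].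
  apply/funext => x; rewrite patchE; case: ifPn => //=.
  rewrite notin_setE/= in_itv/= => x01; rewrite eta_out//.
  by apply/negP => /andP[x0 x1]; apply: x01; rewrite !ltW.
apply/integrable_restrict => //; rewrite setTI.
apply: continuous_compact_integrable; first exact: segment_compact.
by apply: continuous_subspaceT; exact: eta_continuous.
Qed.

Definition step x : R := \int[leb]_(t in `]-oo, x]) eta t.

Lemma step_derive x : is_derive x 1 step (eta x).
Proof.
have xx : x < x + 1 by rewrite ltrDl.
have ie : leb.-integrable `]-oo, x + 1] (EFin \o eta).
  by apply: integrableS eta_integrable.
have [d <-] := continuous_FTC1 xx ie (ltNyr x) (@eta_continuous x).
by rewrite derive1E; apply: DeriveDef.
Qed.

Lemma step_prim l : is_prim l step eta.
Proof. exact: prim_C1 (fun x _ => step_derive x) eta_continuous. Qed.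

Lemma step_le0 x : x <= 0 -> step x = 0.
Proof.
move=> x0; rewrite /step (@eq_Rintegral _ _ _ _ _ (cst 0)); last first.
  move=> t; rewrite inE/= in_itv/= => tx; rewrite eta_out//.
  by rewrite negb_and -leNgt (le_trans tx x0).
by rewrite Rintegral_cst// mul0r.
Qed.

Lemma step_ge1 x : 1 <= x -> step x = step 1.
Proof.
move=> x1; apply/eqP; rewrite -subr_eq0 (step_prim x).2//.
rewrite (@eq_Rintegral _ _ _ _ _ (cst 0)); last first.
  move=> t; rewrite inE/= in_itv/= => /andP[t1 _]; rewrite eta_out//.
  by rewrite negb_and -!leNgt (ltW t1) orbT.
by rewrite Rintegral_cst// mul0r.
Qed.

Lemma step_mono a b : 0 <= a -> a <= b -> step a <= step b.
Proof.
move=> a0 ab; rewrite -subr_ge0 (step_prim b).2//.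
by apply: Rintegral_ge0 => x _; exact: eta_ge0.
Qed.

Lemma step1_gt0 : 0 < step 1.
Proof.
rewrite lt_neqAle -{2}(step_le0 (lexx 0)) step_mono// andbT.
apply/eqP => s10; have := eta_half; rewrite lt_neqAle => /andP[+ _].
apply/negP; rewrite negbK; apply/eqP.
have d := step_derive 2^-1.
suff d0 : is_derive (2^-1 : R) 1 step 0.
  by rewrite -(@derive_val _ _ _ _ _ _ _ d) (@derive_val _ _ _ _ _ _ _ d0).
apply: (@near_eq_is_derive _ _ _ (cst 0)).
near=> x; rewrite /cst.
have x0 : 0 <= x by apply: ltW; near: x; apply: lt_nbhsr; rewrite invr_gt0.
have x1 : x <= 1.
  by apply: ltW; near: x; apply: lt_nbhsl; rewrite invf_lt1// ltr1n.
have := step_mono x0 x1; have := step_mono (lexx 0) x0.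
by rewrite -s10 (step_le0 (lexx 0)) => ? ?; apply/eqP; rewrite eq_le; apply/andP.
Unshelve. all: by end_near. Qed.

Lemma derive1n_step (n : nat) : derive1n n.+1 step = derive1n n eta.
Proof.
rewrite /derive1n iterSr; congr iter; apply/funext => x.
by rewrite derive1E; apply: derive_val; exact: step_derive.
Qed.

Lemma step_smooth (n : nat) x : derivable (derive1n n step) x 1.
Proof.
case: n => [|n]; first by case: (step_derive x).
by rewrite derive1n_step; exact: bumpfun_smooth.
Qed.

(** [test_function] for an interval that is not given as an edge. *)
Definition test_fun l (phi : R -> R) : Prop :=
  (forall (n : nat) x, derivable (derive1n n phi) x 1) /\
  exists a b, [/\ 0 < a, b < l & forall x, phi x != 0 -> a <= x <= b].

(** A smooth transition from 0 to [step 1] on [a, a + e], and back on [b, b + e].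
Its derivative is a difference of concentrated bumps at a and at b. *)
Definition plateau a b (e : R) x := step (e^-1 * x - e^-1 * a) - step (e^-1 * x - e^-1 * b).

Lemma is_derive_affine f (df : R) (p q x : R) :
  is_derive (p * x - q) 1 f df -> is_derive x 1 (fun y => f (p * y - q)) (p * df).
Proof.
move=> d; have dl : is_derive x 1 (fun y => p * y - q) p.
  have := is_deriveB (is_deriveZ p (is_derive_id x 1)) (is_derive_cst q x 1).
  by rewrite subr0 /GRing.scale/= mulr1.
by have := @is_derive1_comp R f (fun y => p * y - q) x _ _ d dl; rewrite mulrC.
Qed.

Lemma plateau_derive a b (e : R) x : is_derive x 1 (plateau a b e)
  (e^-1 * (eta (e^-1 * x - e^-1 * a) - eta (e^-1 * x - e^-1 * b))).
Proof.
rewrite mulrBr.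
apply: (is_deriveB (f := fun x => _) (g := fun x => _));
  apply: is_derive_affine; exact: step_derive.
Qed.

Lemma plateau_test l a b (e : R) : 0 < e -> 0 < a -> a <= b -> b + e < l ->
  test_fun l (plateau a b e).
Proof.
move=> e0 a0 ab bl; split.
  pose S : set (R -> R) := [set f | exists (n : nat) (r s : R), f = fun x =>
    r * derive1n n step (e^-1 * x - e^-1 * a) +
    s * derive1n n step (e^-1 * x - e^-1 * b)].
  apply: (@smooth_closed R S); last first.
    by exists 0%N, 1, (-1); apply/funext => x; rewrite mul1r mulN1r.
  move=> f [n [r [s ->]]].
  pose df x := (r * e^-1) * derive1n n.+1 step (e^-1 * x - e^-1 * a) +
    (s * e^-1) * derive1n n.+1 step (e^-1 * x - e^-1 * b).
  have D x : is_derive x 1 (fun x =>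
    r * derive1n n step (e^-1 * x - e^-1 * a) +
    s * derive1n n step (e^-1 * x - e^-1 * b)) (df x).
    have DS y : is_derive y 1 (derive1n n step) (derive1n n.+1 step y).
      by apply: DeriveDef; [exact: step_smooth|rewrite -derive1E].
    rewrite /df -!mulrA.
    by apply: (is_deriveD (f := fun x => _) (g := fun x => _));
      apply: (is_deriveZ (f := fun x => _)); apply: is_derive_affine; exact: DS.
  split; first by move=> x; case: (D x).
  exists n.+1, (r * e^-1), (s * e^-1); apply/funext => x; rewrite derive1E.
  exact: derive_val.
exists a, (b + e); split => // x; apply: contraNT; rewrite negb_and -!ltNge.
have ei : 0 < e^-1 by rewrite invr_gt0.
rewrite /plateau -!mulrBr => /orP[xa|bx].
  by rewrite !step_le0 ?subrr// pmulr_rle0//; lra.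
by rewrite !step_ge1 ?subrr// mulrC ler_pdivlMr//; lra.
Qed.

Lemma etaM_prim l a (e : R) : is_prim l (fun x => step (e^-1 * x - e^-1 * a))
  (fun x => e^-1 * eta (e^-1 * x - e^-1 * a)).
Proof.
apply: prim_C1 => [x _|x]; first by apply: is_derive_affine; exact: step_derive.
apply: cvgMr.
apply: (@continuous_comp _ _ _ (fun y => e^-1 * y - e^-1 * a) eta); last exact: eta_continuous.
by apply: cvgB; [apply: cvgMr; exact: cvg_id|exact: cvg_cst].
Qed.

Lemma plateau_mass l a (e : R) : 0 < e -> 0 < a -> a + e < l ->
  \int[leb]_(x in oo 0 l) (e^-1 * eta (e^-1 * x - e^-1 * a)) = step 1.
Proof.
move=> e0 a0 al; have ei : 0 < e^-1 by rewrite invr_gt0.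
have [_ <-//] := etaM_prim l a e.
- rewrite -!mulrBr step_ge1; last by rewrite mulrC ler_pdivlMr//; lra.
  by rewrite (@step_le0 (_ * _)) ?subr0// pmulr_rle0//; lra.
- lra.
Qed.

Section DuBoisReymond.
Variables (l : R) (u : R -> R).
Hypothesis su : sqint leb (oo 0 l) u.
Hypothesis cu : {in `]0, l[%classic, continuous u}.

Lemma etaM_sqint (e a : R) :
  sqint leb (oo 0 l) (fun x => e^-1 * eta (e^-1 * x - e^-1 * a)).
Proof. exact: prim_sqint (etaM_prim l a e). Qed.

(** The bump is nonnegative, has mass [step 1], and lives on [a, a + e]. *)
Lemma average_near a (e d : R) : 0 < e -> 0 < a -> a + e < l ->
  (forall x, a <= x -> x <= a + e -> `|u x - u a| <= d) ->
  `|ip leb (oo 0 l) u (fun x => e^-1 * eta (e^-1 * x - e^-1 * a)) - u a * step 1|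
    <= d * step 1.
Proof.
move=> e0 a0 al H; have sm := etaM_sqint e a.
have im := sqint_integrable sm.
rewrite -(plateau_mass e0 a0 al) -!RintegralZl// -RintegralB//; last 2 first.
- exact: sqint_mul.
- by apply: sqint_integrable; exact: sqintZ.
have iB : leb.-integrable (oo 0 l) (EFin \o (fun x =>
    u x * (e^-1 * eta (e^-1 * x - e^-1 * a)) - u a * (e^-1 * eta (e^-1 * x - e^-1 * a)))).
  apply: integrableB_EFin => //; first exact: sqint_mul.
  by apply: sqint_integrable; exact: sqintZ.
apply: le_trans (le_normr_Rintegral _ iB) _ => //.
apply: le_Rintegral => //; first exact: (integrable_abse iB).
  by apply: sqint_integrable; exact: sqintZ.
have ei : 0 < e^-1 by rewrite invr_gt0.
move=> x _; rewrite -mulrBl normrM [X in _ * X]ger0_norm; last first.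
  by rewrite mulr_ge0 ?eta_ge0// ltW.
have [z0|z0] := eqVneq (eta (e^-1 * x - e^-1 * a)) 0; first by rewrite z0 !mulr0.
rewrite ler_wpM2r ?mulr_ge0 ?eta_ge0 ?(ltW ei)//.
have : (0 < e^-1 * x - e^-1 * a) && (e^-1 * x - e^-1 * a < 1).
  by apply: contraNT z0 => /eta_out ->.
rewrite -mulrBr pmulr_rgt0// mulrC ltr_pdivrMr// => /andP[? ?].
by apply: H; lra.
Qed.

(** Tested against the derivative of a plateau, u has equal averages near a and
near b; in the limit of concentrated bumps the averages become values. *)
Lemma du_bois_reymond :
  (forall phi, test_fun l phi ->
     \int[leb]_(x in oo 0 l) (u x * derive1 phi x) = 0) ->
  forall a b, 0 < a -> a <= b -> b < l -> u a = u b.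
Proof.
move=> H a b a0 ab bl; apply/eqP; rewrite -subr_eq0 -normr_le0.
apply/ler_addgt0Pl => d d0; rewrite addr0.
have al : a < l by exact: le_lt_trans bl.
have b0 : 0 < b by exact: lt_le_trans ab.
have near_pt x : 0 < x -> x < l -> exists2 e : R, 0 < e &
    forall y, `|y - x| <= e -> `|u y - u x| <= d / 2.
  move=> x0 xl; have := cu (x := x); rewrite inE/= in_itv/= x0 xl => /(_ erefl).
  move/cvgrPdist_le => /(_ (d / 2)); rewrite divr_gt0// => /(_ erefl) [e /= e0 He].
  exists (e / 2); first by rewrite divr_gt0.
  move=> y yx; rewrite distrC; apply: He; rewrite /ball_/= distrC.
  by apply: le_lt_trans yx _; lra.
have [e1 e10 H1] := near_pt _ a0 al; have [e2 e20 H2] := near_pt _ b0 bl.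
pose e := Num.min (Num.min e1 e2) ((l - b) / 2).
have e0 : 0 < e by rewrite !lt_min e10 e20/= divr_gt0// subr_gt0.
have [ee1 ee2 el] : [/\ e <= e1, e <= e2 & e <= (l - b) / 2].
  by split; rewrite /e !ge_min lexx ?orbT.
have bel : b + e < l by lra.
have A1 : `|ip leb (oo 0 l) u (fun x => e^-1 * eta (e^-1 * x - e^-1 * a)) -
    u a * step 1| <= d / 2 * step 1.
  apply: average_near => //; first by lra.
  by move=> x ax xa; apply: H1; rewrite ger0_norm; lra.
have A2 : `|ip leb (oo 0 l) u (fun x => e^-1 * eta (e^-1 * x - e^-1 * b)) -
    u b * step 1| <= d / 2 * step 1.
  apply: average_near => //.
  by move=> x ax xa; apply: H2; rewrite ger0_norm; lra.
have : ip leb (oo 0 l) u (fun x => e^-1 * eta (e^-1 * x - e^-1 * a)) =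
       ip leb (oo 0 l) u (fun x => e^-1 * eta (e^-1 * x - e^-1 * b)).
  apply/eqP; rewrite -subr_eq0 -ipBr//; try exact: etaM_sqint.
  apply/eqP; rewrite -[RHS](H _ (plateau_test e0 a0 ab bel)).
  apply: eq_Rintegral => x _; congr (_ * _); rewrite derive1E.
  by rewrite -mulrBr; apply/esym/derive_val; exact: plateau_derive.
move=> E; rewrite E in A1; rewrite -(ler_pM2r step1_gt0) -[X in _ * X <= _]gtr0_norm ?step1_gt0//.
rewrite -normrM mulrBl; move: A1 A2; rewrite !ler_norml.
set I := ip _ _ _ _; lra.
Qed.

End DuBoisReymond.

End Plateaus.

(** * Weak derivatives on an interval *)

Section WeakDerivatives.
Context {R : realType}.
Implicit Types (a b c l x y : R) (f g h k F : R -> R).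
Local Notation leb := (@lebesgue_measure R).
Local Notation "'oo' a b" := (`]a, b[%classic : set (measurableTypeR R))
  (at level 10, a at level 9, b at level 9).
Hint Resolve moo : core.

(** The retraction of the line onto [0, l]. Composition with it extends a function
by constants, in the way [edge_param] does. *)
Definition clamp l x : R := Num.max 0 (Num.min x l).

Lemma clamp_itv l x : 0 <= l -> 0 <= clamp l x <= l.
Proof. by move=> l0; rewrite /clamp le_max lexx ge_max l0 ge_min lexx orbT. Qed.

Lemma clamp_id l x : 0 <= x <= l -> clamp l x = x.
Proof. by case/andP => x0 xl; rewrite /clamp min_l// max_r. Qed.

Lemma clamp_le0 l x : x <= 0 -> clamp l x = 0.
Proof. by move=> x0; rewrite /clamp max_l// ge_min x0. Qed.

Lemma clamp_ge l x : 0 <= l -> l <= x -> clamp l x = l.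
Proof. by move=> l0 lx; rewrite /clamp min_r// max_r. Qed.

Lemma clamp_lip l x y : 0 <= l -> `|clamp l x - clamp l y| <= `|x - y|.
Proof.
move=> l0; wlog xy : x y / x <= y => [H|].
  have [/H//|/ltW yx] := leP x y.
  by rewrite distrC [leRHS]distrC; exact: H.
rewrite distrC [leRHS]distrC.
rewrite [leRHS]ger0_norm ?subr_ge0//.
rewrite /clamp /Num.max /Num.min ler_norml; do ![case: ifPn]; rewrite -?leNgt => *; lra.
Qed.

Lemma holder_clamp_continuous l f C : 0 <= l ->
  (forall a b, 0 <= a -> a <= b -> b <= l -> `|f b - f a| <= C * Num.sqrt (b - a)) ->
  continuous (f \o clamp l).
Proof.
move=> l0 H x; apply/cvgrPdist_le => /= e e0.
have : `|C| * Num.sqrt `|x - y| @[y --> x] --> `|C| * 0.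
  by apply: cvgMr; exact: cvg_sqrt_dist.
rewrite mulr0 => /cvgrPdist_le /(_ _ e0) Ce.
near=> y.
apply: (@le_trans _ _ (`|C| * Num.sqrt `|x - y|)); last first.
  by apply: le_trans (ler_norm _) _; rewrite -normrN -sub0r; near: y.
apply: (@le_trans _ _ (`|C| * Num.sqrt `|clamp l x - clamp l y|)); last first.
  by rewrite ler_wpM2l// ler_wsqrtr// clamp_lip.
have /andP[x0 xl] := clamp_itv x l0; have /andP[y0 yl] := clamp_itv y l0.
have HC p q : 0 <= p -> p <= q -> q <= l -> `|f q - f p| <= `|C| * Num.sqrt `|q - p|.
  move=> p0 pq ql; apply: le_trans (H _ _ p0 pq ql) _.
  by rewrite (@ger0_norm _ (q - p)) ?subr_ge0// ler_wpM2r// ler_norm.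
have [xy|/ltW yx] := leP (clamp l x) (clamp l y).
  by rewrite distrC [in leRHS]distrC HC.
by rewrite HC.
Unshelve. all: by end_near. Qed.

Lemma prim_clamp_continuous l f g : 0 <= l -> is_prim l f g -> continuous (f \o clamp l).
Proof.
move=> l0 fg; apply: (@holder_clamp_continuous _ _ (Num.sqrt (ip leb (oo 0 l) g g))) => //.
by move=> a b; exact: prim_holder.
Qed.

Definition primitive g x : R := \int[leb]_(t in oo 0 x) g t.

Lemma primitive_prim l g : sqint leb (oo 0 l) g -> is_prim l (primitive g) g.
Proof.
move=> sg; split => // a b a0 ab bl; rewrite /primitive.
rewrite (@Rint_split _ 0 a b)//; first by rewrite addrC addKr.
exact/sqint_integrable/(sqint_sub _ bl sg).
Qed.

Lemma primitive0 g : primitive g 0 = 0.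
Proof. exact: Rint_nil. Qed.

(** [is_L2_deriv] for an interval that is not given as an edge. *)
Definition weak_deriv l f g : Prop := sqint leb (oo 0 l) g /\
  forall phi, test_fun l phi ->
    \int[leb]_(s in oo 0 l) (f s * derive1 phi s) =
    - \int[leb]_(s in oo 0 l) (g s * phi s).

Lemma test_prim l phi : test_fun l phi -> is_prim l phi (derive1 phi).
Proof.
move=> [sm _]; have s1 := sm 1%N.
apply: prim_C1 => [x _|x].
  by rewrite derive1E; apply: DeriveDef => //; exact: (sm 0%N).
by apply: differentiable_continuous; apply/derivable1_diffP; exact: s1.
Qed.

Lemma test_ends l phi : test_fun l phi -> phi 0 = 0 /\ phi l = 0.
Proof.
move=> [_ [a [b [a0 bl H]]]]; split; apply/eqP; apply: contraT => /H /andP[? ?]; lra.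
Qed.

Lemma prim_weak l f g : 0 <= l -> is_prim l f g -> weak_deriv l f g.
Proof.
move=> l0 fg; split; first exact: prim_sqint fg.
move=> phi tphi; have := prim_by_parts l0 fg (test_prim tphi).
by have [-> ->] := test_ends tphi; rewrite !mulr0 subrr sub0r.
Qed.

(** The difference between f and the primitive of g has weak derivative 0, so it is
constant inside of the interval by [du_bois_reymond], and up to the ends by
continuity. *)
Lemma weak_prim l f g : 0 < l -> continuous f -> weak_deriv l f g -> is_prim l f g.
Proof.
move=> l0 cf [sg fg]; have Gg := primitive_prim sg.
have cG := prim_clamp_continuous (ltW l0) Gg.
pose u x := f x - (primitive g \o clamp l) x.
have cu : continuous u by move=> x; apply: cvgB; [exact: cf|exact: cG].
have sf : sqint leb (oo 0 l) f.
  have [M [_ HM]] : bounded_set (f @` `[0, l]).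
    apply: compact_bounded; apply: continuous_compact; last exact: segment_compact.
    exact: continuous_subspaceT.
  apply: (@sqint_bounded _ _ _ _ _ _ (M + 1)) => //; first exact: leb_itv_fin.
    apply: measurable_funTS; exact: continuous_measurable_fun.
  move=> x /=; rewrite in_itv/= => /andP[x0 xl].
  by apply: (HM (M + 1)); rewrite ?ltrDl//; exists x => //=; rewrite in_itv/= !ltW.
have su' : sqint leb (oo 0 l) (fun x => f x - primitive g x).
  by apply: sqintB => //; exact: prim_sqint_fun Gg.
have uE : {in oo 0 l, (fun x => f x - primitive g x) =1 u}.
  by move=> x; rewrite inE/= in_itv/= => /andP[x0 xl]; rewrite /u /= clamp_id// !ltW.
have su := eq_sqint uE su'.
have uc a b : 0 < a -> a <= b -> b < l -> u a = u b.
  apply: (du_bois_reymond su (fun x _ => cu x)) => phi tphi.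
  have sd := prim_sqint (test_prim tphi).
  rewrite -[LHS]/(ip leb (oo 0 l) u (derive1 phi)).
  rewrite -(eq_ip leb uE (fun x _ => erefl)) ipBl//; last exact: prim_sqint_fun Gg.
  rewrite [X in X - _](fg phi tphi) [X in _ - X]((prim_weak (ltW l0) Gg).2 phi tphi).
  by rewrite subrr.
have uc' a : 0 < a -> a < l -> u a = u (l / 2).
  move=> a0 al; have [al2|/ltW l2a] := leP a (l / 2).
    by apply: uc => //; lra.
  by apply/esym; apply: uc => //; lra.
have u0 : u 0 = u (l / 2).
  apply: (@cvg_unique _ _ (u x @[x --> 0^'+])); first exact: Rhausdorff.
    by apply: cvg_at_right_filter; exact: cu.
  apply: cvg_near_cst; near=> x; apply: uc'; first by [].
  by near: x; exact: nbhs_right_lt.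
have ul : u l = u (l / 2).
  apply: (@cvg_unique _ _ (u x @[x --> l^'-])); first exact: Rhausdorff.
    by apply: cvg_at_left_filter; exact: cu.
  apply: cvg_near_cst; near=> x; apply: uc'; last by [].
  by near: x; exact: nbhs_left_gt.
have ucc a : 0 <= a -> a <= l -> u a = u (l / 2).
  rewrite le_eqVlt => /predU1P[<- _|a0]; first exact: u0.
  by rewrite le_eqVlt => /predU1P[->|al]; [exact: ul|exact: uc'].
split => // a b a0 ab bl; rewrite -Gg.2//.
have al := le_trans ab bl; have b0 := le_trans a0 ab.
have : u a = u b by rewrite !ucc.
rewrite /u/= !clamp_id ?a0 ?b0//; lra.
Unshelve. all: by end_near. Qed.

(** Lebesgue differentiation of the primitive of g - g', which is constant. *)
Lemma prim_unique l f g g' : is_prim l f g -> is_prim l f g' ->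
  g = g' %[ae leb in oo 0 l].
Proof.
move=> fg fg'; have [sd d0] := primB fg fg'.
pose d : R -> R := (fun x => g x - g' x) \_ (oo 0 l).
have id : leb.-integrable setT (EFin \o d).
  rewrite /d -restrict_EFin; apply/integrable_restrict => //; rewrite setTI.
  exact: sqint_integrable sd.
have dint x : 0 <= x -> x <= l -> \int[leb]_(t in `[0, x]) d t = 0.
  move=> x0 xl.
  have i1 : leb.-integrable `[0, x] (EFin \o d) by exact: integrableS id.
  rewrite -Rintegral_itv_obnd_cbnd; last by apply: integrableS id.
  rewrite -Rintegral_itv_bndo_bndc; last by apply: integrableS id.
  transitivity (\int[leb]_(t in oo 0 x) (g t - g' t)); last by rewrite -d0// !subrr.
  apply: eq_Rintegral.
  move=> t; rewrite inE/= in_itv/= => /andP[t0 tx]; rewrite /d patchE ifT// inE/= in_itv/=.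
  by rewrite t0 (lt_le_trans tx).
have lid : locally_integrable [set: R] d.
  exact: (open_integrable_locally openT id).
have idy y : leb.-integrable [set` Interval (BLeft 0) (BRight y)] (EFin \o d).
  by apply: integrableS id.
have := @FTC1 R d (BLeft 0) idy lid.
apply: filterS; first exact: (ae_filter_ringOfSetsType leb).
move=> x /= + x0l; move: (x0l); rewrite in_itv/= => /andP[x0 xl].
rewrite lte_fin x0 => /(_ erefl) [_].
have dz : is_derive x 1 (fun x => \int[leb]_(t in [set` Interval (BLeft 0) (BRight x)]) d t) 0.
  apply: (@near_eq_is_derive _ _ _ (cst 0)); near=> y; rewrite /cst dint//.
    by apply: ltW; near: y; exact: lt_nbhsr.
  by apply: ltW; near: y; exact: lt_nbhsl.
rewrite derive1E (@derive_val _ _ _ _ _ _ _ dz) /d patchE mem_set//.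
by move/eqP; rewrite eq_sym subr_eq0 => /eqP.
Unshelve. all: by end_near. Qed.

Lemma prim_eq l f f' g : is_prim l f g -> (forall x, 0 <= x <= l -> f x = f' x) ->
  is_prim l f' g.
Proof.
move=> [sg fg] ff'; split => // a b a0 ab bl.
have al := le_trans ab bl; have b0 := le_trans a0 ab.
by rewrite -(ff' b) ?b0// -(ff' a) ?a0//; exact: fg.
Qed.

End WeakDerivatives.

(** * Density of primitives with given mean *)

Section Density.
Context {R : realType}.
Implicit Types (a b c l x y : R) (f g h k F : R -> R).
Local Notation leb := (@lebesgue_measure R).
Local Notation "'oo' a b" := (`]a, b[%classic : set (measurableTypeR R))
  (at level 10, a at level 9, b at level 9).
Hint Resolve moo : core.

Definition approx l g := forall e, 0 < e -> exists p q, is_prim l p q /\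
  ip leb (oo 0 l) (fun x => g x - p x) (fun x => g x - p x) <= e.

Lemma approx_closure l g : sqint leb (oo 0 l) g ->
  (forall e, 0 < e -> exists h, [/\ sqint leb (oo 0 l) h, approx l h &
     ip leb (oo 0 l) (fun x => g x - h x) (fun x => g x - h x) <= e]) ->
  approx l g.
Proof.
move=> sg H e e0; have e4 : 0 < e / 4 by rewrite divr_gt0.
have [h [sh ah gh]] := H _ e4; have [p [q [pq hp]]] := ah _ e4.
exists p, q; split => //; have sp := prim_sqint_fun pq.
have := ip_sqrD (moo 0 l) (sqintB (moo 0 l) sg sh) (sqintB (moo 0 l) sh sp).
rewrite (_ : (fun x => g x - h x + (h x - p x)) = (fun x => g x - p x)); last first.
  by apply/funext => x; ring.
lra.
Qed.

(** Dominated convergence of the squares. *)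
Lemma ip_cvg0 l (u : nat -> R -> R) g : sqint leb (oo 0 l) g ->
  (forall n, measurable_fun (oo 0 l) (u n)) ->
  (forall n x, 0 < x -> x < l -> `|u n x| <= `|g x|) ->
  (forall x, 0 < x -> x < l -> u n x @[n --> \oo] --> (0 : R)) ->
  forall e, 0 < e -> exists n, ip leb (oo 0 l) (u n) (u n) <= e.
Proof.
move=> sg mu ug u0 e e0.
have := @dominated_cvg _ _ _ leb (oo 0 l) (moo 0 l)
  (fun n x => (u n x * u n x)%:E) (fun=> 0%E) (fun x => (g x ^+ 2)%:E).
have C1 n : measurable_fun (oo 0 l) (fun x => (u n x * u n x)%:E).
  by apply/measurable_EFinP/measurable_funM.
have C2 x : oo 0 l x -> (u n x * u n x)%:E @[n --> \oo] --> 0%E.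
  rewrite /= in_itv/= => /andP[x0 xl]; apply: cvg_EFin; first exact: nearW.
  by rewrite -(mulr0 0); apply: cvgM; exact: u0.
have C3 (n : nat) x : oo 0 l x -> (`|(u n x * u n x)%:E| <= (g x ^+ 2)%:E)%E.
  rewrite /= in_itv/= => /andP[x0 xl]; rewrite lee_fin normrM -expr2.
  by rewrite -(real_normK (num_real (g x))) lerXn2r ?nnegrE ?ug.
move=> /(_ C1 C2 (fun=> _) (sqint_sqr sg) C3).
move=> /(_ (fun _ _ => isT)); rewrite integral0 => /fine_cvgP[_].
move=> /cvgrPdist_le /(_ _ e0) [n _ /(_ n (leqnn n))] /=.
rewrite sub0r normrN => H; exists n; apply: le_trans H.
exact: ler_norm.
Qed.

(** The means of k over [x, x + h] are primitives, and tend to k(x) as h tends to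
0. *)
Lemma approx_continuous l k (M : R) : 0 < l -> continuous k -> (forall x, `|k x| <= M) ->
  approx l k.
Proof.
move=> l0 ck kM e e0.
(* the base point -2 makes K differentiable on both sides of 0 *)
pose K x : R := \int[leb]_(t in `[-2, x]) k t.
have dK x : -2 < x -> is_derive x 1 K (k x).
  move=> x2; have xx : x < x + 1 by rewrite ltrDl.
  have ie : leb.-integrable [set` Interval (BLeft (-2)) (BRight (x + 1))] (EFin \o k).
    apply: continuous_compact_integrable; first exact: segment_compact.
    exact: continuous_subspaceT.
  have [|d <-] := continuous_FTC1 xx ie _ (@ck x); first by rewrite lte_fin.
  by rewrite derive1E; apply: DeriveDef.
have Kk : is_prim (l + 1) K k.
  by apply: prim_C1 => // x x1; apply: dK; lra.
pose h (n : nat) : R := n.+1%:R^-1.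
have h0 n : 0 < h n by rewrite invr_gt0.
have h1 n : h n <= 1 by rewrite invf_le1 ?ler1n.
pose p (n : nat) x := (h n)^-1 * (K (1 * x - (- h n)) - K (1 * x - 0)).
have pp n : is_prim l (p n) (fun x => (h n)^-1 * (k (1 * x - (- h n)) - k (1 * x - 0))).
  apply: primZ; have ck' r : continuous (fun x => k (1 * x - r)).
    move=> x; apply: (@continuous_comp _ _ _ (fun y => 1 * y - r) k); last exact: ck.
    by apply: cvgB; [apply: cvgMr; exact: cvg_id|exact: cvg_cst].
  have hn := h0 n; apply: primB.
    apply: prim_C1 => [x x1|]; last exact: ck'.
    by rewrite -[k _]mul1r; apply: is_derive_affine; apply: dK; lra.
  apply: prim_C1 => [x x1|]; last exact: ck'.
  by rewrite -[k _]mul1r; apply: is_derive_affine; apply: dK; lra.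
have M0 : 0 <= M := le_trans (normr_ge0 _) (kM 0).
have pM n x : 0 < x -> x < l -> `|p n x| <= M.
  move=> x0 xl; rewrite /p !mul1r opprK subr0 normrM gtr0_norm ?invr_gt0//.
  have hn := h0 n; have hn1 := h1 n.
  rewrite mulrC ler_pdivrMr// Kk.2//; try lra.
  have ik : leb.-integrable (oo x (x + h n)) (EFin \o k).
    by apply/sqint_integrable/(sqint_sub _ _ (prim_sqint Kk)); lra.
  apply: le_trans (le_normr_Rintegral _ ik) _ => //.
  have -> : M * h n = \int[leb]_(t in oo x (x + h n)) M.
    rewrite Rintegral_cst// leb_itv; last by lra.
    by rewrite addrAC subrr add0r.
  apply: le_Rintegral => //; first exact: (integrable_abse ik).
  by apply: sqint_integrable; exact: sqint_cst.
have [n Hn] : exists n, ip leb (oo 0 l) (fun x => k x - p n x) (fun x => k x - p n x) <= e.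
  apply: (@ip_cvg0 _ (fun n x => k x - p n x) (fun=> 2 * M)) => //.
  - exact: sqint_cst.
  - move=> n; apply: measurable_funB; last exact: prim_measurable (pp n).
    by apply: measurable_funTS; exact: continuous_measurable_fun.
  - move=> n x x0 xl; apply: le_trans (ler_normB _ _) _.
    rewrite [leRHS]ger0_norm ?mulr_ge0//.
    by have := kM x; have := pM n x x0 xl; lra.
  - move=> x x0 xl.
    have x2 : -2 < x by lra.
    have dx := dK x x2; have [dd _] := dx.
    have : h^-1 *: (K (h *: 1 + x) - K x) @[h --> 0^'] --> k x.
      have := @derive_val _ _ _ _ _ _ _ dx; rewrite /derive => <-.
      exact: dd.
    move/cvg_dnbhs_at_right/cvg_at_rightP => /(_ h (conj h0 cvg_harmonic)) H.
    rewrite -(subrr (k x)); apply: cvgB; first exact: cvg_cst.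
    have -> : p ^~ x = (fun n => (h n)^-1 *: (K (h n *: 1 + x) - K x)); last exact: H.
    apply/funext => n; rewrite /p /GRing.scale/= !mul1r mulr1 subr0 opprK.
    by rewrite (addrC x).
by exists (p n), (fun x => (h n)^-1 * (k (1 * x - (- h n)) - k (1 * x - 0))).
Qed.

(** Continuous functions are dense in L^1. If moreover they are truncated at M, then
|g - k|^2 <= 2 M |g - k|, so that they approximate g in L^2. *)
Lemma approx_bounded l g (M : R) : 0 < l -> measurable_fun (oo 0 l) g ->
  (forall x, `|g x| <= M) -> approx l g.
Proof.
move=> l0 mg gM; have M0 : 0 <= M := le_trans (normr_ge0 _) (gM 0).
have sg : sqint leb (oo 0 l) g.
  by apply: (@sqint_bounded _ _ _ _ _ _ M) => //; exact: leb_itv_fin.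
apply: approx_closure => // e e0.
have [k_ [ck ik H]] := approximation_continuous_integrable (moo 0 l)
  (leb_itv_fin 0 l) (sqint_integrable sg).
have e2 : 0 < e / (2 * M + 1) by rewrite divr_gt0// ltr_wpDl// mulr_ge0.
have [n Hn] : exists n, (\int[leb]_(z in oo 0%R l) `|(g z - k_ n z)%R%:E| <=
    (e / (2 * M + 1))%R%:E)%E.
  move/fine_cvgP : H => [[N1 _ HN1] /cvgrPdist_le /(_ _ e2) [N2 _ HN2]].
  exists (maxn N1 N2); have := HN2 (maxn N1 N2) (leq_maxr _ _).
  have := HN1 (maxn N1 N2) (leq_maxl _ _) => /= fin.
  rewrite sub0r normrN => h; rewrite -(fineK fin) lee_fin; apply: le_trans h.
  exact: ler_norm.
(* truncation at M does not increase the distance to g, as |g| <= M *)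
pose k x := Num.max (- M) (Num.min (k_ n x) M).
have kM x : `|k x| <= M.
  by rewrite ler_norml /k le_max lexx ge_max ge_min lexx orbT andbT; lra.
have ck' : continuous k.
  move=> x; apply: (@continuous_max _ _ (fun=> - M) (fun x => Num.min (k_ n x) M)).
    exact: cst_continuous.
  by apply: (@continuous_min _ _ (k_ n) (fun=> M)); [exact: ck|exact: cst_continuous].
have mk : measurable_fun (oo 0 l) k.
  by apply: measurable_funTS; exact: continuous_measurable_fun.
have sk : sqint leb (oo 0 l) k.
  by apply: (@sqint_bounded _ _ _ _ _ _ M) => //; exact: leb_itv_fin.
exists k; split => //; first exact: approx_continuous kM.
have ka : leb.-integrable (oo 0 l) (fun x => (g x - k_ n x)%:E).
  by apply: integrableB_EFin => //; exact: sqint_integrable sg.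
apply: (@le_trans _ _ (2 * M * \int[leb]_(x in oo 0 l) `|g x - k_ n x|)).
  rewrite -RintegralZl//; last exact: (integrable_abse ka).
  have sgk := sqintB (moo 0 l) sg sk.
  apply: le_Rintegral => //; first exact: sqint_mul.
    apply: (@integrableZl _ _ _ leb _ (moo 0 l) _ (EFin \o (fun x => `|g x - k_ n x|))).
    exact: (integrable_abse ka).
  move=> x _; rewrite -expr2 -real_normK ?num_real// expr2; apply: ler_pM => //.
    by apply: le_trans (ler_normB _ _) _; have := gM x; have := kM x; lra.
  have := gM x; rewrite ler_norml /k /Num.max /Num.min => /andP[g1 g2].
  rewrite !ler_norml; have := ler_norm (g x - k_ n x); have := ler_norm (- (g x - k_ n x)).
  by rewrite normrN; do ![case: ifPn]; rewrite -?leNgt => *; apply/andP; split; lra.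
have : \int[leb]_(x in oo 0 l) `|g x - k_ n x| <= e / (2 * M + 1).
  rewrite -lee_fin fineK//; apply: integrable_fin_num => //; exact: (integrable_abse ka).
have M20 : 0 <= 2 * M by rewrite mulr_ge0.
move=> /(ler_wpM2l M20) /le_trans; apply.
by rewrite mulrCA ger_pMr// ler_pdivrMr ?mul1r ?lerDl// ltr_wpDl.
Qed.

(** By truncation. *)
Lemma approx_sqint l g : 0 < l -> sqint leb (oo 0 l) g -> approx l g.
Proof.
move=> l0 sg; apply: approx_closure => // e e0.
pose c (n : nat) x := Num.max (- n%:R) (Num.min (g x) n%:R).
have mg := sqint_measurable sg.
have mc n : measurable_fun (oo 0 l) (c n).
  by apply: measurable_maxr => //; exact: measurable_minr.
have cn n x : `|c n x| <= n%:R.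
  rewrite ler_norml /c le_max lexx ge_max ge_min lexx orbT andbT/=.
  by rewrite (@le_trans _ _ 0)// oppr_le0.
have cg n x : `|g x - c n x| <= `|g x|.
  have n0 : 0 <= n%:R :> R by [].
  rewrite /c /Num.max /Num.min; have := ler_norm (g x); have := ler_norm (- g x).
  rewrite normrN ler_norml.
  by do ![case: ifPn]; rewrite -?leNgt => *; apply/andP; split; lra.
have gc x : 0 < x -> x < l -> g x - c n x @[n --> \oo] --> (0 : R).
  move=> x0 xl.
  apply: cvg_near_cst; exists (Num.truncn `|g x|).+1 => // n /= Hn.
  have : `|g x| <= n%:R.
    by rewrite ltW// (lt_le_trans (truncnS_gt _))// ler_nat.
  rewrite ler_norml => /andP[h1 h2].
  by rewrite /c min_l// max_r// subrr.
have [n Hn] := @ip_cvg0 l (fun n x => g x - c n x) g sg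
  (fun n => measurable_funB mg (mc n)) (fun n x _ _ => cg n x) gc e e0.
exists (c n); split => //.
  by apply: (@sqint_bounded _ _ _ _ _ _ n%:R) => //; exact: leb_itv_fin.
exact: approx_bounded (mc n) (cn n).
Qed.

Lemma prim_id l : is_prim l (fun x => x) (fun=> 1).
Proof. by apply: prim_C1 => x; exact: cvg_cst. Qed.

(** A function that vanishes at both ends and is positive in between, for cutting
off and for adjusting means. *)
Definition hat l x : R := x * (l - x).

Lemma hat_prim l : 0 <= l -> exists q, is_prim l (hat l) q.
Proof.
move=> l0; eexists; apply: prim_mul => //; first exact: prim_id.
by apply: primB; [exact: prim_cst|exact: prim_id].
Qed.

Lemma hat_ge0 l x : 0 <= x -> x <= l -> 0 <= hat l x.
Proof. by move=> x0 xl; rewrite mulr_ge0// subr_ge0. Qed.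

(** The cut-off factor is 1 - psi = b / (b + r), with b = [hat l]: it vanishes at
the ends, and tends to 1 inside of the interval as r tends to 0. *)
Lemma prim_cutoff l p q e : 0 < l -> is_prim l p q -> 0 < e ->
  exists p' q', [/\ is_prim l p' q', p' 0 = 0, p' l = 0 &
    ip leb (oo 0 l) (fun x => p x - p' x) (fun x => p x - p' x) <= e].
Proof.
move=> l0 pq e0; pose b := hat l; have [bq hb] := hat_prim (ltW l0).
pose r (n : nat) : R := n.+1%:R^-1.
have r0 n : 0 < r n by rewrite invr_gt0.
have br n x : 0 <= x -> x <= l -> r n <= b x + r n.
  by move=> x0 xl; rewrite lerDr hat_ge0.
pose psi n x := r n * (b x + r n)^-1.
pose dpsi n x := r n * (- (b x + r n)^-1 ^+ 2 * (bq x + 0)).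
have Hpsi n : is_prim l (psi n) (dpsi n).
  apply: primZ; apply: (prim_inv (ltW l0) (r0 n) _ (br n)).
  by apply: primD => //; exact: prim_cst.
have psi01 n x : 0 <= x -> x <= l -> 0 <= psi n x <= 1.
  move=> x0 xl; have := br n x x0 xl; have := r0 n => rn brx.
  have brp := lt_le_trans rn brx.
  by rewrite /psi divr_ge0 ?(ltW rn) ?(ltW brp)//= ler_pdivrMr// mul1r.
pose p' n x := p x - psi n x * p x.
have Hp' n : is_prim l (p' n) (fun x => q x - (psi n x * q x + dpsi n x * p x)).
  by apply: primB => //; apply: prim_mul => //; exact: ltW.
have b0 x : x = 0 \/ x = l -> b x = 0.
  by case=> ->; rewrite /b /hat ?mul0r// subrr mulr0.
have ends n x : x = 0 \/ x = l -> p' n x = 0.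
  by move=> xx; rewrite /p' /psi b0// add0r divff ?gt_eqF// mul1r subrr.
have pp' n : (fun x => p x - p' n x) = (fun x => psi n x * p x).
  by apply/funext => x; rewrite /p'; ring.
have cvg x : 0 < x -> x < l -> p x - p' n x @[n --> \oo] --> (0 : R).
  move=> x0 xl; have bx : 0 < b x by rewrite /b /hat mulr_gt0// subr_gt0.
  have -> : (fun n => p x - p' n x) = (fun n => r n * ((b x + r n)^-1 * p x)).
    by apply/funext => n; rewrite /p' /psi; ring.
  rewrite -(mul0r ((b x + 0)^-1 * p x)); apply: cvgM; first exact: cvg_harmonic.
  apply: cvgM; last exact: cvg_cst.
  apply: cvgV; first by rewrite addr0 gt_eqF.
  by apply: cvgD; [exact: cvg_cst|exact: cvg_harmonic].
have ppx n x : 0 < x -> x < l -> `|p x - p' n x| <= `|p x|.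
  move=> x0 xl; have /andP[h0 h1] := psi01 n x (ltW x0) (ltW xl).
  rewrite (_ : p x - p' n x = psi n x * p x); last by rewrite /p'; ring.
  by rewrite normrM ger0_norm// ler_piMl.
have [n Hn] := @ip_cvg0 l (fun n x => p x - p' n x) p (prim_sqint_fun pq)
  (fun n => measurable_funB (prim_measurable pq) (prim_measurable (Hp' n))) ppx cvg e e0.
exists (p' n), (fun x => q x - (psi n x * q x + dpsi n x * p x)).
by split => //; apply: ends; [left|right].
Qed.

(** A multiple of [hat l] restores the mean after the cut-off. With equal means, the
primitives of p and g have the same increment over the interval: this is what
glues the approximations on the edges together in [dom_dense]. *)
Lemma prim_dense l g e : 0 < l -> sqint leb (oo 0 l) g -> 0 < e ->
  exists p q, [/\ is_prim l p q, p 0 = 0, p l = 0,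
    \int[leb]_(x in oo 0 l) p x = \int[leb]_(x in oo 0 l) g x &
    ip leb (oo 0 l) (fun x => g x - p x) (fun x => g x - p x) <= e].
Proof.
move=> l0 sg e0; have ll := ltW l0.
have [bq hb] := hat_prim ll; have sb := prim_sqint_fun hb.
pose B := \int[leb]_(x in oo 0 l) hat l x.
have BE : B = l ^+ 3 / 6.
  (* x (l - x) is the derivative of (l / 2) x^2 - x^3 / 3 *)
  have sq := prim_sqr ll (prim_id l).
  have := primB (primZ (l / 2) sq) (primZ 3^-1 (prim_mul ll (prim_id l) sq)).
  move=> [_ /(_ 0 l (lexx 0) ll (lexx l)) H].
  rewrite /B (_ : l ^+ 3 / 6 = l / 2 * l ^+ 2 - 3^-1 * (l * l ^+ 2) -
    (l / 2 * 0 ^+ 2 - 3^-1 * (0 * 0 ^+ 2))); last by field.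
  by rewrite H; apply: eq_Rintegral => x _; rewrite /hat; field.
have B0 : 0 < B by rewrite BE divr_gt0// exprn_gt0.
pose b2 := ip leb (oo 0 l) (hat l) (hat l).
have b20 : 0 <= b2 by exact: ip_ge0.
have BB : 0 < B ^+ 2 by rewrite exprn_gt0.
have K0 : 0 < 4 + 2 * (l / B ^+ 2) * b2.
  by rewrite ltr_pwDl// !mulr_ge0// invr_ge0 ltW.
(* the error of p2 is at most 4 e', and the squared coefficient of the correction
   is at most (l / B^2) 4 e' *)
pose e' := e / (4 + 2 * (l / B ^+ 2) * b2) / 4.
have e'0 : 0 < e' by rewrite !divr_gt0.
have [p1 [q1 [pq1 h1]]] := approx_sqint l0 sg e'0.
have [p2 [q2 [pq2 p20 p2l h2]]] := prim_cutoff l0 pq1 e'0.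
have sp1 := prim_sqint_fun pq1; have sp2 := prim_sqint_fun pq2.
have h12 := ip_sqrD (moo 0 l) (sqintB (moo 0 l) sg sp1) (sqintB (moo 0 l) sp1 sp2).
rewrite (_ : (fun x => g x - p1 x + (p1 x - p2 x)) = (fun x => g x - p2 x)) in h12; last first.
  by apply/funext => x; ring.
pose u x := g x - p2 x; have su : sqint leb (oo 0 l) u by exact: sqintB.
have uu : ip leb (oo 0 l) u u <= 4 * e' by rewrite /u; lra.
pose I := \int[leb]_(x in oo 0 l) u x.
have I2 : I ^+ 2 <= l * ip leb (oo 0 l) u u.
  have := ip_CS (moo 0 l) (sqint_cst 0 l 1) su.
  by rewrite ip1 ip11 ?subr0.
pose p x := p2 x + I / B * hat l x.
have pq : is_prim l p (fun x => q2 x + I / B * bq x) by apply: primD => //; exact: primZ.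
have ig := sqint_integrable sg; have ip2 := sqint_integrable sp2.
have ib := sqint_integrable sb; have ibZ := sqint_integrable (sqintZ (moo 0 l) (I / B) sb).
exists p, (fun x => q2 x + I / B * bq x); split => //.
- by rewrite /p p20 /hat mul0r mulr0 addr0.
- by rewrite /p p2l /hat subrr !mulr0 addr0.
- rewrite RintegralD// RintegralZl// -/B divfK ?gt_eqF//.
  by rewrite /I /u RintegralB//; ring.
- have := ip_sqrD (moo 0 l) su (sqintZ (moo 0 l) (- (I / B)) sb).
  rewrite (_ : (fun x => u x + - (I / B) * hat l x) = (fun x => g x - p x)); last first.
    by apply/funext => x; rewrite /u /p; ring.
  have sZ := sqintZ (moo 0 l) (- (I / B)) sb.
  rewrite ipZl// ipZr// -/b2 => /le_trans; apply.
  have -> : - (I / B) * (- (I / B) * b2) = I ^+ 2 / B ^+ 2 * b2.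
    by field; rewrite gt_eqF.
  have : I ^+ 2 / B ^+ 2 * b2 <= l / B ^+ 2 * b2 * (4 * e').
    have -> : I ^+ 2 / B ^+ 2 * b2 = I ^+ 2 * (b2 / B ^+ 2) by ring.
    have -> : l / B ^+ 2 * b2 * (4 * e') = l * (4 * e') * (b2 / B ^+ 2) by ring.
    rewrite ler_wpM2r ?divr_ge0 ?(ltW BB)//.
    by apply: le_trans I2 _; rewrite ler_wpM2l.
  have : e = (4 + 2 * (l / B ^+ 2) * b2) * (4 * e').
    by rewrite /e' [4 * _]mulrC divfK// mulrC divfK ?gt_eqF.
  set X := l / B ^+ 2 * b2; have -> : 2 * (l / B ^+ 2) * b2 = 2 * X by rewrite /X; ring.
  set Y := I ^+ 2 / _ * _; nra.
Qed.

End Density.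

(** * Functions and integrals on a metric graph *)

Section GraphSpace.
Context {R : realType} {G : metricGraph R} (c : edge G -> {posnum R}).
Local Notation X := (graph_space G).
Local Notation mu := (graph_measure c).
Local Notation leb := (@lebesgue_measure R).
Local Notation Io := (fun e : edge G =>
  (edge_interval e : set (measurableTypeR R))).
Implicit Types (e : edge G) (s : R).

Lemma edge_param_in e s (h : 0 < s < len e) : edge_param e s = Inner h.
Proof.
rewrite /edge_param; case: {-}_ / boolP => [h'|/negP//].
by rewrite (bool_irrelevance h h').
Qed.

Lemma edge_param_le0 e s : s <= 0 -> edge_param e s = Vertex (src e).
Proof.
move=> s0; rewrite /edge_param; case: {-}_ / boolP => [h|_]; last by rewrite s0.
by case/andP: {-}h; rewrite ltNge s0.
Qed.

Lemma edge_param_ge e s : len e <= s -> edge_param e s = Vertex (tgt e).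
Proof.
move=> ls; rewrite /edge_param; case: {-}_ / boolP => [h|_].
  by case/andP: {-}h => _; rewrite ltNge ls.
by rewrite leNgt (lt_le_trans (len_gt0 e) ls).
Qed.

Lemma of_edges_in (g : edge G -> R -> R) e s : 0 < s < len e ->
  of_edges g (edge_param e s) = g e s.
Proof. by move=> h; rewrite (edge_param_in h). Qed.

(** The topology is final for the parametrizations of the edges. *)
Lemma space_continuousP (f : X -> R) :
  (forall e, continuous (restr_edge f e)) -> continuous f.
Proof.
move=> H; apply/continuousP => U oU; rewrite openE.
move=> x fx; exists (f @^-1` U); split => //.
by move=> e; rewrite -comp_preimage; have /continuousP := H e; exact.
Qed.

Lemma space_continuous_restr (f : X -> R) e :
  continuous f -> continuous (restr_edge f e).
Proof.
move=> cf x; apply: continuous_comp; first exact: edge_param_continuous.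
exact: cf.
Qed.

Lemma space_openP (U : set X) : space_open U -> open U.
Proof. by []. Qed.

Lemma open_space_measurable (U : set X) : open U -> measurable U.
Proof. by move=> oU; exact: sub_gen_smallest. Qed.

Lemma continuous_space_measurable (f : X -> R) : continuous f -> measurable_fun setT f.
Proof.
move=> /continuousP cf; apply: (measurability _ (RGenOpens.measurableE R)).
move=> _ [_ [a [b ->] <-]]; rewrite setTI; apply: open_space_measurable.
exact/cf/interval_open.
Qed.

Definition edge_coord e (x : X) : R :=
  match x with Vertex _ => 0 | @Inner _ _ e' s _ => if e' == e then s else 0 end.

Definition edge_part e (U : set R) : set X :=
  [set x | exists s (h : 0 < s < len e), U s /\ x = Inner h].

Lemma edge_part_open e U : open U -> open (edge_part e U).
Proof.
move=> oU; apply: space_openP => e'.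
have [->|ne] := eqVneq e' e.
  rewrite (_ : _ @^-1` _ = U `&` `]0, len e[%classic); first exact: openI.
  apply/seteqP; split => s /=.
    move=> [t [h [Ut]]].
    have [s0|s0] := leP s 0; first by rewrite edge_param_le0.
    have [ls|ls] := leP (len e) s; first by rewrite edge_param_ge.
    have h' : 0 < s < len e by rewrite s0.
    by rewrite (edge_param_in h') => -[->]; rewrite in_itv.
  move=> [Us]; rewrite in_itv/= => h; exists s, h; split => //.
  exact: edge_param_in.
rewrite (_ : _ @^-1` _ = set0); first exact: open0.
apply/seteqP; split => // s /= [t [h [_]]].
have [s0|s0] := leP s 0; first by rewrite edge_param_le0.
have [ls|ls] := leP (len e') s; first by rewrite edge_param_ge.
have h' : 0 < s < len e' by rewrite s0.
by rewrite (edge_param_in h') => -[/eqP]; rewrite (negbTE ne).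
Qed.

Lemma edge_coord_measurable e : measurable_fun setT (edge_coord e).
Proof.
apply: (measurability _ (RGenOpens.measurableE R)).
move=> _ [_ [a [b ->] <-]]; rewrite setTI; set U := (X in _ @^-1` X).
have oU : open U by rewrite /U; exact: interval_open.
have mU : measurable (edge_part e U).
  by apply: open_space_measurable; apply: edge_part_open.
have mT : measurable (edge_part e setT).
  by apply: open_space_measurable; apply: edge_part_open; exact: openT.
have [U0|U0] := pselect (U 0).
  rewrite (_ : _ @^-1` _ = edge_part e U `|` ~` edge_part e setT).
    by apply: measurableU => //; exact: measurableC.
  apply/seteqP; split.
    move=> [p|e' s h] /=; first by move=> _; right => -[s [h [_]]].
    have [E|ne] := eqVneq e' e; first by move: h; rewrite E => h Us; left; exists s, h.
    by move=> _; right => -[t [h' [_ [/eqP]]]]; rewrite (negbTE ne).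
  move=> [p|e' s h] /=; first by [].
  have [E|//] := eqVneq e' e; move: h; rewrite E => h [[t [h' [Ut [->]]]]//|].
  by move=> H; exfalso; apply: H; exists s, h.
rewrite (_ : _ @^-1` _ = edge_part e U)//; apply/seteqP; split.
  move=> [p|e' s h] //=.
  by have [E|//] := eqVneq e' e; move: h; rewrite E => h Us; exists s, h.
by move=> [p|e' s h] /= [t [h' [Ut]]]// [-> ->]; rewrite eqxx.
Qed.

(** The function is a sum over the edges of functions of the coordinates. Points
off the edge e have coordinate 0, which is not in the open interval. *)
Lemma of_edges_measurable (g : edge G -> R -> R) :
  (forall e, measurable_fun (Io e) (g e)) -> measurable_fun setT (of_edges g).
Proof.
move=> mg.
rewrite (_ : of_edges g = (fun x => \sum_(e : edge G) (g e \_ (Io e)) (edge_coord e x))).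
  apply: measurable_sum => e.
  apply: (@measurableT_comp _ _ _ _ _ _ (g e \_ (Io e))); last exact: edge_coord_measurable.
  by apply/(measurable_restrictT _ _).1; [exact: moo|exact: mg].
have out e : (g e \_ (Io e)) 0 = 0.
  by rewrite patchE memNset//= /edge_interval/= in_itv/= ltxx.
apply/funext => -[p|e s h] /=; first by rewrite big1.
rewrite (bigD1 e)//= eqxx big1 ?addr0 => [|e' ne].
  by rewrite patchE mem_set// /edge_interval/= in_itv/=.
by rewrite eq_sym (negbTE ne).
Qed.

End GraphSpace.

Section GraphIntegral.
Context {R : realType} {G : metricGraph R} (c : edge G -> {posnum R}).
Local Notation X := (graph_space G).
Local Notation mu := (graph_measure c).
Local Notation leb := (@lebesgue_measure R).
Local Notation Io := (fun e : edge G =>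
  (edge_interval e : set (measurableTypeR R))).
Implicit Types (e : edge G) (s : R).

Lemma mIo e : measurable (Io e).
Proof. exact: moo. Qed.

Section EdgeMeasure.
Variable e : edge G.

Definition edge_restr : {measure set (measurableTypeR R) -> \bar R} :=
  mrestr leb (mIo e).

Definition edge_push : {measure set X -> \bar R} :=
  measure_function_pushforward__canonical__measure_function_Measure
    edge_restr (@measurable_edge_param R G e).

Definition edge_measure : {measure set X -> \bar R} :=
  mscale ((c e)%:num%:nng)%R edge_push.

Lemma edge_measureE (A : set X) : edge_measure A =
  ((c e)%:num%:E * leb (Io e `&` edge_param e @^-1` A))%E.
Proof. by rewrite /edge_measure/= /mscale/= /pushforward/= /mrestr setIC. Qed.

Lemma ge0_integral_edge_measure (F : X -> \bar R) :
  measurable_fun setT F -> (forall x, 0 <= F x)%E ->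
  (\int[edge_measure]_x F x =
   (c e)%:num%:E * \int[leb]_(s in Io e) F (edge_param e s))%E.
Proof.
move=> mF F0; rewrite ge0_integral_mscale//; congr (_ * _)%E.
have mep := @measurable_edge_param R G e.
rewrite (@ge0_integral_pushforward _ _ (measurableTypeR R) X R _ mep edge_restr)//.
rewrite preimage_setT.
have mFe : measurable_fun setT (F \o edge_param e : measurableTypeR R -> \bar R).
  exact: measurableT_comp mF mep.
rewrite (@ge0_negligible_integral _ _ _ edge_restr setT (~` Io e))//.
- rewrite setTD setCK; apply: eq_measure_integral => A mA AI.
  by rewrite /edge_restr/= /mrestr setIidl.
- by apply: measurableC; exact: mIo.
- by move=> x _; exact: F0.
- by rewrite /edge_restr/= /mrestr setICl measure0.
Qed.

End EdgeMeasure.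

(** The edges are numbered, as finite sums of measures are over natural numbers. *)
Definition nth_edge_measure (n : nat) : {measure set X -> \bar R} :=
  match insub n : option 'I_#|edge G| with
  | Some i => edge_measure (enum_val i) | None => mzero end.

Lemma nth_edge_measureE (i : 'I_#|edge G|) :
  nth_edge_measure i = edge_measure (enum_val i).
Proof.
rewrite /nth_edge_measure insubT/=; first exact: ltn_ord.
by move=> h; congr (edge_measure (enum_val _)); exact: val_inj.
Qed.

(** The measure of the graph is the sum of the push-forwards of the weighted
Lebesgue measures of the edges. *)
Lemma ge0_integral_graph (F : X -> \bar R) :
  measurable_fun setT F -> (forall x, 0 <= F x)%E ->
  (\int[mu]_x F x =
   \sum_(e : edge G) (c e)%:num%:E * \int[leb]_(s in Io e) F (edge_param e s))%E.
Proof.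
move=> mF F0.
rewrite (@eq_measure_integral _ _ _ setT (msum nth_edge_measure #|edge G|)); last first.
  move=> A mA _; rewrite /= /msum /graph_measure.
  rewrite (reindex_onto (@enum_val _ (mem (edge G))) enum_rank)/=; last first.
    by move=> e _; rewrite enum_rankK.
  rewrite (eq_bigl xpredT); last by move=> i; rewrite enum_valK eqxx.
  apply: eq_bigr => i _; rewrite nth_edge_measureE.
  by rewrite edge_measureE.
rewrite ge0_integral_measure_sum//.
rewrite [RHS](reindex_onto (@enum_val _ (mem (edge G))) enum_rank)/=; last first.
  by move=> e _; rewrite enum_rankK.
rewrite [RHS](eq_bigl xpredT); last by move=> i; rewrite enum_valK eqxx.
apply: eq_bigr => i _; rewrite nth_edge_measureE.
exact: ge0_integral_edge_measure.
Qed.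

End GraphIntegral.

Section GraphSquareIntegrable.
Context {R : realType} {G : metricGraph R} (c : edge G -> {posnum R}).
Local Notation X := (graph_space G).
Local Notation mu := (graph_measure c).
Local Notation leb := (@lebesgue_measure R).
Local Notation Io := (fun e : edge G =>
  (edge_interval e : set (measurableTypeR R))).
Implicit Types (e : edge G) (s : R).

Lemma mT : measurable [set: X].
Proof. exact: measurableT. Qed.
Hint Resolve mT : core.

Lemma ip_fin d (T : measurableType d) (m : {measure set T -> \bar R}) (D : set T)
  (f g : T -> R) : measurable D -> sqint m D f -> sqint m D g ->
  (ip m D f g)%:E = (\int[m]_(x in D) (f x * g x)%:E)%E.
Proof.
by move=> mD sf sg; rewrite fineK//; apply: integrable_fin_num => //; apply: sqint_mul.
Qed.

Lemma L2_sqint (f : X -> R) : L2 c f <-> sqint mu setT f.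
Proof.
rewrite /L2 /sqint; split.
  move=> Lf; split.
    by move: Lf; rewrite inE => /andP[/[!inE]/=].
  exact: (integrable_lty mT (Lfun2_integrable_sqr Lf)).
move=> [mf foo]; rewrite inE; apply/andP; rewrite !inE/=; split => //.
rewrite /finite_norm unlock /Lnorm poweR_lty//.
under eq_integral do rewrite /= powR_mulrn ?normr_ge0// real_normK ?num_real//.
exact: foo.
Qed.

Lemma LnormE (f : X -> R) : sqint mu setT f ->
  ('N[mu]_2%:E[EFin \o f])%E = (Num.sqrt (ip mu setT f f))%:E.
Proof.
move=> sf; rewrite unlock /Lnorm.
under eq_integral do rewrite /= powR_mulrn ?normr_ge0// real_normK ?num_real// expr2.
by rewrite -ip_fin// poweR_EFin powR12_sqrt// ip_ge0.
Qed.

Lemma L2normE (f : X -> R) : sqint mu setT f ->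
  L2norm c f = Num.sqrt (ip mu setT f f).
Proof. by move=> sf; rewrite /L2norm LnormE. Qed.

Lemma restr_edge_measurable (f : X -> R) e : measurable_fun setT f ->
  measurable_fun (Io e) (restr_edge f e).
Proof.
move=> mf; apply: measurable_funTS.
by apply: measurableT_comp => //; exact: measurable_edge_param.
Qed.

Lemma int_sqr_graph (f : X -> R) : measurable_fun setT f ->
  (\int[mu]_x (f x ^+ 2)%:E = \sum_(e : edge G) (c e)%:num%:E *
     \int[leb]_(s in Io e) (restr_edge f e s ^+ 2)%:E)%E.
Proof.
move=> mf; apply: ge0_integral_graph; last by move=> x; rewrite lee_fin sqr_ge0.
by apply/measurable_EFinP; exact: measurable_funX.
Qed.

Lemma sqint_edge (f : X -> R) e : sqint mu setT f -> sqint leb (Io e) (restr_edge f e).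
Proof.
move=> [mf foo]; split; first exact: restr_edge_measurable.
move: foo; rewrite int_sqr_graph// ltey => foo.
rewrite ltey; apply: contra_neq foo => Ie.
have c0 : (0 < (c e)%:num%:E)%E by rewrite lte_fin.
apply/esum_eqyP; last by exists e; split; rewrite ?mem_index_enum// Ie gt0_muley.
move=> e' _; rewrite gt_eqF// (lt_le_trans ltNy0)// mule_ge0//.
by apply: integral_ge0 => x _; rewrite lee_fin sqr_ge0.
Qed.

Lemma sqint_graph (f : X -> R) : measurable_fun setT f ->
  (forall e, sqint leb (Io e) (restr_edge f e)) -> sqint mu setT f.
Proof.
move=> mf sf; split => //; rewrite int_sqr_graph//.
apply: lte_sum_pinfty => e _; apply: lte_mul_pinfty => //.
by case: (sf e).
Qed.

Lemma ip_sqr_graph (f : X -> R) : sqint mu setT f ->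
  ip mu setT f f = \sum_(e : edge G) (c e)%:num * ip leb (Io e) (restr_edge f e) (restr_edge f e).
Proof.
move=> sf; apply: EFin_inj; rewrite ip_fin// -sumEFin.
under eq_integral do rewrite -expr2.
rewrite int_sqr_graph; last exact: sqint_measurable sf.
apply: eq_bigr => e _; have me := @mIo R G e; have se := sqint_edge e sf.
by rewrite EFinM ip_fin.
Qed.

(** By polarization of the case f = g, where the integrand is nonnegative. *)
Lemma ip_graph (f g : X -> R) : sqint mu setT f -> sqint mu setT g ->
  ip mu setT f g = \sum_(e : edge G) (c e)%:num * ip leb (Io e) (restr_edge f e) (restr_edge g e).
Proof.
move=> sf sg; have sD := sqintD mT sf sg; have sB := sqintB mT sf sg.
have := ip_sqr_graph sD; have := ip_sqr_graph sB.
rewrite ipBl// !ipBr// ipDl// !ipDr// (ipC _ _ g f) => HB HD.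
have -> : ip mu setT f g = 4^-1 * (ip mu setT f f + ip mu setT f g +
    (ip mu setT f g + ip mu setT g g) - (ip mu setT f f - ip mu setT f g -
    (ip mu setT f g - ip mu setT g g))) by field.
rewrite HB HD -sumrB mulr_sumr; apply: eq_bigr => e _.
have sfe := sqint_edge e sf; have sge := sqint_edge e sg.
have me := @mIo R G e.
have -> : restr_edge (fun x => f x + g x) e = (fun s => restr_edge f e s + restr_edge g e s) by [].
have -> : restr_edge (fun x => f x - g x) e = (fun s => restr_edge f e s - restr_edge g e s) by [].
have sDe := sqintD me sfe sge; have sBe := sqintB me sfe sge.
rewrite ipBl// !ipBr// ipDl// !ipDr//.
rewrite (ipC leb (edge_interval e) (restr_edge g e) (restr_edge f e)).
by field.
Qed.

Lemma graph_measure_setT : mu setT = (\sum_(e : edge G) (c e)%:num * len e)%:E.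
Proof.
rewrite /= /graph_measure -sumEFin; apply: eq_bigr => e _.
rewrite preimage_setT setIT EFinM lebesgue_measure_itv/= lte_fin len_gt0.
by rewrite -EFinD subr0.
Qed.

Lemma graph_measure_fin : (mu setT < +oo)%E.
Proof. by rewrite graph_measure_setT ltry. Qed.

(** Closed edges are images of compact intervals. *)
Lemma continuous_bounded (f : X -> R) : continuous f -> exists M, forall x, `|f x| <= M.
Proof.
move=> cf; have H e : exists M, forall s, 0 <= s <= len e -> `|f (edge_param e s)| <= M.
  have [M [_ HM]] : bounded_set (restr_edge f e @` `[0, len e]).
    apply: compact_bounded; apply: continuous_compact; last exact: segment_compact.
    by apply: continuous_subspaceT; exact: space_continuous_restr.
  exists (M + 1) => s s0; apply: (HM (M + 1)); first by rewrite ltrDl.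
  by exists s => //=; rewrite in_itv.
have [M HM] := choice H.
pose N := \sum_(e : edge G) `|M e| + \sum_(p : vertex G) `|f (Vertex p)|.
exists N => -[p|e s h]; rewrite /N.
  by rewrite (bigD1 p)//= addrCA lerDl addr_ge0// sumr_ge0.
rewrite (bigD1 e)//= -addrA; apply: ler_wpDr.
  by rewrite addr_ge0// sumr_ge0.
apply: le_trans (ler_norm _); rewrite -(edge_param_in h); apply: HM.
by case/andP: h => /ltW -> /ltW ->.
Qed.

Lemma sqint_continuous (f : X -> R) : continuous f -> sqint mu setT f.
Proof.
move=> cf; have [M HM] := continuous_bounded cf.
by apply: (@sqint_bounded _ _ _ _ _ mT M) => //;
  [exact: graph_measure_fin|exact: continuous_space_measurable].
Qed.

End GraphSquareIntegrable.

(** * The Sobolev space and the energy *)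

Section Energy.
Context {R : realType} {G : metricGraph R} (c : edge G -> {posnum R}).
Local Notation X := (graph_space G).
Local Notation mu := (graph_measure c).
Local Notation leb := (@lebesgue_measure R).
Local Notation Io := (fun e : edge G =>
  (edge_interval e : set (measurableTypeR R))).
Implicit Types (e : edge G) (s : R) (f g h : X -> R) (df dg : edge G -> R -> R).

(** The family [edge_deriv f] is one choice of derivatives, whereas the rules of
calculus produce others. They agree almost everywhere, so the energy can be
computed with any of them ([energyE]). *)
Definition grad (f : X -> R) (df : edge G -> R -> R) : Prop :=
  continuous f /\ forall e, is_prim (len e) (restr_edge f e) (df e).

Lemma len0 e : 0 <= len e. Proof. exact/ltW/len_gt0. Qed.

Lemma grad_W12 f df : grad f df -> W12 f.
Proof.
move=> [cf H]; split => // e; exists (df e).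
exact: (prim_weak (len0 e) (H e)).
Qed.

Lemma W12_grad (f : X -> R) : W12 f -> grad f (edge_deriv f).
Proof.
move=> [cf H]; split => // e; apply: weak_prim; first exact: len_gt0.
  exact: space_continuous_restr.
exact: (@xgetPex _ (fun=> 0) [set g | is_L2_deriv e (restr_edge f e) g] (H e)).
Qed.

Lemma grad_ae f df df' e : grad f df -> grad f df' -> df e = df' e %[ae leb in Io e].
Proof. by move=> [_ H] [_ H']; exact: prim_unique (H e) (H' e). Qed.

Lemma grad_sqint f df e : grad f df -> sqint leb (Io e) (df e).
Proof. by move=> [_ H]; exact: prim_sqint (H e). Qed.

Lemma energyE f df g dg : grad f df -> grad g dg ->
  energy f g = \sum_(e : edge G) ip leb (Io e) (df e) (dg e).
Proof.
move=> hf hg; apply: eq_bigr => e _.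
have hf' := W12_grad (grad_W12 hf); have hg' := W12_grad (grad_W12 hg).
exact: (@ae_ip _ _ _ leb (Io e) (mIo e) _ _ _ _ (grad_sqint e hf') (grad_sqint e hf)
  (grad_sqint e hg') (grad_sqint e hg) (grad_ae e hf' hf) (grad_ae e hg' hg)).
Qed.

Lemma gradB f df g dg : grad f df -> grad g dg ->
  grad (fun x => f x - g x) (fun e s => df e s - dg e s).
Proof.
move=> [cf hf] [cg hg]; split.
  by move=> x; exact: (cvgB (cf x) (cg x)).
by move=> e; exact: primB (hf e) (hg e).
Qed.

Lemma gradZ f df (r : R) : grad f df -> grad (fun x => r * f x) (fun e s => r * df e s).
Proof.
move=> [cf hf]; split; first by move=> x; exact: (cvgM (cvg_cst r) (cf x)).
by move=> e; exact: primZ (hf e).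
Qed.

Lemma W12B (f g : X -> R) : W12 f -> W12 g -> W12 (fun x => f x - g x).
Proof. by move=> /W12_grad hf /W12_grad hg; exact: grad_W12 (gradB hf hg). Qed.

Lemma energyC (f g : X -> R) : energy f g = energy g f.
Proof. by apply: eq_bigr => e _; exact: ipC. Qed.

Lemma energy_ge0 (f : X -> R) : 0 <= energy f f.
Proof. by apply: sumr_ge0 => e _; exact: ip_ge0. Qed.

Lemma energyBl (f g h : X -> R) : W12 f -> W12 g -> W12 h ->
  energy (fun x => f x - g x) h = energy f h - energy g h.
Proof.
move=> /W12_grad hf /W12_grad hg /W12_grad hh.
rewrite (energyE (gradB hf hg) hh) -sumrB; apply: eq_bigr => e _.
exact: (ipBl (mIo e) (grad_sqint e hf) (grad_sqint e hg) (grad_sqint e hh)).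
Qed.

Lemma energyZl (f h : X -> R) (r : R) : W12 f -> W12 h ->
  energy (fun x => r * f x) h = r * energy f h.
Proof.
move=> /W12_grad hf /W12_grad hh.
rewrite (energyE (gradZ r hf) hh) mulr_sumr; apply: eq_bigr => e _.
exact: (ipZl (mIo e) r (grad_sqint e hf) (grad_sqint e hh)).
Qed.

Lemma energy_CS (f g : X -> R) : W12 f -> W12 g ->
  energy f g ^+ 2 <= energy f f * energy g g.
Proof.
move=> Wf Wg; apply: discriminant_le; first exact: energy_ge0.
have Wt t : W12 (fun x => t * g x) by exact: grad_W12 (gradZ t (W12_grad Wg)).
move=> t; pose k x := t * g x; pose u x := f x - k x.
have Wk : W12 k := Wt t; have Wu : W12 u by exact: W12B.
have := energy_ge0 u.
have -> : energy u u = energy f u - energy k u by exact: energyBl.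
rewrite (energyC f u) (energyC k u).
have -> : energy u f = energy f f - energy k f by exact: energyBl.
have -> : energy u k = energy f k - energy k k by exact: energyBl.
rewrite (energyC f k); have kE h : W12 h -> energy k h = t * energy g h.
  by move=> Wh; exact: energyZl.
rewrite !kE// (energyC g k) kE// (energyC g f).
by move: (energy f f) (energy f g) (energy g g) => A B C; congr (0 <= _); ring.
Qed.

(** The factors c_e^(-1/2) cancel the weights of the measure. *)
Lemma ip_of_edges (a b : edge G -> R -> R) :
  (forall e, sqint leb (Io e) (a e)) -> (forall e, sqint leb (Io e) (b e)) ->
  sqint mu setT (of_edges (fun e s => (Num.sqrt (c e)%:num)^-1 * a e s)) /\
  ip mu setT (of_edges (fun e s => (Num.sqrt (c e)%:num)^-1 * a e s))
             (of_edges (fun e s => (Num.sqrt (c e)%:num)^-1 * b e s)) =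
  \sum_(e : edge G) ip leb (Io e) (a e) (b e).
Proof.
move=> sa sb.
have restr (u : edge G -> R -> R) e : {in Io e,
    (fun s => (Num.sqrt (c e)%:num)^-1 * u e s) =1
    restr_edge (of_edges (fun e s => (Num.sqrt (c e)%:num)^-1 * u e s)) e}.
  by move=> s; rewrite inE /edge_interval/= in_itv/= => h; rewrite /restr_edge/= of_edges_in.
have sq (u : edge G -> R -> R) : (forall e, sqint leb (Io e) (u e)) ->
    sqint mu setT (of_edges (fun e s => (Num.sqrt (c e)%:num)^-1 * u e s)).
  move=> su; apply: sqint_graph.
    apply: of_edges_measurable => e.
    exact: sqint_measurable (sqintZ (mIo e) _ (su e)).
  move=> e; apply: eq_sqint (restr u e) _.
  exact: (sqintZ (mIo e)).
split; first exact: sq.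
rewrite ip_graph; [|exact: sq..]; apply: eq_bigr => e _.
rewrite -(eq_ip leb (restr a e) (restr b e)).
rewrite (ipZl (mIo e))//; last exact: (sqintZ (mIo e)).
rewrite (ipZr (mIo e))//.
by rewrite mulrA mulrA -mulrA -expr2 exprVn sqr_sqrtr// mulrA divff// mul1r.
Qed.

Lemma dop_sqint (f : X -> R) : W12 f -> sqint mu setT (dop c f).
Proof.
move=> /W12_grad hf.
by have [] := ip_of_edges (fun e => grad_sqint e hf) (fun e => grad_sqint e hf).
Qed.

Lemma ip_dop (f g : X -> R) : W12 f -> W12 g ->
  ip mu setT (dop c f) (dop c g) = energy f g.
Proof.
move=> /W12_grad hf /W12_grad hg.
by have [] := ip_of_edges (fun e => grad_sqint e hf) (fun e => grad_sqint e hg).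
Qed.

Lemma ip_dopB (f g : X -> R) : W12 f -> W12 g ->
  let h x := f x - g x in
  ip mu setT (fun x => dop c f x - dop c g x) (fun x => dop c f x - dop c g x) = energy h h.
Proof.
move=> Wf Wg h; have Wh : W12 h := W12B Wf Wg.
have sf := dop_sqint Wf; have sg := dop_sqint Wg; have sB := sqintB (@mT R G) sf sg.
rewrite [LHS](ipBl (@mT R G) sf sg sB).
rewrite (ipBr (@mT R G) sf sg sf) (ipBr (@mT R G) sf sg sg) !ip_dop//.
have -> : energy h h = energy f h - energy g h by exact: energyBl.
rewrite (energyC f h) (energyC g h).
have -> : energy h f = energy f f - energy g f by exact: energyBl.
have -> : energy h g = energy f g - energy g g by exact: energyBl.
by rewrite (energyC g f).
Qed.

End Energy.

Section Oscillation.
Context {R : realType} {G : metricGraph R} (c : edge G -> {posnum R}).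
Local Notation X := (graph_space G).
Local Notation mu := (graph_measure c).
Local Notation leb := (@lebesgue_measure R).
Local Notation Io := (fun e : edge G =>
  (edge_interval e : set (measurableTypeR R))).
Implicit Types (e : edge G) (s : R) (f g h : X -> R) (df dg : edge G -> R -> R).

Lemma grad_expR f df (r : R) : grad f df ->
  grad (fun x => expR (r * f x)) (fun e s => r * expR (r * restr_edge f e s) * df e s).
Proof.
move=> [cf hf]; split; last by move=> e; exact: prim_expR (len0 e) (hf e).
move=> x; apply: (@continuous_comp _ _ _ (fun x => r * f x) (@expR R)).
  exact: (cvgM (cvg_cst r) (cf x)).
exact: continuous_expR.
Qed.

Lemma grad_ln f df (m : R) : 0 < m -> (forall x, m <= f x) -> grad f df ->
  grad (fun x => ln (f x)) (fun e s => (restr_edge f e s)^-1 * df e s).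
Proof.
move=> m0 mf [cf hf]; split; last first.
  by move=> e; apply: (prim_ln (len0 e) m0 (hf e)) => s _ _; exact: mf.
move=> x; apply: (@continuous_comp _ _ _ f (@ln R)); first exact: cf.
by apply: continuous_ln; exact: lt_le_trans (mf x).
Qed.

(** Two vertices are joined by a chain of at most #|vertex G| edges, and each of the
two points adds one more edge. The last term makes the constant positive in the
absence of edges. *)
Definition osc_const : R :=
  (#|vertex G| + 2)%:R * (\sum_(e : edge G) Num.sqrt (len e)) + 1.

Lemma osc_const_gt0 : 0 < osc_const.
Proof. by rewrite ltr_wpDl// mulr_ge0// sumr_ge0. Qed.

Lemma edge_osc f df e s s' : grad f df -> 0 <= s -> s <= s' -> s' <= len e ->
  `|f (edge_param e s') - f (edge_param e s)| <=
  (\sum_(e : edge G) Num.sqrt (len e)) * Num.sqrt (energy f f).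
Proof.
move=> hf s0 ss sl; have [_ H] := hf.
apply: le_trans (prim_holder (H e) s0 ss sl) _; rewrite mulrC.
apply: ler_pM => //.
  rewrite (bigD1 e)//=; apply: ler_wpDr; first by rewrite sumr_ge0.
  by rewrite ler_wsqrtr//; lra.
rewrite ler_wsqrtr// (energyE hf hf) (bigD1 e)//= lerDl sumr_ge0// => e' _.
exact: ip_ge0.
Qed.

(** Telescoping along a simple chain of vertices. *)
Lemma vertex_osc f df (p q : vertex G) : grad f df ->
  `|f (Vertex p) - f (Vertex q)| <=
  #|vertex G|%:R * (\sum_(e : edge G) Num.sqrt (len e)) * Num.sqrt (energy f f).
Proof.
move=> hf; rewrite -mulrA; set K := (\sum_e _) * _; have K0 : 0 <= K by rewrite mulr_ge0// sumr_ge0.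
have step (p' q' : vertex G) : [exists e : edge G, (p' \in [set src e; tgt e]%SET) &&
    (q' \in [set src e; tgt e]%SET)] -> `|f (Vertex p') - f (Vertex q')| <= K.
  move=> /existsP[e]; rewrite !inE => /andP[pe qe].
  have : `|f (Vertex (tgt e)) - f (Vertex (src e))| <= K.
    rewrite -(@edge_param_le0 _ _ e 0)// -(@edge_param_ge _ _ e (len e))//.
    exact: (edge_osc hf (lexx 0) (len0 e) (lexx _)).
  by move: pe qe => /orP[|] /eqP -> /orP[|] /eqP ->; rewrite ?subrr ?normr0// distrC.
have /connectP[s] := @chain_connected R G p q.
case/shortenP => s' us' uniq_s' _ ->.
have size_s' : (size s' <= #|vertex G|)%N.
  by move: uniq_s' => /= /andP[_ /card_uniqP <-]; exact: max_card.
apply: (@le_trans _ _ ((size s')%:R * K)); last by rewrite ler_wpM2r// ler_nat.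
elim: s' p us' {uniq_s' size_s'} => [|p' s' IH] p /=.
  by rewrite subrr normr0 mul0r.
move=> /andP[/step h /IH h'].
apply: le_trans (ler_distD (f (Vertex p')) _ _) _.
by rewrite -natr1 mulrDl mul1r addrC; exact: lerD.
Qed.

(** The Hoelder bounds on the edges, linked by connectedness. *)
Lemma osc_le f : W12 f -> forall x y, `|f x - f y| <= osc_const * Num.sqrt (energy f f).
Proof.
move=> /W12_grad hf x y; set L := \sum_(e : edge G) Num.sqrt (len e).
have L0 : 0 <= L by rewrite sumr_ge0.
have E0 : 0 <= Num.sqrt (energy f f) by exact: sqrtr_ge0.
have near_vertex z : exists p, `|f z - f (Vertex p)| <= L * Num.sqrt (energy f f).
  case: z => [p|e s h]; first by exists p; rewrite subrr normr0 mulr_ge0.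
  exists (src e); rewrite -(@edge_param_le0 _ _ e 0)// -(edge_param_in h).
  by case/andP: h => /ltW s0 /ltW sl; exact: (edge_osc hf (lexx 0) s0 sl).
have [p hp] := near_vertex x; have [q hq] := near_vertex y.
have hpq := vertex_osc p q hf; rewrite -/L in hpq.
rewrite /osc_const -/L natrD mulrDl mulrDl mul1r.
rewrite (_ : f x - f y = (f x - f (Vertex p)) + (f (Vertex p) - f (Vertex q)) +
  (f (Vertex q) - f y)); last by ring.
apply: le_trans (ler_normD _ _) _.
apply: le_trans (lerD (ler_normD _ _) (lexx _)) _.
rewrite (distrC (f (Vertex q))).
by rewrite mulrDl -!mulrA; rewrite -!mulrA in hpq; lra.
Qed.

End Oscillation.

(** * The domain of the Kirchhoff Laplacian *)

Section GeneratorDomain.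
Context {R : realType} {G : metricGraph R} (c : edge G -> {posnum R}).
Local Notation X := (graph_space G).
Local Notation mu := (graph_measure c).
Local Notation leb := (@lebesgue_measure R).
Local Notation Io := (fun e : edge G =>
  (edge_interval e : set (measurableTypeR R))).
Implicit Types (e : edge G) (s : R) (f g h : X -> R) (df dg : edge G -> R -> R).

Definition total_mass : R := \sum_(e : edge G) (c e)%:num * len e.

Lemma total_mass_gt0 : (0 < #|edge G|)%N -> 0 < total_mass.
Proof.
case/card_gt0P => e _; rewrite /total_mass (bigD1 e)//=.
rewrite ltr_pwDl ?mulr_gt0 ?len_gt0// sumr_ge0// => e' _.
by rewrite mulr_ge0// len0.
Qed.

Lemma sqint_const (r : R) : sqint mu setT (fun=> r).
Proof. by apply: sqint_continuous; exact: cst_continuous. Qed.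

Lemma ip_const (r : R) : ip mu setT (fun=> r) (fun=> 1) = r * total_mass.
Proof.
rewrite /ip Rintegral_cst// mulr1; congr (_ * _).
by have := graph_measure_setT c; rewrite /= => ->.
Qed.

Definition sup_const : R := 2 / total_mass + 2 * @osc_const R G ^+ 2.

Lemma sup_const_gt0 : (0 < #|edge G|)%N -> 0 < sup_const.
Proof.
move=> /total_mass_gt0 m0; rewrite ltr_pwDl ?divr_gt0// mulr_ge0// sqr_ge0//.
Qed.

(** Average |f(x)|^2 <= 2 |f(y)|^2 + 2 |f(x) - f(y)|^2 over y. *)
Lemma sup_le f : (0 < #|edge G|)%N -> W12 f -> forall x,
  f x ^+ 2 <= sup_const * (ip mu setT f f + energy f f).
Proof.
move=> /total_mass_gt0 m0 Wf x; set E := energy f f; set N := ip _ _ _ _.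
have E0 : 0 <= E by exact: energy_ge0.
have N0 : 0 <= N by exact: ip_ge0.
have fxy y : f x ^+ 2 - 2 * @osc_const R G ^+ 2 * E <= 2 * f y ^+ 2.
  have := osc_le Wf x y; rewrite -/E => h.
  have h2 : (f x - f y) ^+ 2 <= @osc_const R G ^+ 2 * E.
    rewrite -[E in leRHS]sqr_sqrtr// -exprMn -real_normK ?num_real//.
    by rewrite lerXn2r ?nnegrE// mulr_ge0// ltW// osc_const_gt0.
  have := sqr_ge0 (f x - 2 * f y); nra.
have sf : sqint mu setT f by apply: sqint_continuous; case: Wf.
have : (f x ^+ 2 - 2 * @osc_const R G ^+ 2 * E) * total_mass <= 2 * N.
  rewrite -ip_const /N -(ipZl (@mT R G) 2 sf sf).
  apply: le_Rintegral => //.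
  - exact: sqint_mul (sqint_const _) (sqint_const _).
  - exact: sqint_mul (sqintZ (@mT R G) 2 sf) sf.
  - by move=> y _; rewrite mulr1 (_ : 2 * f y * f y = 2 * f y ^+ 2); [exact: fxy|ring].
rewrite -ler_pdivlMr// lerBlDr => /le_trans; apply.
rewrite /sup_const; have : 0 <= total_mass^-1 by rewrite invr_ge0 ltW.
have : 0 <= @osc_const R G ^+ 2 by exact: sqr_ge0.
move: (total_mass^-1) (_ ^+ 2) => m o o0 m0'.
by have := mulr_ge0 m0' E0; have := mulr_ge0 o0 N0; nra.
Qed.

(** [form_generator] for the representative in W^{1,2}, which has values at all
points. *)
Definition dom (phi g : X -> R) : Prop := [/\ W12 phi, sqint mu setT g &
  forall psi, W12 psi -> energy phi psi = - ip mu setT g psi].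

(** Composition with [clamp] matches the extension by constants of [edge_param]. *)
Lemma edge_glue (w : X -> R) (P : edge G -> R -> R) : continuous w ->
  (forall e, exists Q, is_prim (len e) (P e) Q) ->
  (forall e, P e 0 = w (Vertex (src e)) /\ P e (len e) = w (Vertex (tgt e))) ->
  exists2 f : X -> R, continuous f & [/\ forall p, f (Vertex p) = w (Vertex p) &
    forall e s, 0 <= s <= len e -> restr_edge f e s = P e s].
Proof.
move=> cw HP Hends.
pose f (x : X) := match x with Vertex p => w (Vertex p) | @Inner _ _ e s _ => P e s end.
have fE e s : restr_edge f e s = P e (clamp (len e) s).
  rewrite /restr_edge/=.
  have [s0|s0] := leP s 0.
    by rewrite edge_param_le0// clamp_le0//= (Hends e).1.
  have [ls|ls] := leP (len e) s.
    by rewrite edge_param_ge// clamp_ge ?len0//= (Hends e).2.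
  have h : 0 < s < len e by rewrite s0.
  by rewrite (edge_param_in h)/= clamp_id// !ltW.
exists f.
  apply: space_continuousP => e; have [Q HQ] := HP e.
  rewrite (_ : restr_edge f e = P e \o clamp (len e)); last exact/funext.
  exact: prim_clamp_continuous (len0 e) HQ.
by split => // e s h; rewrite fE clamp_id.
Qed.

(** On each edge, approximate the derivative of w by p, which vanishes at both ends
and has the same integral. The primitives of the p's have the values of w at the
vertices, and as the p's vanish there, no boundary terms appear in the
integration by parts: the Kirchhoff conditions hold trivially. *)
Lemma dom_dense (w : X -> R) (e0 : R) : W12 w -> 0 < e0 ->
  exists phi g, [/\ dom phi g, forall p, phi (Vertex p) = w (Vertex p) &
    energy (fun x => w x - phi x) (fun x => w x - phi x) <= e0].
Proof.
move=> Ww e00; have hw := W12_grad Ww; have [cw pw] := hw.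
pose eps := e0 / (#|edge G|%:R + 1).
have eps0 : 0 < eps by rewrite divr_gt0// ltr_wpDl.
have /choice[pq Hpq] : forall e, exists pq : (R -> R) * (R -> R),
    [/\ is_prim (len e) pq.1 pq.2, pq.1 0 = 0, pq.1 (len e) = 0,
    \int[leb]_(x in Io e) pq.1 x = \int[leb]_(x in Io e) edge_deriv w e x &
    ip leb (Io e) (fun x => edge_deriv w e x - pq.1 x) (fun x => edge_deriv w e x - pq.1 x) <= eps].
  move=> e; have [p [q H]] := prim_dense (len_gt0 e) (grad_sqint e hw) eps0.
  by exists (p, q).
pose p e := (pq e).1; pose q e := (pq e).2.
have prim_p e : is_prim (len e) (fun s => w (Vertex (src e)) + primitive (p e) s) (p e).
  have [pp _ _ _ _] := Hpq e.
  have := primD (prim_cst (len e) (w (Vertex (src e)))) (primitive_prim (prim_sqint_fun pp)).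
  by under [X in is_prim _ _ X]eq_fun do rewrite add0r.
have [phi cphi [phiV phiE]] : exists2 f : X -> R, continuous f &
    [/\ forall p, f (Vertex p) = w (Vertex p) &
    forall e s, 0 <= s <= len e ->
      restr_edge f e s = w (Vertex (src e)) + primitive (p e) s].
  apply: edge_glue => // e; first by exists (p e).
  rewrite primitive0 addr0; split => //; have [_ _ _ pw' _] := Hpq e.
  rewrite /primitive [X in _ + X]pw' -(pw e).2//; last exact: len0.
  by rewrite /restr_edge/= edge_param_ge// edge_param_le0// addrC subrK.
have hphi : grad phi p.
  split => // e; apply: prim_eq (prim_p e) _ => s h; exact/esym/phiE.
pose g := of_edges (fun e s => (c e)%:num^-1 * q e s).
have gE e : {in Io e, (fun s => (c e)%:num^-1 * q e s) =1 restr_edge g e}.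
  by move=> s; rewrite inE /edge_interval/= in_itv/= => h; rewrite /restr_edge/= /g of_edges_in.
have sq e : sqint leb (Io e) (q e) by have [pp _ _ _ _] := Hpq e; exact: prim_sqint pp.
have sg : sqint mu setT g.
  apply: sqint_graph.
    by apply: of_edges_measurable => e; exact: sqint_measurable (sqintZ (mIo e) _ (sq e)).
  by move=> e; apply: eq_sqint (gE e) _; exact: (sqintZ (mIo e)).
exists phi, g; split => //.
  split => //; first exact: grad_W12 hphi.
  move=> psi Wpsi; have hpsi := W12_grad Wpsi; have [cpsi ppsi] := hpsi.
  rewrite (energyE hphi hpsi) ip_graph//; last exact: sqint_continuous.
  rewrite -sumrN; apply: eq_bigr => e _; have [pp p0 pl _ _] := Hpq e.
  rewrite (prim_by_parts (len0 e) pp (ppsi e)) p0 pl !mul0r subrr sub0r; congr (- _).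
  have spsi : sqint leb (Io e) (restr_edge psi e) by exact: prim_sqint_fun (ppsi e).
  rewrite -(eq_ip leb (gE e) (fun x _ => erefl)) (ipZl (mIo e) _ (sq e) spsi).
  by rewrite mulrA divff// mul1r.
rewrite (energyE (gradB hw hphi) (gradB hw hphi)).
apply: (@le_trans _ _ (\sum_(e : edge G) eps)).
  by apply: ler_sum => e _; have [_ _ _ _] := Hpq e.
rewrite sumr_const -mulr_natl /eps mulrA ler_pdivrMr ?ltr_wpDl// mulrC ler_pM2l//.
by rewrite cardT; lra.
Qed.

End GeneratorDomain.

(** * The heat semigroup and the decay of energy *)

Section Norm.
Context {R : realType} {G : metricGraph R} (c : edge G -> {posnum R}).
Local Notation X := (graph_space G).
Local Notation mu := (graph_measure c).
Local Notation leb := (@lebesgue_measure R).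
Local Notation Io := (fun e : edge G =>
  (edge_interval e : set (measurableTypeR R))).
Implicit Types (e : edge G) (s t : R) (f g h : X -> R).

Definition nrm (f : X -> R) : R := Num.sqrt (ip mu setT f f).

Lemma nrm_ge0 f : 0 <= nrm f. Proof. exact: sqrtr_ge0. Qed.

Lemma nrm_sqr f : nrm f ^+ 2 = ip mu setT f f.
Proof. by rewrite sqr_sqrtr// ip_ge0. Qed.

Lemma nrm_CS f g : sqint mu setT f -> sqint mu setT g ->
  `|ip mu setT f g| <= nrm f * nrm g.
Proof. exact: (ip_CS_norm (@mT R G)). Qed.

Lemma nrmD f g : sqint mu setT f -> sqint mu setT g ->
  nrm (fun x => f x + g x) <= nrm f + nrm g.
Proof.
move=> sf sg; have sD := sqintD (@mT R G) sf sg.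
have h0 : 0 <= nrm f + nrm g by rewrite addr_ge0// nrm_ge0.
rewrite -(ger0_norm h0) -sqrtr_sqr ler_wsqrtr//.
rewrite (ipDl (@mT R G) sf sg sD) (ipDr (@mT R G) sf sg sf) (ipDr (@mT R G) sf sg sg).
rewrite (ipC mu setT g f) -!nrm_sqr.
have := nrm_CS sf sg; have := ler_norm (ip mu setT f g).
by move: (ip _ _ _ _) (nrm f) (nrm g) => a b d; nra.
Qed.

Lemma nrm_ae f g : sqint mu setT f -> sqint mu setT g -> f = g %[ae mu] ->
  nrm f = nrm g.
Proof.
by move=> sf sg fg; congr Num.sqrt; exact: (ae_ip (@mT R G) sf sg sf sg fg fg).
Qed.

Lemma ip_ael f g h : sqint mu setT f -> sqint mu setT g -> sqint mu setT h ->
  f = g %[ae mu] -> ip mu setT f h = ip mu setT g h.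
Proof.
move=> sf sg sh fg; apply: (ae_ip (@mT R G) sf sg sh sh fg) _.
exact: aeW.
Qed.

Lemma ip_aer f g h : sqint mu setT f -> sqint mu setT g -> sqint mu setT h ->
  f = g %[ae mu] -> ip mu setT h f = ip mu setT h g.
Proof. by move=> sf sg sh fg; rewrite ![ip mu setT h _]ipC; exact: ip_ael. Qed.

Section Semigroup.
Variables (T : R -> (X -> R) -> X -> R) (hT : is_heat_semigroup c T).

Lemma T_sqint t f : 0 <= t -> sqint mu setT f -> sqint mu setT (T t f).
Proof.
by case: hT => -[H _ _ _] _ _ _ _ t0 /L2_sqint sf; apply/L2_sqint; exact: H.
Qed.

Lemma T_lin t (a : R) f g : 0 <= t -> sqint mu setT f -> sqint mu setT g ->
  T t (fun x => a * f x + g x) = (fun x => a * T t f x + T t g x) %[ae mu].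
Proof.
by case: hT => -[_ H _ _] _ _ _ _ t0 /L2_sqint sf /L2_sqint sg; exact: H.
Qed.

Lemma T_contract t f : 0 <= t -> sqint mu setT f -> nrm (T t f) <= nrm f.
Proof.
move=> t0 sf; have sT := T_sqint t0 sf.
case: hT => -[_ _ H _] _ _ _ _; have := H t f t0 ((L2_sqint c f).2 sf).
by rewrite !L2normE.
Qed.

Lemma T_sym t f g : 0 <= t -> sqint mu setT f -> sqint mu setT g ->
  ip mu setT (T t f) g = ip mu setT f (T t g).
Proof.
by case: hT => -[_ _ _ H] _ _ _ _ t0 /L2_sqint sf /L2_sqint sg; exact: H.
Qed.

Lemma T_id f : sqint mu setT f -> T 0 f = f %[ae mu].
Proof. by case: hT => _ H _ _ _ /L2_sqint sf; exact: H. Qed.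

Lemma T_add s t f : 0 <= s -> 0 <= t -> sqint mu setT f ->
  T (s + t) f = T s (T t f) %[ae mu].
Proof. by case: hT => _ _ H _ _ s0 t0 /L2_sqint sf; exact: H. Qed.

Lemma T_zero t : 0 <= t -> T t (fun=> 0) = (fun=> 0) %[ae mu].
Proof.
move=> t0; have := T_lin 1 t0 (sqint_const c 0) (sqint_const c 0).
rewrite (_ : (fun x => 1 * 0 + 0) = (fun=> 0)); last by apply/funext => x; rewrite mulr0 addr0.
apply: filterS => x /(_ I) H _; move: H; rewrite mul1r => /eqP.
by rewrite -subr_eq0 opprD addrA subrr sub0r oppr_eq0 => /eqP.
Qed.

Lemma T_scale t (a : R) f : 0 <= t -> sqint mu setT f ->
  T t (fun x => a * f x) = (fun x => a * T t f x) %[ae mu].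
Proof.
move=> t0 sf; have := T_lin a t0 sf (sqint_const c 0).
rewrite (_ : (fun x => a * f x + 0) = (fun x => a * f x)); last by apply/funext => x; rewrite addr0.
by apply: filterS2 (T_zero t0) => x /(_ I) z0 /(_ I) + _; rewrite z0 addr0.
Qed.

Lemma T_sub t f g : 0 <= t -> sqint mu setT f -> sqint mu setT g ->
  T t (fun x => f x - g x) = (fun x => T t f x - T t g x) %[ae mu].
Proof.
move=> t0 sf sg; have := T_lin (-1) t0 sg sf.
rewrite (_ : (fun x => -1 * g x + f x) = (fun x => f x - g x)); last first.
  by apply/funext => x; ring.
by apply: filterS => x /(_ I) -> _; ring.
Qed.

Lemma T_comm s t f : 0 <= s -> 0 <= t -> sqint mu setT f ->
  T s (T t f) = T t (T s f) %[ae mu].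
Proof.
move=> s0 t0 sf; have := T_add t0 s0 sf; rewrite addrC.
by apply: filterS2 (T_add s0 t0 sf) => x /(_ I) <- /(_ I) <-.
Qed.

End Semigroup.

End Norm.

Section EnergyDecay.
Context {R : realType} {G : metricGraph R} (c : edge G -> {posnum R}).
Local Notation X := (graph_space G).
Local Notation mu := (graph_measure c).
Local Notation leb := (@lebesgue_measure R).
Local Notation Io := (fun e : edge G =>
  (edge_interval e : set (measurableTypeR R))).
Implicit Types (e : edge G) (s t : R) (f g h : X -> R).

Lemma energy_root f : exists2 a, 0 <= a & a ^+ 2 = energy f f.
Proof.
by exists (Num.sqrt (energy f f)); [exact: sqrtr_ge0|exact: sqr_sqrtr (energy_ge0 f)].
Qed.

Lemma dom_sqint phi g : dom c phi g -> sqint mu setT phi.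
Proof. by case=> -[cphi _] _ _; exact: sqint_continuous. Qed.

Lemma dom_generator phi g : dom c phi g -> form_generator c phi g.
Proof.
move=> dphi; have sphi := dom_sqint dphi; case: dphi => Wphi sg H.
split; [exact/L2_sqint|exact/L2_sqint|].
by exists phi; [split => //; exact: aeW|].
Qed.

Lemma generator_dom f g : form_generator c f g ->
  exists2 phi, phi = f %[ae mu] & dom c phi g.
Proof.
move=> [_ /L2_sqint sg [phi [Wphi phif] H]].
by exists phi => //; split.
Qed.

Lemma lerXn2r_nneg (a b : R) : 0 <= a -> 0 <= b -> a <= b -> a ^+ 2 <= b ^+ 2.
Proof. by move=> a0 b0 ab; rewrite lerXn2r. Qed.

Lemma sqr_le_abs (x y : R) : 0 <= y -> x ^+ 2 <= y ^+ 2 -> x <= y.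
Proof.
move=> y0 xy; apply: le_trans (ler_norm _) _.
by rewrite -ler_sqr ?nnegrE// real_normK ?num_real.
Qed.

(** A norm is determined by duality with a dense subspace. Here a and b are the
norms of vectors w and f, the number p is the product of w with a vector phi of
the subspace, and q is the square of the norm of phi, so that
a^2 - 2 p + q is that of w - phi, and a^2 - p is the product of w - phi with w. *)
Lemma dual_le (a b : R) : 0 <= a -> 0 <= b ->
  (forall r, 0 < r -> exists p q, [/\ 0 <= q, a ^+ 2 - 2 * p + q <= r ^+ 2,
     (a ^+ 2 - p) ^+ 2 <= (a ^+ 2 - 2 * p + q) * a ^+ 2 & p ^+ 2 <= q * b ^+ 2]) ->
  a <= b.
Proof.
move=> a0 b0 H; rewrite leNgt; apply/negP => ba.
have apos : 0 < a by exact: le_lt_trans ba.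
(* for b < a and this distance r, p is both too large, p >= a^2 - a r, and too
   small, p <= (a + r) b *)
pose r := (a ^+ 2 - a * b) / (2 * (a + b)).
have ab0 : 0 < a + b by lra.
have r0 : 0 < r.
  by rewrite divr_gt0 ?mulr_gt0// expr2 -mulrBr mulr_gt0// subr_gt0.
have [p [q [q0 h1 h2 h3]]] := H r r0.
have rE : r * (2 * (a + b)) = a ^+ 2 - a * b by rewrite /r divfK// gt_eqF// mulr_gt0.
clearbody r.
have p1 : a ^+ 2 - p <= a * r.
  apply: sqr_le_abs; first by rewrite mulr_ge0// ltW.
  by rewrite exprMn mulrC; apply: le_trans h2 _; rewrite ler_wpM2r// sqr_ge0.
have p1' : p - a ^+ 2 <= a * r.
  apply: sqr_le_abs; first by rewrite mulr_ge0// ltW.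
  by rewrite -sqrrN opprB exprMn mulrC; apply: le_trans h2 _; rewrite ler_wpM2r// sqr_ge0.
have q1 : q <= (a + r) ^+ 2 by rewrite sqrrD; lra.
have p2 : p <= (a + r) * b.
  apply: sqr_le_abs; first by rewrite mulr_ge0// addr_ge0// ltW.
  by rewrite exprMn; apply: le_trans h3 _; rewrite ler_wpM2r// sqr_ge0.
have : 0 < r * (a + b) by rewrite mulr_gt0.
by nra.
Qed.

Section Semigroup.
Variables (T : R -> (X -> R) -> X -> R) (hT : is_heat_semigroup c T).

Lemma dom_diff phi g : dom c phi g ->
  nrm c (fun x => t^-1 * (T t phi x - phi x) - g x) @[t --> 0^'+] --> (0 : R).
Proof.
move=> dphi; have sphi := dom_sqint dphi.
have sg : sqint mu setT g by case: dphi.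
have [_ _ _ _ H] := hT; have /H := dom_generator dphi.
move=> /(_ ((L2_sqint c phi).2 sphi) ((L2_sqint c g).2 sg)).
apply: cvg_trans; apply: near_eq_cvg; near=> t.
have t0 : 0 < t by [].
rewrite L2normE//; apply: sqintB => //; apply: sqintZ => //; apply: sqintB => //.
by apply: (T_sqint hT) => //; exact: ltW.
Unshelve. all: by end_near. Qed.

Lemma diff_sqint phi g t : 0 <= t -> sqint mu setT phi -> sqint mu setT g ->
  sqint mu setT (fun x => t^-1 * (T t phi x - phi x) - g x).
Proof.
move=> t0 sphi sg; apply: sqintB => //; apply: sqintZ => //; apply: sqintB => //.
exact: (T_sqint hT).
Qed.

(** By linearity and since T_s T_t = T_(s + t) = T_t T_s. *)
Lemma T_diff phi g s t : 0 <= s -> 0 <= t -> sqint mu setT phi -> sqint mu setT g ->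
  (fun x => t^-1 * (T t (T s phi) x - T s phi x) - T s g x) =
  T s (fun x => t^-1 * (T t phi x - phi x) - g x) %[ae mu].
Proof.
move=> s0 t0 sphi sg; have st := T_sqint hT t0 sphi.
have sB := sqintB (@mT R G) st sphi; have sZ := sqintZ (@mT R G) t^-1 sB.
have e1 := T_sub hT s0 sZ sg; have e2 := T_scale hT t^-1 s0 sB.
have e3 := T_sub hT s0 st sphi; have e4 := T_comm hT t0 s0 sphi.
apply: filterS2 (filterI e1 e2) (filterI e3 e4) => x.
move=> [/(_ I) {}e1 /(_ I) {}e2] [/(_ I) {}e3 /(_ I) {}e4] _.
by rewrite e1 e2 e3 e4.
Qed.

(** By [T_diff] and contraction, the difference quotients of T_s phi converge, and
this characterizes the domain. *)
Lemma dom_T phi g s : 0 <= s -> dom c phi g ->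
  exists2 phis, phis = T s phi %[ae mu] & dom c phis (T s g).
Proof.
move=> s0 dphi; have sphi := dom_sqint dphi.
have sg : sqint mu setT g by case: dphi.
apply: generator_dom; have [_ _ _ _ H] := hT.
have sTp := T_sqint hT s0 sphi; have sTg := T_sqint hT s0 sg.
apply/H; [exact/L2_sqint|exact/L2_sqint|].
apply: (@squeeze_cvgr _ _ _ _ (fun=> 0)
  (fun t => nrm c (fun x => t^-1 * (T t phi x - phi x) - g x))).
- near=> t; have t0 : 0 < t by [].
  have sL := diff_sqint (ltW t0) sTp sTg.
  rewrite L2normE// -/(nrm c _) nrm_ge0/=.
  have sD := diff_sqint (ltW t0) sphi sg.
  rewrite (nrm_ae sL (T_sqint hT s0 sD) (T_diff s0 (ltW t0) sphi sg)).
  exact: (T_contract hT).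
- exact: cvg_cst.
- exact: dom_diff.
Unshelve. all: by end_near. Qed.

Lemma energy_dom phi g psi : dom c phi g -> W12 psi -> energy phi psi = - ip mu setT g psi.
Proof. by case=> _ _; apply. Qed.

(** If a(s) exceeds A by x, then a(2s) exceeds A by at least 2x, and a would be
unbounded. *)
Lemma doubling_le (a : R -> R) (A K : R) : 0 <= A ->
  (forall t, 0 <= t -> a t <= K) -> (forall t, 0 <= t -> 0 <= a t) ->
  (forall t, 0 <= t -> a t ^+ 2 <= A * a (2 * t)) ->
  forall t, 0 <= t -> a t <= A.
Proof.
move=> A0 aK a0 H t t0; rewrite leNgt; apply/negP => At.
have step s : 0 <= s -> A < a s -> 2 * (a s - A) <= a (2 * s) - A.
  move=> s0 As; have Hs := H s s0.
  have Apos : 0 < A.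
    rewrite lt_neqAle A0 andbT; apply/eqP => A0'; move: Hs.
    by rewrite -A0' mul0r leNgt exprn_gt0// A0'.
  have : A * (2 * (a s - A)) <= A * (a (2 * s) - A).
    by have := sqr_ge0 (a s - A); nra.
  by rewrite ler_pM2l.
have iter (n : nat) : exists s, [/\ 0 <= s, A < a s & n.+1%:R * (a t - A) <= a s - A].
  elim: n => [|n [s [s0 As IH]]]; first by exists t; rewrite mul1r.
  exists (2 * s); have h := step s s0 As; split.
  - by rewrite mulr_ge0.
  - by lra.
  - apply: le_trans h; rewrite -natr1 mulrDl mul1r.
    have : a t - A <= n.+1%:R * (a t - A) by rewrite ler_peMl ?ler1n// subr_ge0 ltW.
    lra.
have [s [s0 As]] := iter (Num.truncn ((K - A) / (a t - A))).
have := truncnS_gt ((K - A) / (a t - A)); rewrite ltr_pdivrMr ?subr_gt0// => h1 h2.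
by have := aK s s0; lra.
Qed.

(** Let a(s) be the energy of T_s phi, which is - <T_s g, T_s phi> and so is bounded.
By symmetry a(s) = - <g, T_2s phi>, the energy product of phi and T_2s phi, so
that a(s)^2 <= a(0) a(2s). *)
Lemma energy_T_dom phi g t phit : 0 <= t -> dom c phi g ->
  phit = T t phi %[ae mu] -> dom c phit (T t g) -> energy phit phit <= energy phi phi.
Proof.
move=> t0 dphi phitE dphit; have sphi := dom_sqint dphi.
have sg : sqint mu setT g by case: dphi.
have Wphi : W12 phi by case: dphi.
pose a s := - ip mu setT (T s g) (T s phi).
have aE s f : 0 <= s -> f = T s phi %[ae mu] -> dom c f (T s g) -> energy f f = a s.
  move=> s0 fE df; rewrite (energy_dom df); last by case: df.
  by congr (- _); apply: ip_aer fE;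
    [exact: dom_sqint df|exact: (T_sqint hT)|exact: (T_sqint hT)].
rewrite (aE t phit)//.
apply: (@doubling_le a _ (nrm c g * nrm c phi)) => // [|s s0|s s0|s s0].
- exact: energy_ge0.
- apply: le_trans (ler_norm _) _; rewrite normrN.
  apply: le_trans (nrm_CS (T_sqint hT s0 sg) (T_sqint hT s0 sphi)) _.
  by apply: ler_pM; rewrite ?nrm_ge0//; exact: (T_contract hT).
- have [f fE df] := dom_T s0 dphi.
  by rewrite -(aE s f)//; exact: energy_ge0.
- have s20 : 0 <= 2 * s by rewrite mulr_ge0.
  have [f fE df] := dom_T s20 dphi.
  have Wf : W12 f by case: df.
  have -> : a s = energy phi f.
    rewrite (energy_dom dphi)// /a; congr (- _).
    rewrite (T_sym hT s0 sg (T_sqint hT s0 sphi)).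
    apply: ip_aer => //; [|exact: dom_sqint df|].
      by do 2 apply: (T_sqint hT) => //.
    have := T_add hT s0 s0 sphi; rewrite -mulr2n -mulr_natl.
    by apply: filterS2 fE => x /(_ I) -> /(_ I) ->.
  by have := energy_CS Wphi Wf; rewrite (aE (2 * s) f).
Qed.

(** The energy product of T_t f with phi in the domain equals that of f with T_t phi,
which is bounded by means of [energy_T_dom]; conclude by duality, as the domain
is dense. *)
Lemma energy_T f w t : 0 <= t -> W12 f -> W12 w -> w = T t f %[ae mu] ->
  energy w w <= energy f f.
Proof.
move=> t0 Wf Ww wE.
have sf : sqint mu setT f by case: Wf => cf _; exact: sqint_continuous.
have sw : sqint mu setT w by case: Ww => cw _; exact: sqint_continuous.
have H phi g : dom c phi g -> energy w phi ^+ 2 <= energy phi phi * energy f f.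
  move=> dphi; have Wphi : W12 phi by case: dphi.
  have sg : sqint mu setT g by case: dphi.
  have [phit phitE dphit] := dom_T t0 dphi.
  have Wphit : W12 phit by case: dphit.
  have -> : energy w phi = energy phit f.
    rewrite energyC (energy_dom dphi Ww) (energy_dom dphit Wf); congr (- _).
    by rewrite (T_sym hT t0 sg sf); apply: ip_aer wE => //; exact: (T_sqint hT).
  apply: le_trans (energy_CS Wphit Wf) _.
  exact: (ler_wpM2r (energy_ge0 f) (energy_T_dom t0 dphi phitE dphit)).
have [a a0 aa] := energy_root w; have [b b0 bb] := energy_root f.
suff ab : a <= b by rewrite -aa -bb; exact: (lerXn2r_nneg a0 b0 ab).
apply: dual_le => // r r0.
have [phi [g [dphi _ hE]]] := dom_dense c Ww (exprn_gt0 2 r0).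
have Wphi : W12 phi by case: dphi.
have Wu := W12B Ww Wphi; set u := fun x => _ in hE Wu.
have e1 : energy u w = energy w w - energy phi w by exact: energyBl.
have e2 : energy u phi = energy w phi - energy phi phi by exact: energyBl.
have e3 : energy u u = energy w u - energy phi u by exact: energyBl.
have h3 := H _ _ dphi; have h2 := energy_CS Wu Ww; have h4 := energy_ge0 phi.
rewrite (energyC w u) (energyC phi u) e1 e2 (energyC phi w) -aa in e3.
rewrite e1 (energyC phi w) e3 -aa in h2; rewrite e3 in hE; rewrite -bb in h3.
exists (energy w phi), (energy phi phi).
move: hE h2 h3 h4; move: (energy w phi) (energy phi phi) => p q.
rewrite (_ : a ^+ 2 - p - (p - q) = a ^+ 2 - 2 * p + q); last by ring.
by move=> *; split.
Qed.

Lemma sup_T f w t : (0 < #|edge G|)%N -> 0 <= t -> W12 f -> W12 w ->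
  w = T t f %[ae mu] -> forall x,
  w x ^+ 2 <= sup_const c * (ip mu setT f f + energy f f).
Proof.
move=> E0 t0 Wf Ww wE x; apply: le_trans (sup_le c E0 Ww x) _.
apply: (ler_wpM2l (ltW (sup_const_gt0 c E0))); apply: lerD; last first.
  exact: (energy_T t0 Wf Ww wE).
have sf : sqint mu setT f by case: Wf => cf _; exact: sqint_continuous.
have sw : sqint mu setT w by case: Ww => cw _; exact: sqint_continuous.
rewrite -!nrm_sqr; apply: lerXn2r_nneg; [exact: nrm_ge0|exact: nrm_ge0|].
by rewrite (nrm_ae sw (T_sqint hT t0 sf) wE); exact: (T_contract hT).
Qed.

End Semigroup.

End EnergyDecay.

(** * The minimum principle *)

Section MinimumPrinciple.
Context {R : realType} {G : metricGraph R} (c : edge G -> {posnum R}).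
Local Notation X := (graph_space G).
Local Notation mu := (graph_measure c).
Local Notation leb := (@lebesgue_measure R).
Local Notation Io := (fun e : edge G =>
  (edge_interval e : set (measurableTypeR R))).
Implicit Types (e : edge G) (s t : R) (f g h : X -> R).

(** A connected graph with at least one edge has no isolated vertex. *)
Lemma incident_edge : (0 < #|edge G|)%N -> forall x : X, exists e s,
  0 <= s <= len e /\ x = edge_param e s.
Proof.
case/card_gt0P => e0 _ [p|e s h]; last first.
  exists e, s; rewrite (edge_param_in h); split => //.
  by case/andP: (h) => /ltW -> /ltW ->.
have end_pt e : p \in [set src e; tgt e]%SET ->
    exists e s, 0 <= s <= len e /\ (Vertex p : X) = edge_param e s.
  rewrite !inE => /orP[|] /eqP ->.
    by exists e, 0; rewrite lexx len0 edge_param_le0.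
  by exists e, (len e); rewrite lexx len0 edge_param_ge.
have /connectP[[|q s] /=] := @chain_connected R G p (src e0).
  by move=> _ sp; apply: (end_pt e0); rewrite !inE sp eqxx.
by move=> /andP[/existsP[e /andP[pe _]] _] _; exact: end_pt pe.
Qed.

(** By continuity, u stays below a - d on a piece of an edge, of mass eta. The
statement is about L^2 norms instead of this mass, as it will be applied to
W = e^(-lam u / 2). *)
Lemma region_below (u : X -> R) (x0 : X) (a : R) : (0 < #|edge G|)%N ->
  continuous u -> u x0 < a ->
  exists eta d : R, [/\ 0 < eta, 0 < d & forall (W : X -> R) (m : R),
    sqint mu setT W -> 0 <= m -> (forall y, u y <= a - d -> m <= W y) ->
    eta * m ^+ 2 <= ip mu setT W W].
Proof.
move=> E0 cu ua; have [e [s0 [/andP[s00 s0l] x0E]]] := incident_edge E0 x0.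
pose d := (a - u x0) / 2; have d0 : 0 < d by rewrite divr_gt0// subr_gt0.
have ce := space_continuous_restr (e := e) cu.
have /cvgrPdist_le /(_ _ d0) [r /= r0 Hr] := ce s0.
(* (p, q) is the piece of the edge *)
pose p := Num.max 0 (s0 - r / 2); pose q := Num.min (len e) (s0 + r / 2).
have le0 := len_gt0 e.
have pq : p < q.
  by rewrite /p /q gt_max !lt_min le0 /=; apply/andP; split; [|apply/andP; split]; lra.
have p0 : 0 <= p by rewrite /p le_max lexx.
have ql : q <= len e by rewrite /q ge_min lexx.
have ur s : p < s -> s < q -> u (edge_param e s) <= a - d.
  rewrite /p /q gt_max lt_min => /andP[_ h1] /andP[_ h2].
  have /Hr : `|s0 - s| < r by rewrite ltr_norml; apply/andP; split; lra.
  rewrite /restr_edge/= -x0E ler_norml => /andP[h3 _].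
  by move: h3; rewrite /d; lra.
exists ((c e)%:num * (q - p)), d; split => //; first by rewrite mulr_gt0// subr_gt0.
move=> W m sW m0 HW.
rewrite ip_sqr_graph// (bigD1 e)//=; apply: ler_wpDr.
  by apply: sumr_ge0 => e' _; rewrite mulr_ge0// ip_ge0.
rewrite -mulrA ler_wpM2l//.
have sWe := sqint_edge e sW.
apply: le_trans (ip_sub p0 ql sWe).
have sm := sqint_cst p q m.
have -> : (q - p) * m ^+ 2 = ip leb `]p, q[ (fun=> m) (fun=> m).
  by rewrite /ip Rintegral_cst; [rewrite leb_itv ?(ltW pq)//; ring|exact: moo].
apply: (le_ip (moo p q)).
- exact: measurable_cst.
- move=> s; rewrite /= in_itv/= => /andP[ps sq].
  by rewrite ger0_norm// (le_trans _ (ler_norm _))// HW// ur.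
- exact: sqint_sub sWe.
Qed.

Section Semigroup.
Variables (T : R -> (X -> R) -> X -> R) (hT : is_heat_semigroup c T).

Lemma exp_sqint f (r : R) : W12 f -> sqint mu setT (fun x => expR (r * f x)).
Proof.
move=> /W12_grad hf; have [cV _] := grad_expR r hf; exact: sqint_continuous.
Qed.

(** The product of e^(r f) with the generator at f is - r times the integral of
e^(r f) |f'|^2. *)
Lemma generator_exp f g (r : R) : r <= 0 -> dom c f g ->
  0 <= ip mu setT (fun x => expR (r * f x)) g.
Proof.
move=> r0 df; have Wf : W12 f by case: df.
have hf := W12_grad Wf; have hV := grad_expR r hf.
rewrite ipC -[ip _ _ _ _]opprK -(energy_dom df (grad_W12 hV)) (energyE hf hV) -sumrN.
apply: sumr_ge0 => e _.
have sd := grad_sqint e hf; have sdV := grad_sqint e hV.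
rewrite -mulN1r -(ipZl (mIo e) (-1) sd sdV); apply: Rintegral_ge0 => s _.
rewrite (_ : _ * _ = - r * (expR (r * restr_edge f e s) * edge_deriv f e s ^+ 2)); last by ring.
by rewrite mulr_ge0 ?oppr_ge0// mulr_ge0 ?sqr_ge0// expR_ge0.
Qed.

(** Tangents of the exponential at f1: the weight is taken at the end of the step,
where [generator_exp] will be applied. *)
Lemma exp_step f0 f1 (lam : R) : 0 < lam -> W12 f0 -> W12 f1 ->
  ip mu setT (fun x => expR (- lam * f1 x)) (fun=> 1) -
  ip mu setT (fun x => expR (- lam * f0 x)) (fun=> 1) <=
  - lam * ip mu setT (fun x => expR (- lam * f1 x)) (fun x => f1 x - f0 x).
Proof.
move=> l0 W0 W1; have s0 := exp_sqint (- lam) W0; have s1 := exp_sqint (- lam) W1.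
have s00 : sqint mu setT f0 by case: W0 => cf _; exact: sqint_continuous.
have s11 : sqint mu setT f1 by case: W1 => cf _; exact: sqint_continuous.
have one := sqint_const c 1; have sB := sqintB (@mT R G) s11 s00.
rewrite -(ipBl (@mT R G) s1 s0 one) -(ipZr (@mT R G) (- lam) sB s1).
apply: le_Rintegral => //.
- exact: sqint_mul (sqintB (@mT R G) s1 s0) one.
- exact: sqint_mul s1 (sqintZ (@mT R G) (- lam) sB).
- move=> x _; rewrite mulr1.
  have -> : expR (- lam * f0 x) = expR (- lam * f1 x) * expR (lam * (f1 x - f0 x)).
    by rewrite -expRD; congr expR; ring.
  have := ler_wpM2l (ltW (expR_gt0 (- lam * f1 x))) (expR_ge1Dx (lam * (f1 x - f0 x))).
  by lra.
Qed.

Section Orbit.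
Variables (phi g : X -> R) (dphi : dom c phi g) (lam t : R).
Hypotheses (E0 : (0 < #|edge G|)%N) (lam0 : 0 < lam) (t0 : 0 < t).

(** The consistency error of a backward step: the generator is evaluated at the end
of the step. *)
Let quotient_err (h : R) := nrm c (fun x => h^-1 * (T h phi x - phi x) - T h g x).

Lemma quotient_err_small (e0 : R) : 0 < e0 ->
  exists2 r, 0 < r & forall h : R, 0 < h -> h < r -> quotient_err h <= e0.
Proof.
move=> e00; have sphi := dom_sqint dphi; have sg : sqint mu setT g by case: dphi.
have e2 : 0 < e0 / 2 by rewrite divr_gt0.
have /cvgrPdist_le /(_ _ e2) h1 := dom_diff hT dphi.
have [_ _ _ H _] := hT.
have /cvgrPdist_le /(_ _ e2) h2 := H g ((L2_sqint c g).2 sg).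
have : \forall h \near 0^'+, quotient_err h <= e0.
  near=> h; have h0 : 0 < h by [].
  have sT := T_sqint hT (ltW h0) sg.
  have a1 : nrm c (fun x => h^-1 * (T h phi x - phi x) - g x) <= e0 / 2.
    apply: le_trans (ler_norm _) _; rewrite -normrN -sub0r; near: h; exact: h1.
  have a2 : nrm c (fun x => T h g x - g x) <= e0 / 2.
    rewrite -[nrm _ _](L2normE (sqintB (@mT R G) sT sg)).
    apply: le_trans (ler_norm _) _; rewrite -normrN -sub0r; near: h; exact: h2.
  have sD := diff_sqint hT (ltW h0) sphi sg.
  have sgT := sqintZ (@mT R G) (-1) (sqintB (@mT R G) sT sg).
  have := nrmD sD sgT.
  rewrite (_ : (fun x => _ + _) = (fun x => h^-1 * (T h phi x - phi x) - T h g x)); last first.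
    by apply/funext => x; ring.
  have -> : nrm c (fun x => -1 * (T h g x - g x)) = nrm c (fun x => T h g x - g x).
    rewrite /nrm (ipZl (@mT R G) _ (sqintB (@mT R G) sT sg) sgT).
    rewrite (ipZr (@mT R G) _ (sqintB (@mT R G) sT sg) (sqintB (@mT R G) sT sg)).
    by rewrite mulrA mulrNN !mul1r.
  by rewrite -/(quotient_err h); lra.
move=> [r /= r0 Hr]; exists r => // h h0 hr; apply: Hr => //=.
by rewrite /ball_/= sub0r normrN gtr0_norm.
Unshelve. all: by end_near. Qed.

(** Here f1 - f0 = h (T_(s+h) g + r), where the norm of r is at most [quotient_err h]
by contraction. The first term has the right sign by [generator_exp]. *)
Lemma orbit_step (B s h : R) f0 f1 : 0 <= s -> 0 < h ->
  f0 = T s phi %[ae mu] -> dom c f0 (T s g) ->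
  f1 = T (s + h) phi %[ae mu] -> dom c f1 (T (s + h) g) ->
  nrm c (fun x => expR (- lam * f1 x)) <= B ->
  ip mu setT (fun x => expR (- lam * f1 x)) (fun=> 1) <=
  ip mu setT (fun x => expR (- lam * f0 x)) (fun=> 1) + lam * h * (B * quotient_err h).
Proof.
move=> s0 h0 f0E d0 f1E d1 nB.
have W0 : W12 f0 by case: d0. have W1 : W12 f1 by case: d1.
have sphi := dom_sqint dphi; have sg : sqint mu setT g by case: dphi.
have sf0 := dom_sqint d0; have sf1 := dom_sqint d1.
have sV := exp_sqint (- lam) W1; have sh0 : 0 <= s + h by rewrite addr_ge0// ltW.
have sg1 := T_sqint hT sh0 sg.
have sB := sqintB (@mT R G) sf1 sf0.
pose r x := h^-1 * (f1 x - f0 x) - T (s + h) g x.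
have sr : sqint mu setT r by apply: sqintB => //; exact: (sqintZ (@mT R G)).
have rE : nrm c r <= quotient_err h.
  have sTg := T_sqint hT (ltW h0) sg.
  have sD := diff_sqint hT (ltW h0) sphi sTg.
  apply: le_trans (T_contract hT s0 sD).
  rewrite le_eqVlt; apply/orP; left; apply/eqP.
  apply: (nrm_ae sr (T_sqint hT s0 sD)).
  have e1 := T_add hT s0 (ltW h0) sphi; have e2 := T_add hT s0 (ltW h0) sg.
  have e3 := T_diff hT s0 (ltW h0) sphi sTg; have e4 := T_comm hT (ltW h0) s0 sphi.
  apply: filterS2 (filterI (filterI e1 e2) (filterI e3 e4)) (filterI f0E f1E) => x.
  move=> [[/(_ I) {}e1 /(_ I) {}e2] [/(_ I) {}e3 /(_ I) {}e4]] [/(_ I) {}f0E /(_ I) {}f1E] _.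
  by rewrite /r -e3 e4 -e1 -e2 f0E f1E.
have := exp_step lam0 W0 W1.
have -> : ip mu setT (fun x => expR (- lam * f1 x)) (fun x => f1 x - f0 x) =
    h * (ip mu setT (fun x => expR (- lam * f1 x)) r +
         ip mu setT (fun x => expR (- lam * f1 x)) (T (s + h) g)).
  rewrite -(ipDr (@mT R G) sr sg1 sV) -(ipZr (@mT R G) h (sqintD (@mT R G) sr sg1) sV).
  congr ip; apply/funext => x; rewrite /r subrK mulrA divff ?gt_eqF//.
  by rewrite mul1r.
have l0' : - lam <= 0 by rewrite oppr_le0 ltW.
have := generator_exp l0' d1; have := nrm_CS sV sr.
have : nrm c (fun x => expR (- lam * f1 x)) * nrm c r <= B * quotient_err h.
  by apply: ler_pM => //; exact: nrm_ge0.
rewrite ler_norml.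
move: (ip _ _ _ (fun=> 1)) (ip _ _ _ (fun=> 1)) (ip _ _ _ r) (ip _ _ _ (T _ g)) => p1 p0 i1 i2.
move: (nrm c _ * _) (B * _) => n1 b h1 /andP[h2 _] h3 h4.
have : 0 <= lam * h * (b + i1 + i2).
  by apply: mulr_ge0; [rewrite mulr_ge0 ?(ltW lam0) ?(ltW h0)|lra].
lra.
Qed.

(** The integral increases by at most (lam t / n) B [quotient_err (t / n)] in each of
n steps of length t / n, and the total of these tends to 0. *)
Lemma orbit_exp (a : R) phit : (forall x, a <= phi x) ->
  phit = T t phi %[ae mu] -> dom c phit (T t g) ->
  ip mu setT (fun x => expR (- lam * phit x)) (fun=> 1) <=
  expR (- lam * a) * total_mass c.
Proof.
move=> aphi phitE dphit.
have sphi := dom_sqint dphi; have Wphi : W12 phi by case: dphi.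
have sg : sqint mu setT g by case: dphi.
have Hrep s : exists f, 0 <= s -> f = T s phi %[ae mu] /\ dom c f (T s g).
  have [s0|_] := boolP (0 <= s); last by exists phi.
  by have [f fE df] := dom_T hT s0 dphi; exists f.
have {Hrep} /choice[rep Hrep] := Hrep.
pose N := ip mu setT phi phi + energy phi phi.
have [M M0 HM] : exists2 M, 0 <= M & forall s, 0 <= s -> forall x, - lam * rep s x <= M.
  (* the orbit is uniformly bounded, by the Sobolev inequality *)
  exists (lam * Num.sqrt (sup_const c * N)).
    by rewrite mulr_ge0 ?sqrtr_ge0// ltW.
  move=> s s0 x; have [fE df] := Hrep s s0; have Wf : W12 (rep s) by case: df.
  have h := sup_T hT E0 s0 Wphi Wf fE x; rewrite -/N in h.
  rewrite mulNr -mulrN ler_wpM2l ?(ltW lam0)//.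
  apply: sqr_le_abs; first exact: sqrtr_ge0.
  by rewrite sqrrN (sqr_sqrtr (le_trans (sqr_ge0 _) h)).
pose B := Num.sqrt (expR M ^+ 2 * total_mass c).
have HB s : 0 <= s -> nrm c (fun x => expR (- lam * rep s x)) <= B.
  move=> s0; have [_ df] := Hrep s s0; have Wf : W12 (rep s) by case: df.
  have sV := exp_sqint (- lam) Wf.
  apply: ler_wsqrtr; rewrite -ip_const; apply: le_Rintegral => //.
  - exact: (sqint_mul (@mT R G) sV sV).
  - exact: sqint_mul (sqint_const _ _) (sqint_const _ _).
  - move=> x _; rewrite mulr1 -expr2 lerXn2r ?nnegrE ?expR_ge0//.
    by rewrite ler_expR; exact: HM.
pose Psi s := ip mu setT (fun x => expR (- lam * rep s x)) (fun=> 1).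
have Psi_t f s : 0 <= s -> f = T s phi %[ae mu] -> W12 f ->
    Psi s = ip mu setT (fun x => expR (- lam * f x)) (fun=> 1).
  move=> s0 fE Wf; have [gE dg] := Hrep s s0; have Wg : W12 (rep s) by case: dg.
  apply: ip_ael; [exact: exp_sqint|exact: exp_sqint|exact: sqint_const|].
  by apply: filterS2 fE gE => x /(_ I) -> /(_ I) ->.
have step (h : R) (k : nat) : 0 < h ->
    Psi (k%:R * h) <= Psi 0 + k%:R * (lam * h * (B * quotient_err h)).
  move=> h0; elim: k => [|k IH]; first by rewrite !mul0r addr0.
  have k0 : 0 <= k%:R * h by rewrite mulr_ge0// ltW.
  have k1 : 0 <= k%:R * h + h by rewrite addr_ge0// ltW.
  have kE : k.+1%:R * h = k%:R * h + h by rewrite -natr1 mulrDl mul1r.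
  have [f0E d0] := Hrep _ k0; have [f1E d1] := Hrep _ k1.
  rewrite kE; apply: le_trans (orbit_step k0 h0 f0E d0 f1E d1 (HB _ k1)) _.
  by rewrite -natr1 mulrDl mul1r addrA lerD2r; exact: IH.
have W_t : W12 phit by case: dphit.
rewrite -(Psi_t phit t (ltW t0) phitE W_t).
have Psi0 : Psi 0 <= expR (- lam * a) * total_mass c.
  have phi0 : phi = T 0 phi %[ae mu].
    by apply: filterS (T_id hT sphi) => x /(_ I) ->.
  rewrite (Psi_t phi 0 (lexx 0) phi0 Wphi) -ip_const; apply: le_Rintegral => //.
  - exact: sqint_mul (exp_sqint _ Wphi) (sqint_const _ _).
  - exact: sqint_mul (sqint_const _ _) (sqint_const _ _).
  - by move=> x _; rewrite !mulr1 ler_expR !mulNr lerN2 ler_wpM2l ?(ltW lam0).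
apply: le_trans Psi0; apply/ler_addgt0Pl => e0 e00.
have B0 : 0 <= B by exact: sqrtr_ge0.
have C0 : 0 < lam * t * B + 1 by rewrite ltr_wpDl// !mulr_ge0// ltW.
have [r r0 Hr] := quotient_err_small (divr_gt0 e00 C0).
pose n := Num.truncn (t / r).
have n0 : 0 < n.+1%:R :> R by [].
have tn : t / n.+1%:R < r.
  rewrite ltr_pdivrMr// mulrC -ltr_pdivrMr//; exact: truncnS_gt.
have := step _ n.+1 (divr_gt0 t0 n0); rewrite mulrC divfK ?gt_eqF// => /le_trans; apply.
rewrite addrC lerD2r.
have -> : n.+1%:R * (lam * (t / n.+1%:R) * (B * quotient_err (t / n.+1%:R))) =
    (lam * t * B) * quotient_err (t / n.+1%:R).
  by field; rewrite gt_eqF.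
have h := Hr _ (divr_gt0 t0 n0) tn.
have D0 : 0 <= lam * t * B by rewrite !mulr_ge0// ltW.
apply: le_trans (ler_wpM2l D0 h) _.
by rewrite mulrCA ger_pMr// ler_pdivrMr// mul1r lerDl.
Qed.

End Orbit.

(** If T_t phi <= a - d on a set of mass eta, then [orbit_exp] would give
eta e^(lam d) <= [total_mass c], which fails for large lam. *)
Lemma min_principle_dom phi g (a t : R) phit : (0 < #|edge G|)%N -> 0 < t ->
  dom c phi g -> (forall x, a <= phi x) ->
  phit = T t phi %[ae mu] -> dom c phit (T t g) -> forall x, a <= phit x.
Proof.
move=> E0 t0 dphi aphi phitE dphit x; rewrite leNgt; apply/negP => xa.
have W_t : W12 phit by case: dphit.
have cphit : continuous phit by case: W_t.
have [eta [d [eta0 d0 H]]] := region_below E0 cphit xa.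
have M0 := total_mass_gt0 c E0.
(* by e^x >= 1 + x, this value of lam is large enough *)
pose lam := total_mass c / (eta * d).
have lam0 : 0 < lam by rewrite divr_gt0// mulr_gt0.
have h1 := orbit_exp dphi E0 lam0 t0 aphi phitE dphit.
have sW := exp_sqint (- (lam / 2)) W_t.
have h2 := H _ (expR (- (lam / 2) * (a - d))) sW (expR_ge0 _).
have {h2} : eta * expR (- (lam / 2) * (a - d)) ^+ 2 <= expR (- lam * a) * total_mass c.
  apply: le_trans (h2 _) _.
    by move=> y ya; rewrite ler_expR !mulNr lerN2 ler_wpM2l// divr_ge0// ltW.
  apply: le_trans h1; rewrite le_eqVlt; apply/orP; left; apply/eqP.
  by apply: eq_Rintegral => y _; rewrite mulr1 -expRD; congr expR; field.
have -> : expR (- (lam / 2) * (a - d)) ^+ 2 = expR (- lam * a) * expR (lam * d).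
  by rewrite expr2 -!expRD; congr expR; field.
rewrite mulrCA ler_pM2l ?expR_gt0// leNgt => /negP; apply.
have ld : lam * d = total_mass c / eta by rewrite /lam; field; rewrite !gt_eqF.
apply: (@lt_le_trans _ _ (eta * (1 + lam * d))).
  by rewrite ld mulrDr mulr1 mulrCA divff ?gt_eqF// mulr1 ltrDr.
by rewrite ler_pM2l// expR_ge1Dx.
Qed.

(** Approximate f by phi in the domain, with small energy of f - phi and equality at
the vertices. Then f - phi is uniformly small by [osc_le], and so is its heat
flow by [sup_T]. *)
Lemma min_principle f w (a t : R) : (0 < #|edge G|)%N -> 0 < t ->
  W12 f -> W12 w -> w = T t f %[ae mu] -> (forall x, a <= f x) -> forall x, a <= w x.
Proof.
move=> E0 t0 Wf Ww wE af x; apply/ler_addgt0Pl => e0 e00.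
(* with K r = (e0 / 2)^2, both f - phi and its heat flow are at most e0 / 2 *)
pose K := @osc_const R G ^+ 2 + sup_const c * (@osc_const R G ^+ 2 * total_mass c + 1) + 1.
have osc0 := @osc_const_gt0 R G; have M0 := total_mass_gt0 c E0; have S0 := sup_const_gt0 c E0.
have K0 : 0 < K.
  rewrite ltr_wpDl// addr_ge0 ?sqr_ge0// mulr_ge0 ?(ltW S0)// addr_ge0//.
  by rewrite mulr_ge0 ?sqr_ge0// ltW.
pose r := (e0 / 2) ^+ 2 / K.
have r0 : 0 < r by rewrite divr_gt0// exprn_gt0// divr_gt0.
have [phi [g [dphi phiV hE]]] := dom_dense c Wf r0.
have Wphi : W12 phi by case: dphi.
have Wu := W12B Wf Wphi; set u := fun x => _ in hE Wu.
have u_small y : u y ^+ 2 <= @osc_const R G ^+ 2 * r.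
  pose p := enum_val (Ordinal (vertex_gt0 G)).
  have := osc_le Wu y (Vertex p); rewrite {2}/u phiV subrr subr0 => h.
  apply: (@le_trans _ _ ((@osc_const R G * Num.sqrt r) ^+ 2)); last first.
    by rewrite exprMn sqr_sqrtr// ltW.
  rewrite -(real_normK (num_real (u y))); apply: lerXn2r_nneg => //.
    by rewrite mulr_ge0 ?sqrtr_ge0// ltW.
  by apply: le_trans h _; rewrite (ler_wpM2l (ltW osc0))//; exact: ler_wsqrtr.
have Kr : K * r = (e0 / 2) ^+ 2 by rewrite /r mulrC divfK// gt_eqF.
have e2 : 0 <= e0 / 2 by rewrite divr_ge0// ltW.
have u_e y : u y <= e0 / 2.
  apply: (sqr_le_abs e2); apply: le_trans (u_small y) _.
  rewrite -Kr; apply: (ler_wpM2r (ltW r0)).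
  rewrite /K -addrA lerDl addr_ge0// mulr_ge0 ?(ltW S0)// addr_ge0//.
  by rewrite mulr_ge0 ?sqr_ge0// ltW.
have [phit phitE dphit] := dom_T hT (ltW t0) dphi.
have W_t : W12 phit by case: dphit.
have h1 : a - e0 / 2 <= phit x.
  apply: (min_principle_dom E0 t0 dphi _ phitE dphit) => y.
  by have := u_e y; have := af y; rewrite /u; lra.
have sphi := dom_sqint dphi.
have sf : sqint mu setT f by case: Wf => cf _; exact: sqint_continuous.
have su : sqint mu setT u by exact: (sqintB (@mT R G)).
have Wd := W12B W_t Ww.
have Wnu := W12B Wphi Wf.
have dE : (fun x => phit x - w x) = T t (fun x => phi x - f x) %[ae mu].
  have e1 := T_sub hT (ltW t0) sphi sf.
  apply: filterS2 (filterI phitE wE) e1 => y [/(_ I) -> /(_ I) ->] /(_ I) ->.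
  by [].
have h2 := sup_T hT E0 (ltW t0) Wnu Wd dE x.
have snu : sqint mu setT (fun x => phi x - f x) by exact: (sqintB (@mT R G)).
have nuE : (fun x => phi x - f x) = (fun x => -1 * u x).
  by apply/funext => y; rewrite /u; ring.
have h3 : ip mu setT (fun x => phi x - f x) (fun x => phi x - f x) <=
    @osc_const R G ^+ 2 * r * total_mass c.
  rewrite -ip_const; apply: le_Rintegral => //.
  - exact: (sqint_mul (@mT R G) snu snu).
  - exact: (sqint_mul (@mT R G) (sqint_const _ _) (sqint_const _ _)).
  - by move=> y _; rewrite mulr1 -expr2 -sqrrN opprB; exact: u_small.
have h4 : energy (fun x => phi x - f x) (fun x => phi x - f x) <= r.
  rewrite nuE; have Wu' : W12 (fun x => -1 * u x) by rewrite -nuE.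
  rewrite (energyZl _ Wu Wu') (energyC u) (energyZl _ Wu Wu) mulrA mulrNN !mul1r.
  exact: hE.
have h5 : phit x - w x <= e0 / 2.
  apply: (sqr_le_abs e2); apply: le_trans h2 _; rewrite -Kr.
  apply: le_trans (ler_wpM2l (ltW S0) (lerD h3 h4)) _.
  rewrite (_ : sup_const c * _ =
    sup_const c * (@osc_const R G ^+ 2 * total_mass c + 1) * r); last by ring.
  apply: (ler_wpM2r (ltW r0)); rewrite /K -addrA addrCA lerDl.
  by rewrite addr_ge0// sqr_ge0.
lra.
Qed.

End Semigroup.

End MinimumPrinciple.

(** * Exponentials and logarithms of Sobolev functions *)

Section ExpLn.
Context {R : realType} {G : metricGraph R} (c : edge G -> {posnum R}).
Local Notation X := (graph_space G).
Local Notation mu := (graph_measure c).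
Local Notation leb := (@lebesgue_measure R).
Local Notation Io := (fun e : edge G =>
  (edge_interval e : set (measurableTypeR R))).
Implicit Types (e : edge G) (s t : R) (f g h : X -> R).

Lemma sum_ip_le (k df : edge G -> R -> R) (C : R) : 0 <= C ->
  (forall e, measurable_fun (Io e) (k e)) -> (forall e, sqint leb (Io e) (df e)) ->
  (forall e s, 0 <= s <= len e -> `|k e s| <= C) ->
  \sum_(e : edge G) ip leb (Io e) (fun s => k e s * df e s) (fun s => k e s * df e s) <=
  C ^+ 2 * \sum_(e : edge G) ip leb (Io e) (df e) (df e).
Proof.
move=> C0 mk sd kC; rewrite mulr_sumr; apply: ler_sum => e _.
have sC := sqintZ (mIo e) C (sd e).
apply: (@le_trans _ _ (ip leb (Io e) (fun s => C * df e s) (fun s => C * df e s))).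
  apply: (le_ip (mIo e) _ _ sC).
    by apply: measurable_funM; [exact: mk|exact: sqint_measurable (sd e)].
  move=> s; rewrite /edge_interval/= in_itv/= => /andP[/ltW h1 /ltW h2].
  by rewrite !normrM ler_wpM2r// (le_trans (kC e s _))// ?h1// ler_norm.
by rewrite (ipZl (mIo e) C (sd e) sC) (ipZr (mIo e) C (sd e) (sd e)) mulrA expr2.
Qed.

Lemma restr_measurable (f : X -> R) e : continuous f -> measurable_fun (Io e) (restr_edge f e).
Proof. by move=> cf; apply: restr_edge_measurable; exact: continuous_space_measurable. Qed.

Lemma energy_ln f (m : R) : 0 < m -> W12 f -> (forall x, m <= f x) ->
  W12 (fun x => ln (f x)) /\
  energy (fun x => ln (f x)) (fun x => ln (f x)) <= m^-1 ^+ 2 * energy f f.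
Proof.
move=> m0 Wf mf; have hf := W12_grad Wf; have hl := grad_ln m0 mf hf.
split; first exact: grad_W12 hl.
rewrite (energyE hl hl) (energyE hf hf).
have m1 : 0 <= m^-1 by rewrite invr_ge0 ltW.
have [cf _] := hf.
apply: (sum_ip_le m1 _ (fun e => grad_sqint e hf)) => [e|e s _].
  have [_ H] := hf.
  have [_ HI] := grad_W12 hl.
  exact: prim_measurable (prim_inv (len0 e) m0 (H e) (fun s _ _ => mf _)).
rewrite ger0_norm ?invr_ge0 ?(le_trans (ltW m0) (mf _))//.
by rewrite lef_pV2 ?posrE ?(lt_le_trans m0 (mf _))//; exact: mf.
Qed.

(** The derivative of ln f - ln f' is (df - df') / f' + (f' - f) df / (f f'). *)
Lemma energy_ln_sub f f' (m m' D : R) : 0 < m -> 0 < m' -> W12 f -> W12 f' ->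
  (forall x, m <= f x) -> (forall x, m' <= f' x) -> (forall x, `|f x - f' x| <= D) ->
  energy (fun x => ln (f x) - ln (f' x)) (fun x => ln (f x) - ln (f' x)) <=
  2 * (m'^-1 ^+ 2 * energy (fun x => f x - f' x) (fun x => f x - f' x)) +
  2 * ((m^-1 * m'^-1 * D) ^+ 2 * energy f f).
Proof.
move=> m0 m'0 Wf Wf' mf mf' fD; have hf := W12_grad Wf; have hf' := W12_grad Wf'.
have hl := gradB (grad_ln m0 mf hf) (grad_ln m'0 mf' hf').
have hB := gradB hf hf'.
rewrite (energyE hl hl) (energyE hB hB) (energyE hf hf).
have [cf H] := hf; have [cf' H'] := hf'.
have D0 : 0 <= D := le_trans (normr_ge0 _) (fD point).
pose df := edge_deriv f; pose df' := edge_deriv f'.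
pose F e := restr_edge f e; pose F' e := restr_edge f' e.
have Fm e s : m <= F e s by exact: mf. have F'm e s : m' <= F' e s by exact: mf'.
have F0 e s : 0 < F e s := lt_le_trans m0 (Fm e s).
have F'0 e s : 0 < F' e s := lt_le_trans m'0 (F'm e s).
have mI e := prim_measurable (prim_inv (len0 e) m0 (H e) (fun s _ _ => mf _)).
have mI' e := prim_measurable (prim_inv (len0 e) m'0 (H' e) (fun s _ _ => mf' _)).
have m1 : 0 <= m^-1 by rewrite invr_ge0 ltW.
have m1' : 0 <= m'^-1 by rewrite invr_ge0 ltW.
have vb e s : 0 <= (F e s)^-1 <= m^-1.
  by rewrite invr_ge0 (ltW (F0 e s))/= lef_pV2 ?posrE; [exact: Fm|exact: F0|].
have vb' e s : 0 <= (F' e s)^-1 <= m'^-1.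
  by rewrite invr_ge0 (ltW (F'0 e s))/= lef_pV2 ?posrE; [exact: F'm|exact: F'0|].
pose k2 e s := (F e s)^-1 * (F' e s)^-1 * (F' e s - F e s).
have mk2 e : measurable_fun (Io e) (k2 e).
  have a1 : measurable_fun (Io e) (fun s => (F e s)^-1) by exact: mI.
  have a2 : measurable_fun (Io e) (fun s => (F' e s)^-1) by exact: mI'.
  have a3 : measurable_fun (Io e) (F e) by exact: restr_measurable cf.
  have a4 : measurable_fun (Io e) (F' e) by exact: restr_measurable cf'.
  by apply: measurable_funM; [exact: measurable_funM|exact: measurable_funB].
have k2b e s : 0 <= s <= len e -> `|k2 e s| <= m^-1 * m'^-1 * D.
  move=> _; have /andP[a0 a1] := vb e s; have /andP[b0 b1] := vb' e s.
  rewrite /k2 !normrM (ger0_norm a0) (ger0_norm b0) distrC.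
  by apply: ler_pM => //; rewrite ?mulr_ge0//; [exact: ler_pM|exact: fD].
have sd e := grad_sqint e hf; have sB e := grad_sqint e hB.
have S1 : \sum_(e : edge G) ip leb (Io e) (fun s => (F' e s)^-1 * (df e s - df' e s))
    (fun s => (F' e s)^-1 * (df e s - df' e s)) <=
    m'^-1 ^+ 2 * \sum_(e : edge G) ip leb (Io e) (fun s => df e s - df' e s)
    (fun s => df e s - df' e s).
  apply: (sum_ip_le m1' mI' sB) => e s _.
  by have /andP[b0 b1] := vb' e s; rewrite (ger0_norm b0).
have C2 : 0 <= m^-1 * m'^-1 * D by rewrite !mulr_ge0.
have S2 := sum_ip_le C2 mk2 sd k2b.
apply: le_trans (lerD (ler_wpM2l (ler0n _ 2) S1) (ler_wpM2l (ler0n _ 2) S2)).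
rewrite !mulr_sumr -big_split/=; apply: ler_sum => e _.
have s1 : sqint leb (Io e) (fun s => (F' e s)^-1 * (df e s - df' e s)).
  apply: (sqint_bdM (mIo e) (mI' e) _ (sB e)) => s _.
  by have /andP[b0 b1] := vb' e s; rewrite (ger0_norm b0); exact: b1.
have s2 : sqint leb (Io e) (fun s => k2 e s * df e s).
  apply: (sqint_bdM (mIo e) (mk2 e) _ (sd e)) => s.
  rewrite /edge_interval/= in_itv/= => /andP[/ltW h1 /ltW h2].
  by apply: k2b; rewrite h1.
have := ip_sqrD (mIo e) s1 s2.
rewrite (_ : (fun s => _ + _) = (fun s => (F e s)^-1 * df e s - (F' e s)^-1 * df' e s))//.
apply/funext => s; rewrite /k2; field.
by rewrite !gt_eqF.
Qed.

(** The derivative splits, as in [energy_ln_sub], into a multiple of dh - dh' and the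
product of dh with the difference of the exponentials, which is estimated by
[exp_lip]. The factors 1/2 are bounded by 1. *)
Lemma initial_diff h h' (M M' d : R) : 0 <= M -> 0 <= M' -> W12 h -> W12 h' ->
  (forall x, `|h x| <= M) -> (forall x, `|h' x| <= M') -> (forall x, `|h x - h' x| <= d) ->
  let w x := expR (- 2^-1 * h x) - expR (- 2^-1 * h' x) in
  (forall x, `|w x| <= expR (M + M') * d) /\
  energy w w <= 2 * (expR (M + M') ^+ 2 * energy (fun x => h x - h' x) (fun x => h x - h' x)) +
     2 * ((expR (M + M') * d) ^+ 2 * energy h h).
Proof.
move=> M0 M'0 Wh Wh' hM hM' hd w.
have d0 : 0 <= d := le_trans (normr_ge0 _) (hd point).
have half (y C : R) : `|y| <= C -> `|- 2^-1 * y| <= C.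
  move=> yC; apply: (@le_trans _ _ `|y|) => //.
  have -> : `|- 2^-1 * y| = 2^-1 * `|y|.
    by rewrite normrM normrN (@gtr0_norm _ 2^-1)// invr_gt0.
  by have := normr_ge0 y; lra.
have w_le x : `|w x| <= expR (M + M') * d.
  apply: le_trans (@exp_lip R (M + M') _ _ _ _) _.
  - by have := hM x; rewrite ler_norml => /andP[? ?]; lra.
  - by have := hM' x; rewrite ler_norml => /andP[? ?]; lra.
  - by rewrite ler_wpM2l ?expR_ge0// -mulrBr; apply: half.
split => //.
have hh := W12_grad Wh; have hh' := W12_grad Wh'.
have hw := gradB (grad_expR (- 2^-1) hh) (grad_expR (- 2^-1) hh').
have hB := gradB hh hh'.
rewrite (energyE hw hw) (energyE hB hB) (energyE hh hh).
have [cw _] := hw; have [cV' _] := grad_expR (- 2^-1) hh'.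
have [cV _] := grad_expR (- 2^-1) hh.
pose E' e s := - 2^-1 * restr_edge (fun x => expR (- 2^-1 * h' x)) e s.
pose k2 e s := - 2^-1 * restr_edge w e s.
have mE' e : measurable_fun (Io e) (E' e).
  by apply: measurable_funM => //; exact: restr_measurable.
have mk2 e : measurable_fun (Io e) (k2 e).
  by apply: measurable_funM => //; exact: restr_measurable.
have E'b e s : 0 <= s <= len e -> `|E' e s| <= expR (M + M').
  move=> _; apply: half.
  rewrite ger0_norm ?expR_ge0// ler_expR.
  by have := hM' (edge_param e s); rewrite ler_norml => /andP[? ?]; lra.
have C2 : 0 <= expR (M + M') * d by rewrite mulr_ge0// expR_ge0.
have k2b e s : 0 <= s <= len e -> `|k2 e s| <= expR (M + M') * d.
  by move=> _; apply: half; exact: w_le.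
have sd e := grad_sqint e hh; have sB e := grad_sqint e hB.
have S1 := sum_ip_le (expR_ge0 _) mE' sB E'b.
have S2 := sum_ip_le C2 mk2 sd k2b.
apply: le_trans (lerD (ler_wpM2l (ler0n _ 2) S1) (ler_wpM2l (ler0n _ 2) S2)).
rewrite !mulr_sumr -big_split/=; apply: ler_sum => e _.
have bd (b : R) : (forall s, 0 <= s <= len e -> `|E' e s| <= b) ->
    forall s, Io e s -> `|E' e s| <= b.
  move=> Hb s; rewrite /edge_interval/= in_itv/= => /andP[/ltW h1 /ltW h2].
  by apply: Hb; rewrite h1.
have s1 := sqint_bdM (mIo e) (mE' e) (bd _ (E'b e)) (sB e).
have k2b' s : Io e s -> `|k2 e s| <= expR (M + M') * d.
  by rewrite /edge_interval/= in_itv/= => /andP[/ltW h1 /ltW h2]; apply: k2b; rewrite h1.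
have s2 := sqint_bdM (mIo e) (mk2 e) k2b' (sd e).
have := ip_sqrD (mIo e) s1 s2.
rewrite (_ : (fun s => _ + _) = (fun s =>
  - 2^-1 * expR (- 2^-1 * restr_edge h e s) * edge_deriv h e s -
  - 2^-1 * expR (- 2^-1 * restr_edge h' e s) * edge_deriv h' e s))//.
by apply/funext => s; rewrite /E' /k2 /w /restr_edge/=; ring.
Qed.

End ExpLn.

(** * Bounds for the solutions *)

Section BurgersBounds.
Context {R : realType} {G : metricGraph R} (c : edge G -> {posnum R}).
Local Notation X := (graph_space G).
Local Notation mu := (graph_measure c).
Local Notation leb := (@lebesgue_measure R).
Local Notation Io := (fun e : edge G =>
  (edge_interval e : set (measurableTypeR R))).
Implicit Types (e : edge G) (s t : R) (f g h : X -> R).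

Section Solutions.
Variables (T : R -> (X -> R) -> X -> R) (hT : is_heat_semigroup c T).

Definition data_bound h : R := @osc_const R G * L2norm c (dop c h).

Lemma L2norm_dop h : W12 h -> L2norm c (dop c h) = Num.sqrt (energy h h).
Proof. by move=> Wh; rewrite (L2normE (dop_sqint c Wh)) (ip_dop c Wh Wh). Qed.

Lemma L2norm_dop_sqr h : W12 h -> L2norm c (dop c h) ^+ 2 = energy h h.
Proof. by move=> Wh; rewrite L2norm_dop//; exact: sqr_sqrtr (energy_ge0 h). Qed.

Lemma L2norm_dop_ge0 h : W12 h -> 0 <= L2norm c (dop c h).
Proof. by move=> Wh; rewrite L2norm_dop//; exact: sqrtr_ge0. Qed.

Lemma data_bound_ge0 h : W12 h -> 0 <= data_bound h.
Proof.
by move=> Wh; exact: mulr_ge0 (ltW (@osc_const_gt0 R G)) (L2norm_dop_ge0 Wh).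
Qed.

Lemma data_boundP h (s0 : X) : W12 h -> h s0 = 0 -> forall x, `|h x| <= data_bound h.
Proof.
move=> Wh hs0 x; have := osc_le Wh x s0.
by rewrite hs0 subr0 /data_bound L2norm_dop.
Qed.

Lemma initE h : (fun x => expR (- h x / 2)) = (fun x => expR (- 2^-1 * h x)).
Proof. by apply/funext => x; congr expR; ring. Qed.

Lemma init_W12 h : W12 h -> W12 (fun x => expR (- 2^-1 * h x)).
Proof. by move=> /W12_grad hh; exact: grad_W12 (grad_expR (- 2^-1) hh). Qed.

Lemma init_energy h (M : R) : W12 h -> (forall x, `|h x| <= M) ->
  energy (fun x => expR (- 2^-1 * h x)) (fun x => expR (- 2^-1 * h x)) <=
  expR M * energy h h.
Proof.
move=> Wh hM; have hh := W12_grad Wh; have hw := grad_expR (- 2^-1) hh.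
have [cw _] := hw.
rewrite (energyE hw hw) (energyE hh hh).
have -> : expR M = expR (M / 2) ^+ 2 by rewrite expr2 -expRD; congr expR; field.
pose k e s : R := - 2^-1 * restr_edge (fun x => expR (- 2^-1 * h x)) e s.
have mk e : measurable_fun (Io e) (k e).
  by apply: measurable_funM => //; exact: restr_measurable.
apply: (sum_ip_le (expR_ge0 _) mk (fun e => grad_sqint e hh)) => e s _.
rewrite /k /restr_edge/= normrM normrN (@gtr0_norm _ 2^-1) ?invr_gt0//.
rewrite (ger0_norm (expR_ge0 _)).
apply: (@le_trans _ _ (expR (- 2^-1 * h (edge_param e s)))).
  by have := expR_ge0 (- 2^-1 * h (edge_param e s)); lra.
by rewrite ler_expR; have := hM (edge_param e s); rewrite ler_norml => /andP[? ?]; lra.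
Qed.

(** The bounds hold at time 0 since |h| <= [data_bound h], and persist by
[min_principle] and [energy_T]. *)
Lemma cole_hopf_bounds h (s0 : X) u t : (0 < #|edge G|)%N -> 0 < t -> W12 h -> h s0 = 0 ->
  the_burgers_solution c T h u -> exists w : X -> R,
  [/\ W12 w, w = T t (fun x => expR (- 2^-1 * h x)) %[ae mu],
      u t = (fun x => - 2 * dop c (fun y => ln (w y)) x) %[ae mu],
      forall x, expR (- (data_bound h / 2)) <= w x &
      energy w w <= expR (data_bound h) * energy h h].
Proof.
move=> E0 t0 Wh hs0 [_ [w Hw]]; have [Ww wE uE] := Hw t (ltW t0).
rewrite initE in wE; have hM := data_boundP Wh hs0; exists (w t); split => //.
  apply: (min_principle hT E0 t0 (init_W12 Wh) Ww wE) => x; rewrite ler_expR.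
  by have := hM x; rewrite ler_norml => /andP[? ?]; lra.
by apply: le_trans (energy_T hT (ltW t0) (init_W12 Wh) Ww wE) _; exact: init_energy.
Qed.

Lemma solution_sqint h u t : 0 <= t -> the_burgers_solution c T h u -> sqint mu setT (u t).
Proof. by move=> t0 [[H _ _ _] _]; apply/L2_sqint; exact: H. Qed.

Lemma no_edge_nrm f : #|edge G| = 0 -> sqint mu setT f -> nrm c f = 0.
Proof.
move=> E0 sf; rewrite /nrm (ip_sqr_graph sf) big1 ?sqrtr0// => e _.
by move: (fintype0 e E0).
Qed.

(** The operator d is isometric for the energy. *)
Lemma nrm_solution f (v : X -> R) : sqint mu setT f -> W12 v ->
  f = (fun x => - 2 * dop c v x) %[ae mu] -> nrm c f ^+ 2 = 4 * energy v v.
Proof.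
move=> sf Wv fE; have sd := dop_sqint c Wv; have sZ := sqintZ (@mT R G) (- 2) sd.
rewrite (nrm_ae sf sZ fE) nrm_sqr (ipZl (@mT R G) _ sd sZ) (ipZr (@mT R G) _ sd sd).
by rewrite (ip_dop c Wv Wv); move: (energy v v) => E; ring.
Qed.

Lemma invr_expR_half_sqr (r : R) : (expR (- (r / 2)))^-1 ^+ 2 = expR r.
Proof. by rewrite expRN invrK expr2 -expRD; congr expR; field. Qed.

Lemma solution_bound h (s0 : X) u t : 0 < t -> W12 h -> h s0 = 0 ->
  the_burgers_solution c T h u ->
  nrm c (u t) <= 2 * L2norm c (dop c h) * expR (data_bound h).
Proof.
move=> t0 Wh hs0 hu; have su := solution_sqint (ltW t0) hu.
have n0 := L2norm_dop_ge0 Wh.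
have [E0|E0] := posnP #|edge G|.
  by rewrite no_edge_nrm// mulr_ge0 ?expR_ge0// mulr_ge0.
have [w [Ww wE uE wm wW]] := cole_hopf_bounds E0 t0 Wh hs0 hu.
have m0 : 0 < expR (- (data_bound h / 2)) by exact: expR_gt0.
have [Wl lE] := energy_ln m0 Ww wm.
apply: sqr_le_abs; first by rewrite mulr_ge0 ?expR_ge0// mulr_ge0.
rewrite (nrm_solution su Wl uE) !exprMn (L2norm_dop_sqr Wh).
rewrite invr_expR_half_sqr in lE.
move: lE wW (expR_gt0 (data_bound h)) => + + ep.
move: (expR (data_bound h)) ep => p p0 l1 l2.
have := ler_wpM2l (ltW p0) l2.
move: l1; move: (energy _ _) (energy w w) (energy h h) => a b d l1 l3.
have := ler_wpM2l (ler0n _ 4) (le_trans l1 l3).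
by rewrite (_ : 2 ^+ 2 * d * p ^+ 2 = 4 * (p * (p * d))); last by ring.
Qed.

(** The first two terms come from the energy of the difference of the solutions of
the heat equation, the others from its supremum. *)
Definition stab_const : R := @osc_const R G ^+ 2 + 1 +
  sup_const c * (@osc_const R G ^+ 2 * total_mass c + @osc_const R G ^+ 2 + 1).

Lemma sup_const_ge0 : 0 <= sup_const c.
Proof.
apply: addr_ge0; last by rewrite mulr_ge0// sqr_ge0.
rewrite divr_ge0//; apply: sumr_ge0 => e _; exact: mulr_ge0 (ltW (gt0 _)) (len0 e).
Qed.

Lemma total_mass_ge0 : 0 <= total_mass c.
Proof. by apply: sumr_ge0 => e _; exact: mulr_ge0 (ltW (gt0 _)) (len0 e). Qed.

Lemma stab_const_gt0 : 0 < stab_const.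
Proof.
rewrite ltr_wpDr//; last by rewrite ltr_wpDl// sqr_ge0.
rewrite mulr_ge0 ?sup_const_ge0// !addr_ge0 ?sqr_ge0// mulr_ge0 ?sqr_ge0//.
exact: total_mass_ge0.
Qed.

(** The final estimate, with p = e^M, p' = e^M', n and d the norms of u0 and of
u0 - u0', o = [osc_const], S = [sup_const c] and m = [total_mass c]. For the
difference of the two heat flows, Ew0 and N are the energy and the squared L^2
norm at time 0, W is the energy at time t, and D2 bounds the squared supremum.
Ew is the energy of w, and E that of ln w - ln w'. Every factor is bounded by
powers of P = p p' >= 1 and k = (n + 1)^2 >= 1. *)
Lemma stability_algebra (o S m n d p p' Ew0 Ew N E D2 W : R) :
  0 <= S -> 0 <= m -> 1 <= p -> 1 <= p' -> 0 <= n -> 0 <= Ew ->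
  Ew0 <= 2 * ((p * p') ^+ 2 * d ^+ 2) + 2 * ((p * p' * (o * d)) ^+ 2 * n ^+ 2) ->
  N <= (p * p' * (o * d)) ^+ 2 * m ->
  D2 <= S * (N + Ew0) -> W <= Ew0 -> Ew <= p * n ^+ 2 ->
  E <= 2 * (p' * W) + 2 * (p * p' * D2 * Ew) ->
  E <= 4 * (o ^+ 2 + 1 + S * (o ^+ 2 * m + o ^+ 2 + 1)) * (p * p') ^+ 4 * (n + 1) ^+ 4 * d ^+ 2.
Proof.
move=> S0 m0 p1 p'1 n0 Ew00 hEw0 hN hD hW hEw hE.
have p0 : 0 <= p by exact: le_trans ler01 p1.
have p'0 : 0 <= p' by exact: le_trans ler01 p'1.
pose P := p * p'; pose k := (n + 1) ^+ 2; pose Q := P ^+ 2 * d ^+ 2.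
have P1 : 1 <= P by rewrite -[1]mulr1 ler_pM.
have P0 : 0 <= P by exact: le_trans ler01 P1.
have pP : p <= P by rewrite ler_peMr.
have p'P : p' <= P by rewrite ler_peMl.
have PP : P <= P ^+ 2 by rewrite expr2 ler_peMr.
have n20 : 0 <= n ^+ 2 by exact: sqr_ge0.
have k1 : 1 <= k by rewrite /k sqrrD mulr1 expr1n; lra.
have nk : n ^+ 2 <= k by rewrite /k sqrrD mulr1 expr1n; lra.
have k0 : 0 <= k by exact: le_trans ler01 k1.
have kk : k <= k ^+ 2 by rewrite expr2 ler_peMr.
have Q0 : 0 <= Q by rewrite mulr_ge0 ?sqr_ge0.
have o0 : 0 <= o ^+ 2 by exact: sqr_ge0.
have Qk : Q <= Q * k by rewrite ler_peMr.
have Qkk : Q * k <= Q * k ^+ 2 by rewrite ler_wpM2l.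
have bEw0 : Ew0 <= 2 * (1 + o ^+ 2) * (Q * k).
  apply: le_trans hEw0 _.
  rewrite (_ : _ + _ = 2 * Q + 2 * o ^+ 2 * (Q * n ^+ 2)); last by rewrite /Q /P; ring.
  rewrite (_ : 2 * (1 + o ^+ 2) * (Q * k) = 2 * (Q * k) + 2 * o ^+ 2 * (Q * k)); last by ring.
  apply: lerD; first exact: (ler_wpM2l (ler0n _ 2) Qk).
  exact: (ler_wpM2l (mulr_ge0 (ler0n _ 2) o0) (ler_wpM2l Q0 nk)).
have bN : N <= o ^+ 2 * m * (Q * k).
  apply: le_trans hN _.
  rewrite (_ : _ * m = o ^+ 2 * m * Q); last by rewrite /Q /P; ring.
  exact: (ler_wpM2l (mulr_ge0 o0 m0) Qk).
pose S' := S * (o ^+ 2 * m + 2 * (1 + o ^+ 2)).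
have om0 : 0 <= o ^+ 2 * m by rewrite mulr_ge0.
have o20 : 0 <= 2 * (1 + o ^+ 2) by rewrite mulr_ge0// addr_ge0.
have S'0 : 0 <= S' := mulr_ge0 S0 (addr_ge0 om0 o20).
have k20 : 0 <= k ^+ 2 by exact: sqr_ge0.
have bD : D2 <= S' * (Q * k).
  apply: le_trans hD _; rewrite /S' -mulrA; apply: ler_wpM2l => //.
  by rewrite mulrDl; exact: lerD.
have Qk0 : 0 <= Q * k by rewrite mulr_ge0.
have bE1 : p' * W <= P ^+ 2 * (2 * (1 + o ^+ 2) * (Q * k ^+ 2)).
  apply: (@le_trans _ _ (p' * (2 * (1 + o ^+ 2) * (Q * k ^+ 2)))).
    apply: ler_wpM2l => //; apply: le_trans hW _; apply: le_trans bEw0 _.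
    exact: (ler_wpM2l o20 Qkk).
  apply: ler_wpM2r; last exact: le_trans p'P PP.
  exact: (mulr_ge0 o20 (mulr_ge0 Q0 k20)).
have bE2 : P * D2 * Ew <= P ^+ 2 * (S' * (Q * k ^+ 2)).
  apply: (@le_trans _ _ (P * (S' * (Q * k)) * Ew)).
    by apply: ler_wpM2r => //; apply: ler_wpM2l.
  apply: (@le_trans _ _ (P * (S' * (Q * k)) * (P * k))).
    apply: ler_wpM2l; first exact: (mulr_ge0 P0 (mulr_ge0 S'0 Qk0)).
    exact: (le_trans hEw (ler_pM p0 n20 pP nk)).
  by rewrite (_ : _ * (P * k) = P ^+ 2 * (S' * (Q * k ^+ 2)))//; ring.
apply: le_trans hE _; rewrite -/P.
apply: le_trans (lerD (ler_wpM2l (ler0n _ 2) bE1) (ler_wpM2l (ler0n _ 2) bE2)) _.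
rewrite (_ : 4 * _ * P ^+ 4 * (n + 1) ^+ 4 * d ^+ 2 =
  2 * (P ^+ 2 * (2 * (1 + o ^+ 2) * (Q * k ^+ 2))) +
  2 * (P ^+ 2 * (2 * (S * (o ^+ 2 * m + o ^+ 2 + 1)) * (Q * k ^+ 2)))); last first.
  by rewrite /Q /k; ring.
rewrite lerD2l; apply: ler_wpM2l => //; apply: ler_wpM2l; first exact: sqr_ge0.
apply: ler_wpM2r; first exact: (mulr_ge0 Q0 k20).
rewrite /S' mulrCA; apply: ler_wpM2l => //.
have : 0 <= o ^+ 2 * m by rewrite mulr_ge0.
lra.
Qed.

Lemma invr_expR_half_mul_sqr (r r' x : R) :
  ((expR (- (r / 2)))^-1 * (expR (- (r' / 2)))^-1 * x) ^+ 2 = expR r * expR r' * x ^+ 2.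
Proof. by rewrite 2!exprMn (invr_expR_half_sqr r) (invr_expR_half_sqr r'). Qed.

Lemma final_algebra (q K P n d E : R) : q ^+ 2 = K ->
  E <= 4 * K * P ^+ 4 * (n + 1) ^+ 4 * d ^+ 2 ->
  4 * E <= (4 * q * (n + 1) ^+ 2 * P ^+ 2 * d) ^+ 2.
Proof.
move=> <- /(ler_wpM2l (ler0n _ 4)) h; apply: le_trans h _.
by rewrite le_eqVlt; apply/orP; left; apply/eqP; ring.
Qed.

Lemma solution_stability h h' (s0 : X) u u' t : 0 < t ->
  W12 h -> h s0 = 0 -> the_burgers_solution c T h u ->
  W12 h' -> h' s0 = 0 -> the_burgers_solution c T h' u' ->
  nrm c (fun x => u t x - u' t x) <=
  4 * Num.sqrt stab_const * (L2norm c (dop c h) + 1) ^+ 2 *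
  expR (2 * @osc_const R G * (L2norm c (dop c h) + L2norm c (dop c h'))) *
  L2norm c (dop c h \- dop c h').
Proof.
move=> t0 Wh hs0 hu Wh' hs0' hu'.
have su := solution_sqint (ltW t0) hu; have su' := solution_sqint (ltW t0) hu'.
have sB := sqintB (@mT R G) su su'.
pose n := L2norm c (dop c h); pose n' := L2norm c (dop c h').
have n0 : 0 <= n by exact: L2norm_dop_ge0.
have Wd := W12B Wh Wh'.
pose d := L2norm c (dop c h \- dop c h').
have dE : d = Num.sqrt (energy (fun x => h x - h' x) (fun x => h x - h' x)).
  rewrite -(ip_dopB c Wh Wh'); apply: L2normE.
  exact: (sqintB (@mT R G) (dop_sqint c Wh) (dop_sqint c Wh')).
have d0 : 0 <= d by rewrite dE; exact: sqrtr_ge0.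
have d2 : d ^+ 2 = energy (fun x => h x - h' x) (fun x => h x - h' x).
  by rewrite dE; exact: sqr_sqrtr (energy_ge0 _).
rewrite -/n -/n' -/d.
pose o := @osc_const R G; have o0 : 0 < o by exact: osc_const_gt0.
rewrite -/o.
(* without edges, the graph is a point of mass 0 *)
have [E0|E0] := posnP #|edge G|.
  rewrite no_edge_nrm//; apply: mulr_ge0 => //; apply: mulr_ge0; last exact: expR_ge0.
  by apply: mulr_ge0; [rewrite mulr_ge0// sqrtr_ge0|exact: sqr_ge0].
have [w [Ww wE uE wm wW]] := cole_hopf_bounds E0 t0 Wh hs0 hu.
have [w' [Ww' wE' uE' wm' wW']] := cole_hopf_bounds E0 t0 Wh' hs0' hu'.
pose M := data_bound h; pose M' := data_bound h'.
have M0 : 0 <= M by exact: data_bound_ge0.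
have M'0 : 0 <= M' by exact: data_bound_ge0.
have hhd x : `|h x - h' x| <= o * d.
  have := osc_le Wd x s0; rewrite hs0 hs0' subrr subr0 => /le_trans; apply.
  by rewrite dE.
have [w0b w0e] := initial_diff M0 M'0 Wh Wh' (data_boundP Wh hs0) (data_boundP Wh' hs0') hhd.
set w0 := fun x => _ in w0b w0e.
have Ww0 : W12 w0 by exact: W12B (init_W12 Wh) (init_W12 Wh').
have Wdw := W12B Ww Ww'.
have sw0 f : W12 f -> sqint mu setT f by case=> cf _; exact: sqint_continuous.
have diffE : (fun x => w x - w' x) = T t w0 %[ae mu].
  have e1 := T_sub hT (ltW t0) (sw0 _ (init_W12 Wh)) (sw0 _ (init_W12 Wh')).
  by apply: filterS2 (filterI wE wE') e1 => x [/(_ I) -> /(_ I) ->] /(_ I) ->.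
have supD := sup_T hT E0 (ltW t0) Ww0 Wdw diffE.
have enD := energy_T hT (ltW t0) Ww0 Wdw diffE.
have N0 : ip mu setT w0 w0 <= (expR (M + M') * (o * d)) ^+ 2 * total_mass c.
  rewrite -ip_const; apply: le_Rintegral => //.
  - exact: (sqint_mul (@mT R G) (sw0 _ Ww0) (sw0 _ Ww0)).
  - exact: (sqint_mul (@mT R G) (sqint_const _ _) (sqint_const _ _)).
  - move=> x _; rewrite mulr1 -expr2 -(real_normK (num_real (w0 x))).
    apply: lerXn2r_nneg; [exact: normr_ge0|exact: le_trans (normr_ge0 _) (w0b x)|exact: w0b].
pose A := sup_const c * (ip mu setT w0 w0 + energy w0 w0).
have A0 : 0 <= A := le_trans (sqr_ge0 _) (supD point).
(* D bounds the supremum of w - w' *)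
have [D D0 D2] : exists2 D, 0 <= D & D ^+ 2 = A.
  by exists (Num.sqrt A); [exact: sqrtr_ge0|exact: sqr_sqrtr].
have wD x : `|w x - w' x| <= D.
  by apply: (sqr_le_abs D0); rewrite real_normK ?num_real// D2; exact: supD.
have lnE := energy_ln_sub (expR_gt0 _) (expR_gt0 _) Ww Ww' wm wm' wD.
have Wl : W12 (fun x => ln (w x)) by have [] := energy_ln (expR_gt0 _) Ww wm.
have Wl' : W12 (fun x => ln (w' x)) by have [] := energy_ln (expR_gt0 _) Ww' wm'.
have Wll := W12B Wl Wl'.
have nE : nrm c (fun x => u t x - u' t x) ^+ 2 =
    4 * energy (fun x => ln (w x) - ln (w' x)) (fun x => ln (w x) - ln (w' x)).
  have sd := dop_sqint c Wl; have sd' := dop_sqint c Wl'.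
  have sdB := sqintB (@mT R G) sd sd'; have sZ := sqintZ (@mT R G) (- 2) sdB.
  have uuE : (fun x => u t x - u' t x) =
      (fun x => - 2 * (dop c (fun y => ln (w y)) x - dop c (fun y => ln (w' y)) x)) %[ae mu].
    by apply: filterS2 uE uE' => x /(_ I) -> /(_ I) -> _; ring.
  rewrite (nrm_ae sB sZ uuE) nrm_sqr (ipZl (@mT R G) _ sdB sZ) (ipZr (@mT R G) _ sdB sdB).
  by rewrite (ip_dopB c Wl Wl'); move: (energy _ _) => E; ring.
have pE : expR (M + M') = expR M * expR M' by exact: expRD.
have p1 r : 0 <= r -> 1 <= expR r :> R by move=> r0; rewrite -expR0 ler_expR.
rewrite (invr_expR_half_mul_sqr M M' D) (invr_expR_half_sqr M') D2 in lnE.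
rewrite pE in w0e N0; rewrite -d2 -(L2norm_dop_sqr Wh) -/n in w0e.
rewrite -(L2norm_dop_sqr Wh) -/n -/M in wW.
have Efin := stability_algebra sup_const_ge0 total_mass_ge0 (p1 _ M0) (p1 _ M'0) n0
  (energy_ge0 w) w0e N0 (lexx _) enD wW lnE.
have r0 : 0 <= 4 * Num.sqrt stab_const * (n + 1) ^+ 2 * expR (2 * o * (n + n')) * d.
  apply: mulr_ge0 => //; apply: mulr_ge0; last exact: expR_ge0.
  by apply: mulr_ge0; [rewrite mulr_ge0// sqrtr_ge0|exact: sqr_ge0].
apply: (sqr_le_abs r0); rewrite nE.
have -> : expR (2 * o * (n + n')) = (expR M * expR M') ^+ 2.
  rewrite -expRD expr2 -expRD; congr expR; rewrite /M /M' /data_bound -/n -/n' -/o; ring.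
exact: (final_algebra (sqr_sqrtr (ltW stab_const_gt0)) Efin).
Qed.

End Solutions.

End BurgersBounds.

Theorem corollary2p2 (R : realType) (G : metricGraph R)
    (c : edge G -> {posnum R}) (T : R -> (graph_space G -> R) -> graph_space G -> R)
    (hT : is_heat_semigroup c T) :
  (exists c1 c2 : R, [/\ 0 < c1, 0 < c2 &
    forall (h0 : graph_space G -> R) (u : R -> graph_space G -> R),
      W12 h0 -> the_burgers_solution c T h0 u ->
      (exists s0 : graph_space G, h0 s0 = 0) ->
      (ereal_sup [set 'N[graph_measure c]_2%:E[EFin \o u t] |
                  t in [set t : R | (0 < t)%R]] <=
       (c1 * L2norm c (dop c h0) * expR (c2 * L2norm c (dop c h0)))%R%:E)%E])
  /\
  (exists c3 c4 : R, [/\ 0 < c3, 0 < c4 &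
    forall (s0 : graph_space G) (h0 h0' : graph_space G -> R) (u u' : R -> graph_space G -> R),
      W12 h0 -> the_burgers_solution c T h0 u -> h0 s0 = 0 ->
      W12 h0' -> the_burgers_solution c T h0' u' -> h0' s0 = 0 ->
      (ereal_sup [set 'N[graph_measure c]_2%:E[EFin \o (u t \- u' t)%R] |
                  t in [set t : R | (0 < t)%R]] <=
       (c3 * (L2norm c (dop c h0) + 1) ^+ 2 *
        expR (c4 * (L2norm c (dop c h0) + L2norm c (dop c h0'))) *
        L2norm c (dop c h0 \- dop c h0'))%R%:E)%E]).
Proof.
have o0 := @osc_const_gt0 R G; split.
- exists 2, (@osc_const R G); split => // h0 u Wh hu [s0 hs0].
  apply: ub_ereal_sup => _ [t t0 <-].
  rewrite (LnormE (solution_sqint (ltW t0) hu)) lee_fin.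
  exact: (solution_bound hT t0 Wh hs0 hu).
exists (4 * Num.sqrt (stab_const c)), (2 * @osc_const R G); split.
- by rewrite mulr_gt0// sqrtr_gt0 stab_const_gt0.
- by rewrite mulr_gt0.
move=> s0 h0 h0' u u' Wh hu hs0 Wh' hu' hs0'.
apply: ub_ereal_sup => _ [t t0 <-].
have suu := sqintB (@mT R G) (solution_sqint (ltW t0) hu) (solution_sqint (ltW t0) hu').
rewrite (LnormE suu) lee_fin.
exact: (solution_stability hT t0 Wh hs0 hu Wh' hs0' hu').
Qed.
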